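(* Assume: (consistency) $Y=Y(A)$; (latent ignorability) for any $a\in\mathcal{A}$, $Y(a)$ is conditionally independent of $\{A,Z\}$ given $(U,L)$; (IV independence) $Z$ is conditionally independent of $U$ given $L$; (IV relevance) for any $a\in\mathcal{A}$ and $l\in\mathcal{L}$, $Z$ and $I\{A=a\}$ are not conditionally independent given $L=l$, i.e. there exist two distinct $z_0,z_1\in\mathcal{Z}$ with $\Pr(A=a\mid Z=z_0,L=l)\neq\Pr(A=a\mid Z=z_1,L=l)$. Let $a\in\mathcal{A}$, $A^{(a)}:=I\{A=a\}$, and assume that $\pi(Z,L)=Z$ is a regular weighting function for $A=a$. Let $$\psi_{a,MIV}^o:=\mathbb{E}\left[(1-A^{(a)})\frac{\mathrm{Cov}\{A^{(a)}Y,Z\mid L\}}{\mathrm{Cov}\{A^{(a)},Z\mid L\}}+A^{(a)}Y\right].$$ Then, in the nonparametric model for the law of $O=(Z,A,Y,L)$, the efficient influence function for $\psi^o_{a,MIV}$ is $$(1-A^{(a)})\gamma_a^o(L)+A^{(a)}Y-\psi^o_{a,MIV}+\frac{1-\delta_a^o(L)}{\kappa_a^o(L)}\left(A^{(a)}Y-\eta_a^o(L)\right)(Z-\rho^o(L))-\frac{1-\delta_a^o(L)}{\kappa_a^o(L)}\gamma_a^o(L)\left(A^{(a)}-\delta_a^o(L)\right)(Z-\rho^o(L)).$$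
   Context: $A\in\mathcal{A}=\{0,\dots,M\}$ is a treatment, $Z\in\mathcal{Z}\subseteq\mathbb{R}$ a univariate instrument, $U$ unmeasured confounders, $L\in\mathcal{L}$ observed covariates, $Y\in\mathbb{R}$ the outcome, $Y(a)$ the potential outcome at level $a$. $Z$ is a regular weighting function for $A=a$ if it is uniformly bounded and there exists $\epsilon_0>0$ with $|\mathrm{Cov}\{I\{A=a\},Z\mid L\}|\ge\epsilon_0$ uniformly for all $L$. Nuisance functions: $\delta_a^o(L)=\mathbb{E}[A^{(a)}\mid L]$, $\eta_a^o(L)=\mathbb{E}[A^{(a)}Y\mid L]$, $\kappa_a^o(L)=\mathrm{Cov}\{A^{(a)},Z\mid L\}$, $\rho^o(L)=\mathbb{E}[Z\mid L]$, $\gamma_a^o(L)=\mathrm{Cov}\{A^{(a)}Y,Z\mid L\}/\mathrm{Cov}\{A^{(a)},Z\mid L\}$. The semiparametric analysis is in the fully nonparametric model for the observed data (tangent space equal to all mean-zero square-integrable functions of $O$), so the efficient influence function is the unique mean-zero square-integrable $\varphi$ with $\frac{d}{d\theta}\psi_{a,MIV}(P_\theta)|_{\theta=0}=\mathbb{E}[\varphi(O)s(O)]$ for every regular parametric submodel $P_\theta$ through the true law with score $s$ at $\theta=0$, where $\psi_{a,MIV}(P)$ is the displayed functional evaluated under $P$.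
   Formalization: The formal theorem also assumes E[(A^(a)Y)^2] finite, and regular submodels are those differentiable in quadratic mean along which, near θ=0, E[(A^(a)Y)^2] stays bounded and Z stays a regular weighting function with uniform bounds; conditions on L hold almost surely. *)

(* Defs.v *)
From HB Require Import structures.
From mathcomp Require Import all_boot all_order all_algebra.
From mathcomp Require Import all_classical all_reals all_analysis.

Set Implicit Arguments.
Unset Strict Implicit.
Unset Printing Implicit Defensive.

Import Order.TTheory GRing.Theory Num.Theory.
Import numFieldNormedType.Exports.

Local Open Scope classical_set_scope.
Local Open Scope ring_scope.

(* The discrete sigma-algebra on the finite set {0, ..., M} of treatments. *)
HB.instance Definition _ (M : nat) := isPointed.Build 'I_M.+1 ord0.
HB.instance Definition _ (M : nat) := @isMeasurable.Build
  default_measure_display 'I_M.+1 discrete_measurable discrete_measurable0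
  discrete_measurableC discrete_measurableU.

Section conditional_expectation.
Context {d dW : measure_display} {T : measurableType d}
  {TW : measurableType dW} {R : realType}.
Implicit Types (P : probability T R) (W : T -> TW) (f X Y : T -> R).

(* g is a version of w |-> E[f | W = w]. *)
Definition is_condE P W f (g : TW -> R) : Prop :=
  [/\ measurable_fun setT g,
      P.-integrable setT (fun x => (g (W x))%:E) &
      forall B, measurable B ->
        (\int[P]_(x in W @^-1` B) (g (W x))%:E =
         \int[P]_(x in W @^-1` B) (f x)%:E)%E].

(* A chosen version; for measurable W and integrable f one exists and any two
   agree almost everywhere for the law of W.  Outside that case, the value is
   irrelevant (zero if there is no version). *)
Definition condE P W f : TW -> R := xget (cst 0) [set g | is_condE P W f g].

Definition condCov P W X Y : TW -> R :=
  fun w => condE P W (fun x => X x * Y x) w - condE P W X w * condE P W Y w.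

Definition cond_indep {d1 d2 : measure_display} {T1 : measurableType d1}
    {T2 : measurableType d2} P (X : T -> T1) (Y : T -> T2) W : Prop :=
  forall (B : set T1) (C : set T2), measurable B -> measurable C ->
    {ae P, forall x, condE P W \1_(X @^-1` B `&` Y @^-1` C) (W x) =
                     condE P W \1_(X @^-1` B) (W x) *
                     condE P W \1_(Y @^-1` C) (W x)}.

(* K is a regular conditional law of X given W. *)
Definition is_cond_law {d1 : measure_display} {T1 : measurableType d1}
    P (X : T -> T1) W (K : R.-pker TW ~> T1) : Prop :=
  forall (B : set TW) (C : set T1), measurable B -> measurable C ->
    P (W @^-1` B `&` X @^-1` C) = (\int[P]_(x in W @^-1` B) K (W x) C)%E.

Definition has_law {d1 : measure_display} {T1 : measurableType d1}
    P (X : T -> T1) (Q : probability T1 R) : Prop :=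
  forall B, measurable B -> Q B = P (X @^-1` B).

Definition sq_integrable P f : Prop :=
  measurable_fun setT f /\ P.-integrable setT (fun x => (f x ^+ 2)%:E).

End conditional_expectation.

(* Under the law Q of (Z, A), Z and I{A = a} are independent. *)
Definition indep_treatment {R : realType} {M : nat} (a : 'I_M.+1)
    (Q : set (R * 'I_M.+1)%type -> \bar R) : Prop :=
  forall B : set R, measurable B ->
    Q (B `*` [set a]) = (Q (B `*` setT) * Q (setT `*` [set a]))%E.

(* Conditional laws given L = l are determined only up to null sets of l, hence
   the dependence of Z and I{A = a} for almost every l. *)
Definition iv_relevant {R : realType} {dO dL : measure_display}
    {Omega : measurableType dO} {TL : measurableType dL} {M : nat}
    (P : probability Omega R) (Z : Omega -> R) (A : Omega -> 'I_M.+1)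
    (L : Omega -> TL) : Prop :=
  exists2 K : R.-pker TL ~> (R * 'I_M.+1)%type,
    is_cond_law P (fun w => (Z w, A w)) L K &
    forall a : 'I_M.+1, {ae P, forall w, ~ indep_treatment a (K (L w))}.

(* Values of O = (Z, A, Y, L). *)
Notation obs_type R M TL := (R * 'I_M.+1 * R * TL)%type (only parsing).

Section observed_data.
Context {R : realType} {M : nat} {dL : measure_display}
  {TL : measurableType dL}.

Local Notation obs := (obs_type R M TL).

Definition obsZ (o : obs) : R := o.1.1.1.
Definition obsA (o : obs) : 'I_M.+1 := o.1.1.2.
Definition obsY (o : obs) : R := o.1.2.
Definition obsL (o : obs) : TL := o.2.

Implicit Types (P : probability obs R) (a : 'I_M.+1).

Definition treat a (o : obs) : R := (obsA o == a)%:R.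
Definition treatY a (o : obs) : R := treat a o * obsY o.

Definition delta P a : TL -> R := condE P obsL (treat a).
Definition eta P a : TL -> R := condE P obsL (treatY a).
Definition kappa P a : TL -> R := condCov P obsL (treat a) obsZ.
Definition rho P : TL -> R := condE P obsL obsZ.
Definition gamma P a : TL -> R :=
  fun l => condCov P obsL (treatY a) obsZ l / condCov P obsL (treat a) obsZ l.

Definition psi_MIV a P : R :=
  \int[P]_o ((1 - treat a o) * gamma P a (obsL o) + treatY a o).

Definition eif_MIV a P (o : obs) : R :=
  (1 - treat a o) * gamma P a (obsL o) + treatY a o - psi_MIV a P
  + (1 - delta P a (obsL o)) / kappa P a (obsL o)
    * (treatY a o - eta P a (obsL o)) * (obsZ o - rho P (obsL o))
  - (1 - delta P a (obsL o)) / kappa P a (obsL o) * gamma P a (obsL o)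
    * (treat a o - delta P a (obsL o)) * (obsZ o - rho P (obsL o)).

(* The weighting function pi(Z, L) = Z is bounded by c, and its conditional
   covariance with I{A = a} is bounded away from zero by e. *)
Definition regular_weighting_bounds a (c e : R) P : Prop :=
  {ae P, forall o, `|obsZ o| <= c} /\
  {ae P, forall o, e <= `|kappa P a (obsL o)|}.

Definition regular_weighting a P : Prop :=
  exists c e : R, 0 < e /\ regular_weighting_bounds a c e P.

(* Differentiability in quadratic mean at t = 0, with score s, of a dominated
   path of laws: for densities p t of Pt t with respect to mu,
     int (sqrt (p t) - sqrt (p 0) - t/2 * s * sqrt (p 0))^2 dmu = o(t^2). *)
Definition qmd (Pt : R -> probability obs R) (s : obs -> R) : Prop :=
  exists (mu : {sigma_finite_measure set obs -> \bar R}) (p : R -> obs -> R),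
    [/\ forall t, measurable_fun setT (p t),
        forall t o, 0 <= p t o,
        \forall t \near (0 : R), forall B, measurable B ->
          Pt t B = (\int[mu]_(o in B) (p t o)%:E)%E &
        (fun t : R => ((t ^- 2)%:E * \int[mu]_o
          ((Num.sqrt (p t o) - Num.sqrt (p 0 o)
            - t / 2 * s o * Num.sqrt (p 0 o)) ^+ 2)%:E)%E)
          @ (0 : R)^' --> (0 : \bar R)%E].

(* A regular one-dimensional parametric submodel through P0 with score s, in
   the nonparametric model of the laws of O with Z in the instrument space ZZ
   for which the functional is defined.  Differentiability in quadratic mean
   alone controls neither the expectation of the unbounded variable A^(a) Y nor
   the denominator of gamma, so the last two clauses ask, uniformly near t = 0,
   for a bounded second moment of A^(a) Y and for Z to be a regular weighting
   function.  The tangent space remains the whole space of mean-zero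
   square-integrable functions: when P0 meets these conditions, every bounded
   mean-zero s is the score of such a path, with Pt t = (1 + t s) P0 near 0. *)
Definition regular_submodel (ZZ : set R) a P0 (Pt : R -> probability obs R)
    (s : obs -> R) : Prop :=
  [/\ forall B, measurable B -> Pt 0 B = P0 B,
      sq_integrable P0 s /\ qmd Pt s,
      \forall t \near (0 : R), Pt t (obsZ @^-1` ZZ) = 1%E,
      exists c : R, \forall t \near (0 : R),
        (\int[Pt t]_o (treatY a o ^+ 2)%:E <= c%:E)%E &
      exists c e : R, 0 < e /\
        \forall t \near (0 : R), regular_weighting_bounds a c e (Pt t)].

Definition is_influence_gradient (ZZ : set R) a P0 (phi : obs -> R) : Prop :=
  [/\ sq_integrable P0 phi,
      \int[P0]_o phi o = 0 &
      forall (Pt : R -> probability obs R) (s : obs -> R),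
        regular_submodel ZZ a P0 Pt s ->
        is_derive (0 : R) (1 : R) (fun t : R => psi_MIV a (Pt t))
          (\int[P0]_o (phi o * s o))].

Definition is_efficient_influence_function (ZZ : set R) a P0
    (phi : obs -> R) : Prop :=
  is_influence_gradient ZZ a P0 phi /\
  forall phi' : obs -> R, is_influence_gradient ZZ a P0 phi' ->
    {ae P0, forall o, phi' o = phi o}.

End observed_data.

(* Main.v *)
Require Import Defs.
From HB Require Import structures.
From mathcomp Require Import all_boot all_order all_algebra.
From mathcomp Require Import all_classical all_reals all_analysis.
From mathcomp Require Import measurable_realfun.
From mathcomp Require Import ring lra.

Set Implicit Arguments.
Unset Strict Implicit.
Unset Printing Implicit Defensive.

Import Order.TTheory GRing.Theory Num.Theory.
Import numFieldNormedType.Exports.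

Local Open Scope classical_set_scope.
Local Open Scope ring_scope.

(* The functional psi is E[(1 - A) gamma(L) + A Y].  For two laws P, Q and an
   L-measurable event F, a von Mises expansion without remainder holds: the
   difference of the parts of psi(Q) and psi(P) on F is (E_Q - E_P)[1_F Phi],
   where Phi = (1 - A) gamma_P + A Y + xi_Q eps_P, with
   xi_Q = (1 - delta_Q) / kappa_Q (Z - rho_Q) and
   eps_P = A Y - eta_P - gamma_P (A - delta_P), provided eta_P and gamma_P are
   square integrable on F under Q.

   Along a path P_t through P_0 with score s, differentiability in quadratic mean
   gives |(E_t - E_0)[h f]| <= C (|t| ||h s|| + K o(t)) for |h| <= K and f
   with second moments bounded by C.  On {|gamma_0| + |eta_0| <= k} the expansion
   with P = P_0, Q = P_t and the convergence of xi_t to xi_0 give the derivative.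
   The complement contributes C |t| ||1_{|gamma_0| + |eta_0| > k} s|| + o(t), which
   is small for large k: there gamma_0 need not be integrable under P_t, but
   one expands around P_0 where |gamma_0| + |eta_0| <= |gamma_t| + |eta_t| and
   around P_t elsewhere, so that the required bound holds on each piece.

   For uniqueness, the linear paths (1 + t s) P_0 with bounded mean-zero s are
   regular submodels, so that the difference of two gradients is orthogonal to
   the centred indicator of the event where it is positive. *)

(** The expansion is exact because weight and residual come from different laws. Under P, eps_P has
    conditional mean zero given L and, since Cov(A Y, Z | L) = gamma Cov(A, Z | L), zero conditional
    covariance with Z; hence every weight that is affine in Z with bounded L-measurable coefficients
    gives mean zero, in particular xi_Q. Under Q, the division by kappa_Q turns E_Q[xi_Q eps_P | L]
    into (1 - delta_Q)(gamma_Q - gamma_P), which is what replacing gamma_Q by gamma_P changes in the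
    outcome. Convergence of gamma_t to gamma_0 is therefore never established. Only xi_t has to
    converge, and it is built from delta, rho and E[A Z | L], conditional means of bounded
    variables, for which a mean-square rate follows from the closeness of the laws.

    The second moments of eta_t and gamma_t are bounded uniformly near t = 0: conditional
    expectation contracts the L2 norm, Z is bounded and kappa is bounded away from zero. *)

Local Notation intg mu f := (integrable mu setT (EFin \o f)).

(** * Square-integrable functions, their norm and the Cauchy-Schwarz inequality *)

Section square_integrable.
Context {d : measure_display} {T : measurableType d} {R : realType}.
Implicit Types (mu : {measure set T -> \bar R}) (f g h : T -> R).

Lemma intgD mu f g : intg mu f -> intg mu g -> intg mu (fun x => f x + g x).
Proof. by move=> fi gi; have := integrableD measurableT fi gi. Qed.

Lemma intgB mu f g : intg mu f -> intg mu g -> intg mu (fun x => f x - g x).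
Proof. by move=> fi gi; have := integrableB measurableT fi gi. Qed.

Lemma intgZ mu k f : intg mu f -> intg mu (fun x => k * f x).
Proof. by move=> fi; have := integrableZl measurableT k fi. Qed.

Lemma intg_meas mu f : intg mu f -> measurable_fun setT f.
Proof. by move=> /measurable_int /measurable_EFinP. Qed.

Lemma intg_le mu f g : measurable_fun setT f -> intg mu g ->
  (forall x, `|f x| <= `|g x|) -> intg mu f.
Proof.
move=> mf gi fg; apply: le_integrable gi => //; first exact/measurable_EFinP.
by move=> x _ /=; rewrite lee_fin.
Qed.

Lemma intg_norm mu f : intg mu f -> intg mu (fun x => `|f x|).
Proof. exact: integrable_norm. Qed.

Lemma intg_bddM mu h f K : measurable_fun setT h -> (forall x, `|h x| <= K) ->
  intg mu f -> intg mu (fun x => h x * f x).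
Proof.
move=> mh hK fi; have mf := intg_meas fi.
apply: (intg_le _ (intgZ K fi)); first exact: measurable_funM.
move=> x; rewrite !normrM ler_wpM2r//; exact: le_trans (ler_norm K).
Qed.

Definition L2 mu f := measurable_fun setT f /\ intg mu (fun x => f x ^+ 2).

Definition nrm mu f := Num.sqrt (\int[mu]_x (f x ^+ 2)).

Lemma nrm_ge0 mu f : 0 <= nrm mu f. Proof. exact: sqrtr_ge0. Qed.

Lemma int_sqr_ge0 mu f : 0 <= \int[mu]_x (f x ^+ 2).
Proof. by apply: Rintegral_ge0 => x _; exact: sqr_ge0. Qed.

Lemma nrm_sqr mu f : nrm mu f ^+ 2 = \int[mu]_x (f x ^+ 2).
Proof. by rewrite sqr_sqrtr// int_sqr_ge0. Qed.

Lemma L2_le mu f g : measurable_fun setT f -> L2 mu g ->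
  (forall x, `|f x| <= `|g x|) -> L2 mu f.
Proof.
move=> mf [mg gi] fg; split=> //; apply: intg_le gi _; first exact: measurable_funX.
by move=> x; rewrite !normrX lerXn2r// nnegrE.
Qed.

Lemma le_nrm mu f g : measurable_fun setT f -> L2 mu g ->
  (forall x, `|f x| <= `|g x|) -> nrm mu f <= nrm mu g.
Proof.
move=> mf L2g fg; have [_ fi] := L2_le mf L2g fg; case: L2g => mg gi.
rewrite ler_sqrt; first last. exact: int_sqr_ge0.
apply: le_Rintegral => // x _.
by rewrite -(real_normK (num_real (f x))) -(real_normK (num_real (g x))) lerXn2r// nnegrE.
Qed.

Lemma L2Z mu k f : L2 mu f -> L2 mu (fun x => k * f x).
Proof.
move=> [mf fi]; split; first exact: measurable_funM.
have := intgZ (k ^+ 2) fi.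
by congr (integrable mu setT _); apply/funext => x/=; rewrite exprMn.
Qed.

Lemma nrmZ mu k f : L2 mu f -> nrm mu (fun x => k * f x) = `|k| * nrm mu f.
Proof.
move=> [mf fi]; rewrite /nrm; under eq_Rintegral do rewrite exprMn.
by rewrite RintegralZl// sqrtrM ?sqr_ge0// sqrtr_sqr.
Qed.

Lemma L2_bddM mu h f K : measurable_fun setT h -> (forall x, `|h x| <= K) ->
  L2 mu f -> L2 mu (fun x => h x * f x).
Proof.
move=> mh hK L2f; apply: (L2_le _ (L2Z K L2f)).
  by case: L2f => mf _; exact: measurable_funM.
move=> x; rewrite !normrM ler_wpM2r//; exact: le_trans (ler_norm K).
Qed.

Lemma nrm_bddM mu h f K : measurable_fun setT h -> (forall x, `|h x| <= K) ->
  L2 mu f -> nrm mu (fun x => h x * f x) <= `|K| * nrm mu f.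
Proof.
move=> mh hK L2f; rewrite -nrmZ//; apply: le_nrm; last 2 first.
- exact: L2Z.
- by move=> x; rewrite !normrM ler_wpM2r//; exact: le_trans (ler_norm K).
- by case: L2f => mf _; exact: measurable_funM.
Qed.

Lemma L2M mu f g : L2 mu f -> L2 mu g -> intg mu (fun x => f x * g x).
Proof.
move=> [mf fi] [mg gi]; apply: (intg_le _ (intgD fi gi)).
  exact: measurable_funM.
move=> x; rewrite normrM [leRHS]ger0_norm ?addr_ge0 ?sqr_ge0//.
rewrite -(real_normK (num_real (f x))) -(real_normK (num_real (g x))).
have := sqr_ge0 (`|f x| - `|g x|); have := mulr_ge0 (normr_ge0 (f x)) (normr_ge0 (g x)).
nra.
Qed.

Lemma L2D mu f g : L2 mu f -> L2 mu g -> L2 mu (fun x => f x + g x).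
Proof.
move=> L2f L2g; have fg := L2M L2f L2g; case: L2f L2g => [mf fi] [mg gi].
split; first exact: measurable_funD.
have := intgD (intgD fi gi) (intgZ 2 fg).
by congr (integrable mu setT _); apply/funext => x/=; congr EFin; ring.
Qed.

Lemma L2B mu f g : L2 mu f -> L2 mu g -> L2 mu (fun x => f x - g x).
Proof.
move=> L2f L2g; have := L2D L2f (L2Z (-1) L2g).
by congr (L2 mu _); apply/funext => x/=; ring.
Qed.

Lemma cauchy_schwarz mu f g : L2 mu f -> L2 mu g ->
  `|\int[mu]_x (f x * g x)| <= nrm mu f * nrm mu g.
Proof.
move=> L2f L2g; have fgi := L2M L2f L2g.
case: (L2f) (L2g) => [mf fi] [mg gi].
rewrite -sqrtrM ?int_sqr_ge0// -sqrtr_sqr ler_sqrt ?mulr_ge0 ?int_sqr_ge0//.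
set a := \int[mu]_x (f x ^+ 2); set b := \int[mu]_x (g x ^+ 2).
set c := \int[mu]_x (f x * g x).
have key l : 0 <= a - 2 * l * c + l ^+ 2 * b.
  have := int_sqr_ge0 mu (fun x => f x - l * g x).
  suff -> : \int[mu]_x ((f x - l * g x) ^+ 2) = a - 2 * l * c + l ^+ 2 * b by [].
  rewrite -(RintegralZl _ measurableT gi) -(RintegralZl _ measurableT fgi).
  rewrite -RintegralB//; last exact: intgZ.
  rewrite -RintegralD//; [|exact: intgB fi (intgZ _ _)|exact: intgZ].
  by apply: eq_Rintegral => x _; ring.
have b0 : 0 <= b by exact: int_sqr_ge0.
have [bp|b_le0] := ltP 0 b.
  have := key (c / b); rewrite -(ler_pM2r bp) mul0r.
  suff -> : (a - 2 * (c / b) * c + (c / b) ^+ 2 * b) * b = a * b - c ^+ 2 by lra.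
  by field; rewrite gt_eqF.
have b_eq0 : b = 0 by lra.
have [->|c0] := eqVneq c 0; first by rewrite expr0n/= mulr_ge0// int_sqr_ge0.
(* With b = 0 the polynomial in l is affine, and this l gives it the value -1. *)
have := key ((a + 1) / (2 * c)); rewrite b_eq0 mulr0 addr0.
suff -> : 2 * ((a + 1) / (2 * c)) * c = a + 1 by lra.
by field.
Qed.

End square_integrable.

Lemma L2_cst {d} {T : measurableType d} {R : realType} (P : probability T R) (k : R) :
  L2 P (fun _ : T => k).
Proof.
split; first exact: measurable_cst.
have := finite_measure_integrable_cst P (k ^+ 2) measurableT.
by congr (integrable P setT _); apply/funext.
Qed.

(** * Integration against a measure given by a density *)

Section integral_density.
Context {d : measure_display} {T : measurableType d} {R : realType}.
Implicit Types mu nu : {measure set T -> \bar R}.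

Import HBNNSimple.

Lemma ge0_integral_density mu nu (p : T -> R) (mp : measurable_fun setT p)
    (p0 : forall x, 0 <= p x)
    (nuE : forall B, measurable B -> nu B = (\int[mu]_(x in B) (p x)%:E)%E)
    (f : T -> \bar R) (mf : measurable_fun setT f) (f0 : forall x, (0 <= f x)%E) :
  (\int[nu]_x f x = \int[mu]_x (f x * (p x)%:E))%E.
Proof.
have mp' : measurable_fun setT (EFin \o p) by exact/measurable_EFinP.
pose h := nnsfun_approx measurableT mf.
have hcvg x : (EFin \o h ^~ x) @ \oo --> f x.
  by apply: cvg_nnsfun_approx => // t _; exact: f0.
have hnd x : {homo (fun n => (h n x)%:E) : m n / (m <= n)%N >-> (m <= n)%E}.
  by move=> m n mn; rewrite lee_fin; exact/lefP/nd_nnsfun_approx.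
have L : (\int[nu]_x (h n x)%:E)%E @[n --> \oo] --> (\int[nu]_x f x)%E.
  rewrite (_ : (\int[nu]_x f x)%E = (\int[nu]_x lim ((h n x)%:E @[n --> \oo]))%E).
    apply: cvg_monotone_convergence => // n.
    - exact/measurable_EFinP.
    - by move=> x _; rewrite lee_fin.
  by apply: eq_integral => x _; apply/esym/cvg_lim => //; exact: hcvg.
have L' : (\int[mu]_x ((h n x)%:E * (p x)%:E))%E @[n --> \oo]
    --> (\int[mu]_x (f x * (p x)%:E))%E.
  rewrite (_ : (\int[mu]_x (f x * (p x)%:E))%E =
      (\int[mu]_x lim (((h n x)%:E * (p x)%:E)%E @[n --> \oo]))%E).
    apply: cvg_monotone_convergence => //.
    - move=> n; apply: emeasurable_funM => //; exact/measurable_EFinP.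
    - by move=> n x _; rewrite mule_ge0// lee_fin.
    - by move=> x _ m n mn; rewrite lee_wpmul2r ?lee_fin//; exact/lefP/nd_nnsfun_approx.
  by apply: eq_integral => x _; apply/esym/cvg_lim => //; apply: cvgeZr => //; exact: hcvg.
suff E n : (\int[nu]_x (h n x)%:E = \int[mu]_x ((h n x)%:E * (p x)%:E))%E.
  by move: L; under eq_fun do rewrite E; move=> L; exact: cvg_unique L L'.
under eq_integral do rewrite fimfunE -fsumEFin//.
rewrite ge0_integral_fsum//; last 2 first.
- by move=> y; apply/measurable_EFinP; exact: measurable_funM.
- by move=> y x _; exact: nnfun_muleindic_ge0.
under [RHS]eq_integral.
  move=> x _; rewrite fimfunE -fsumEFin// ge0_mule_fsuml; last first.
    by move=> y; exact: nnfun_muleindic_ge0.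
  over.
rewrite ge0_integral_fsum//; last 2 first.
- move=> y; apply: emeasurable_funM => //; apply/measurable_EFinP.
  exact: measurable_funM.
- by move=> y x _; rewrite mule_ge0 ?lee_fin//; exact: nnfun_muleindic_ge0.
apply: eq_fsbigr => r /[1!inE] -[x0 _ rE].
have r0 : 0 <= r by rewrite -rE.
have mr : measurable (h n @^-1` [set r]) by exact: measurable_sfunP.
under eq_integral do rewrite EFinM.
rewrite ge0_integralZl//; last exact/measurable_EFinP.
rewrite integral_indic// setIT nuE// integral_mkcond.
under [RHS]eq_integral do rewrite EFinM -muleA.
rewrite ge0_integralZl//; last 2 first.
- by apply: emeasurable_funM => //; exact/measurable_EFinP.
- by move=> x _; rewrite mule_ge0// lee_fin.
congr (_ * _)%E; apply: eq_integral => x _.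
rewrite patchE indicE; case: ifPn => xin; rewrite ?mul1e//.
by rewrite mul0e.
Qed.

Section change_of_density.
Variables (mu nu : {measure set T -> \bar R}) (p : T -> R).
Hypotheses (mp : measurable_fun setT p) (p0 : forall x, 0 <= p x).
Hypothesis nuE : forall B, measurable B -> nu B = (\int[mu]_(x in B) (p x)%:E)%E.

Lemma integrable_density f : measurable_fun setT f ->
  intg nu f <-> intg mu (fun x => f x * p x).
Proof.
move=> mf.
have E : (\int[nu]_x `|(f x)%:E| = \int[mu]_x `|(f x * p x)%:E|)%E.
  rewrite (ge0_integral_density mp p0 nuE)//; last first.
    by apply: measurableT_comp => //; exact/measurable_EFinP.
  by apply: eq_integral => x _ /=; rewrite normrM (ger0_norm (p0 x)) EFinM.
split=> /integrableP[_ H]; apply/integrableP; split.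
- by apply/measurable_EFinP; exact: measurable_funM.
- by rewrite -E.
- exact/measurable_EFinP.
- by rewrite E.
Qed.

Lemma Rintegral_density f : intg nu f ->
  \int[nu]_x f x = \int[mu]_x (f x * p x).
Proof.
move=> fi; have mf := intg_meas fi.
have E (g : T -> R) : measurable_fun setT g -> (forall x, 0 <= g x) ->
    \int[nu]_x g x = \int[mu]_x (g x * p x).
  move=> mg g0; rewrite /Rintegral (ge0_integral_density mp p0 nuE)//.
  exact/measurable_EFinP.
have ni := intg_norm fi; have mn := intg_meas ni.
have fD := intgD ni fi; have mfD := intg_meas fD.
(* Both terms are nonnegative and integrable, so the nonnegative case applies to each. *)
have split_f x : f x = (`|f x| + f x) - `|f x| by ring.
under eq_Rintegral do rewrite split_f.
rewrite RintegralB// E//; last by move=> x; rewrite -lerBlDr sub0r ler_normr lexx orbT.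
rewrite E// -RintegralB//; last 2 first.
- exact/integrable_density.
- exact/integrable_density.
by apply: eq_Rintegral => x _; ring.
Qed.
End change_of_density.
End integral_density.

Section density_measure.
Context {d : measure_display} {T : measurableType d} {R : realType}.
Variables (mu : {measure set T -> \bar R}) (p : T -> R).
Hypotheses (mp : measurable_fun setT p) (p0 : forall x, 0 <= p x).

(** The two proofs are arguments so that the measure structure declared below can be attached to the
    function itself. *)
Definition density of measurable_fun setT p & (forall x, 0 <= p x) :=
  fun A => (\int[mu]_(x in A) (p x)%:E)%E.

Let density0 : density mp p0 set0 = 0%E.
Proof. exact: integral_set0. Qed.

Let density_ge0 A : (0 <= density mp p0 A)%E.
Proof. by apply: integral_ge0 => x _; rewrite lee_fin. Qed.

Let density_sigma_additive : semi_sigma_additive (density mp p0).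
Proof.
apply: semi_sigma_additive_nng_induced; first exact/measurable_EFinP.
by move=> x; rewrite lee_fin.
Qed.

HB.instance Definition _ := isMeasure.Build _ _ _ (density mp p0)
  density0 density_ge0 density_sigma_additive.

End density_measure.

(** Integrability travels with the vanishing integral, so that identities between expectations
    become algebraic combinations of mean-zero functions, closed by [ring] or [field]. *)
Definition mean_zero {d} {T : measurableType d} {R : realType}
    (mu : {measure set T -> \bar R}) (f : T -> R) :=
  intg mu f /\ \int[mu]_x f x = 0.

Section mean_zero.
Context {d : measure_display} {T : measurableType d} {R : realType}.
Variable mu : {measure set T -> \bar R}.

Lemma mean_zeroD f g : mean_zero mu f -> mean_zero mu g ->
  mean_zero mu (fun x => f x + g x).
Proof.
move=> [fi f0] [gi g0]; split; first exact: intgD.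
by rewrite RintegralD// f0 g0 addr0.
Qed.

Lemma mean_zeroB f g : mean_zero mu f -> mean_zero mu g ->
  mean_zero mu (fun x => f x - g x).
Proof.
move=> [fi f0] [gi g0]; split; first exact: intgB.
by rewrite RintegralB// f0 g0 subr0.
Qed.

Lemma mean_zeroP f g : intg mu f -> intg mu g ->
  \int[mu]_x f x = \int[mu]_x g x <-> mean_zero mu (fun x => f x - g x).
Proof.
move=> fi gi; split=> [fg|[_]].
  by split; [exact: intgB|rewrite RintegralB// fg subrr].
by rewrite RintegralB// => /eqP; rewrite subr_eq0 => /eqP.
Qed.

End mean_zero.

(** * Conditional expectation: the pull-out property and existence *)

Section pull_out.
Context {d dW : measure_display} {T : measurableType d}
  {TW : measurableType dW} {R : realType}.
Variables (P : probability T R) (W : {mfun T >-> TW}).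

Let measurable_fun_W (h : TW -> R) : measurable_fun setT h ->
  measurable_fun setT (fun x => h (W x)).
Proof. by move=> mh; exact: measurableT_comp. Qed.

(** The last hypothesis says that the measures with densities [F] and [G] have the same image under
    [W]; both sides integrate [h] against this image. *)
Let ge0_integral_pull_out (F G : T -> R) (h : TW -> R) :
  measurable_fun setT F -> measurable_fun setT G ->
  (forall x, 0 <= F x) -> (forall x, 0 <= G x) ->
  measurable_fun setT h -> (forall w, 0 <= h w) ->
  (forall B, measurable B -> \int[P]_(x in W @^-1` B) (F x)%:E =
     \int[P]_(x in W @^-1` B) (G x)%:E)%E ->
  (\int[P]_x (h (W x) * F x)%:E = \int[P]_x (h (W x) * G x)%:E)%E.
Proof.
move=> mF mG F0 G0 mh h0 FG.
have mh' : measurable_fun setT (EFin \o h) by exact/measurable_EFinP.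
have E (H : T -> R) (mH : measurable_fun setT H) (H0 : forall x, 0 <= H x) :
    (\int[P]_x (h (W x) * H x)%:E =
     \int[pushforward (density P mH H0) W]_w (h w)%:E)%E.
  rewrite ge0_integral_pushforward//; last by move=> w _; rewrite lee_fin.
  rewrite preimage_setT (@ge0_integral_density _ _ _ P (density P mH H0) _ mH H0 (fun _ _ => erefl))//.
  - by apply/measurable_EFinP; exact: measurable_fun_W.
  - by move=> x; rewrite lee_fin.
rewrite (E _ mF F0) (E _ mG G0); apply: eq_measure_integral => A mA _.
exact: FG.
Qed.

Lemma pull_out f g (h : TW -> R) : is_condE P W f g -> intg P f -> measurable_fun setT h ->
  intg P (fun x => h (W x) * f x) -> intg P (fun x => h (W x) * g (W x)) ->
  mean_zero P (fun x => h (W x) * (f x - g (W x))).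
Proof.
move=> [mg gi fg] fi mh hf hg.
have mf := intg_meas fi; have mgW := measurable_fun_W mg.
(* The positive and negative parts of [h] inherit integrability from their domination by |h|. *)
wlog h0 : h mh hf hg / forall w, 0 <= h w.
  move=> H.
  have part (k : TW -> R) : measurable_fun setT k -> (forall w, 0 <= k w) ->
      (forall w, k w <= `|h w|) -> mean_zero P (fun x => k (W x) * (f x - g (W x))).
    move=> mk k0 kh; apply: H => //.
    - apply: intg_le hf _; first by apply: measurable_funM => //; exact: measurable_fun_W.
      by move=> x; rewrite !normrM ler_wpM2r// ger0_norm.
    - apply: intg_le hg _; first by apply: measurable_funM => //; exact: measurable_fun_W.
      by move=> x; rewrite !normrM ler_wpM2r// ger0_norm.
  have := mean_zeroB (part (fun w => Num.max (h w) 0) _ _ _)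
                     (part (fun w => Num.max (- h w) 0) _ _ _).
  have -> : (fun x => Num.max (h (W x)) 0 * (f x - g (W x)) -
      Num.max (- h (W x)) 0 * (f x - g (W x))) = (fun x => h (W x) * (f x - g (W x))).
    apply/funext => x; rewrite -mulrBl; congr (_ * _).
    by rewrite !maxEle; case: ifPn; case: ifPn; lra.
  apply.
  - exact: measurable_maxr.
  - by move=> w; rewrite le_max lexx orbT.
  - by move=> w; rewrite ge_max normr_ge0 ler_norm.
  - by apply: measurable_maxr => //; exact: measurableT_comp.
  - by move=> w; rewrite le_max lexx orbT.
  - by move=> w; rewrite ge_max normr_ge0 -normrN ler_norm.
have iF := intg_norm fi; have iG := intg_norm gi.
(* The common shift |f| + |g(W)| makes both functions nonnegative and leaves their difference
   unchanged. *)
pose F x := f x + `|f x| + `|g (W x)|; pose G x := g (W x) + `|f x| + `|g (W x)|.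
have Fi : intg P F by apply: intgD => //; exact: intgD.
have Gi : intg P G by apply: intgD => //; exact: intgD.
have hnf := intg_norm hf; have hng := intg_norm hg.
have hE a x : `|h (W x) * a| = h (W x) * `|a| by rewrite normrM (ger0_norm (h0 _)).
have hFi : intg P (fun x => h (W x) * F x).
  have := intgD (intgD hf hnf) hng; congr (integrable P setT _).
  by apply/funext => x/=; rewrite !hE; congr EFin; rewrite /F; ring.
have hGi : intg P (fun x => h (W x) * G x).
  have := intgD (intgD hg hnf) hng; congr (integrable P setT _).
  by apply/funext => x/=; rewrite !hE; congr EFin; rewrite /G; ring.
have := (mean_zeroP hFi hGi).1; rewrite (_ : (fun x => h (W x) * F x - h (W x) * G x) =
    fun x => h (W x) * (f x - g (W x))); last first.
  by apply/funext => x; rewrite /F /G; ring.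
apply; rewrite /Rintegral; congr fine; apply: ge0_integral_pull_out => //.
- exact: intg_meas Fi.
- exact: intg_meas Gi.
- by move=> x; rewrite /F addr_ge0// -lerBlDl sub0r ler_normr lexx orbT.
- move=> x; rewrite /G addrAC addr_ge0// -lerBlDl sub0r ler_normr lexx orbT//.
move=> B mB.
have mWB : measurable (W @^-1` B) by rewrite -[X in measurable X]setTI; exact: measurable_funP.
have S k : intg P k -> P.-integrable (W @^-1` B) (EFin \o k).
  by apply: integrableS.
have FE x : (F x)%:E = ((f x)%:E + (`|f x| + `|g (W x)|)%:E)%E.
  by rewrite -EFinD /F addrA.
have GE x : (G x)%:E = ((g (W x))%:E + (`|f x| + `|g (W x)|)%:E)%E.
  by rewrite -EFinD /G addrA.
under eq_integral do rewrite FE; under [RHS]eq_integral do rewrite GE.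
have iFG := intgD iF iG.
rewrite !integralD//; [|exact: (S _ gi)|exact: (S _ iFG)|exact: (S _ fi)|exact: (S _ iFG)].
by rewrite fg.
Qed.

(** The version is the Radon-Nikodym derivative, with respect to the law of [W], of the image under
    [W] of the charge with density [f]. *)
Lemma condE_ex f : intg P f -> exists g, is_condE P W f g.
Proof.
move=> fi.
pose nu := pushforward (induced_charge fi) W.
have dom : nu `<< distribution P W.
  apply: dominates_pushforward; first exact: measurable_funP.
  apply/null_content_dominatesP => A mA A0.
  apply: null_set_integral => //.
  by apply: measurable_funTS; exact: measurable_int fi.
have mWB B : measurable B -> measurable (W @^-1` B).
  by move=> mB; rewrite -[X in measurable X]setTI; exact: measurable_funP.
have mW : measurable_fun setT W by exact: measurable_funP.
pose RN := Radon_Nikodym nu (distribution P W); pose G := RN mW.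
have Gf w : G w = (fine (G w))%:E by rewrite fineK//; exact: Radon_Nikodym_fin_num.
have Gi : (distribution P W).-integrable setT (fun w => (fine (G w))%:E).
  by under eq_fun do rewrite -Gf; exact: Radon_Nikodym_integrable.
have mG : measurable_fun setT (fine \o G) by exact: (intg_meas (f := fine \o G) Gi).
have mG' : measurable_fun setT (fun w => (fine (G w))%:E) by exact/measurable_EFinP.
have GWi : intg P (fun x => fine (G (W x))).
  apply/integrableP; split; first exact/measurable_EFinP/(measurable_fun_W mG).
  case/integrableP : Gi => _; rewrite ge0_integral_distribution//.
  exact: measurableT_comp.
exists (fine \o G); split => // B mB.
have -> : (\int[P]_(x in W @^-1` B) (f x)%:E)%E = nu B by [].
transitivity (\int[distribution P W]_(w in B) G w)%E; last first.
  by apply/esym; exact: Radon_Nikodym_integral dom mB.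
under [RHS]eq_integral do rewrite Gf.
rewrite (integral_pushforward mW)//.
by apply: integrableS GWi => //; exact: mWB.
Qed.

End pull_out.

(** * Measurability and almost-everywhere comparison *)

Lemma measurable_invr (R : realType) : measurable_fun setT (@GRing.inv R).
Proof.
(* The real power is applied to the nonnegative [x ^+ 2]; at 0 both sides vanish because the inverse
   of 0 is 0. *)
have -> : @GRing.inv R = (fun x => x * (x ^+ 2) `^ (-1)).
  apply/funext => x; have [->|x0] := eqVneq x 0; first by rewrite invr0 mul0r.
  by rewrite powR_inv1 ?sqr_ge0//; field.
apply: measurable_funM => //.
by apply: (measurableT_comp (f := @powR R ^~ (-1))) => //; exact: measurable_funX.
Qed.

(** The last branch treats composition with a bundled measurable map such as [W] and leaves the
    measurability of the outer function. *)
Ltac meas := repeat first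
  [ assumption | exact: measurable_cst | exact: measurable_id
  | match goal with
    | |- measurable_fun _ (fun x => _ + _) => apply: measurable_funD
    | |- measurable_fun _ (fun x => _ - _) => apply: measurable_funB
    | |- measurable_fun _ (fun x => - _) => apply: measurable_funN
    | |- measurable_fun _ (fun x => _ * _) => apply: measurable_funM
    | |- measurable_fun _ (fun x => _ ^+ _) => apply: measurable_funX
    | |- measurable_fun _ (fun x => Num.max _ _) => apply: measurable_maxr
    | |- measurable_fun _ (fun x => Num.min _ _) => apply: measurable_minr
    | |- measurable_fun _ (fun x => `|@?f x|) =>
        apply: (measurableT_comp (@normr_measurable _ setT) (g := f))
    | |- measurable_fun _ (fun x => (@?f x)^-1) =>
        apply: (measurableT_comp (@measurable_invr _) (g := f))
    | |- measurable_fun _ (\1__) => apply: measurable_indic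
    | |- measurable_fun _ (fun x => ?h (@?f x)) =>
        apply: (measurableT_comp (f := h) (g := f)); last exact: measurable_funP
    end ].

Section comparison_sets.
Context {d : measure_display} {T : measurableType d} {R : realType}.
Implicit Types f g : T -> R.

Lemma measurable_set_lt f g : measurable_fun setT f -> measurable_fun setT g ->
  measurable [set x | f x < g x].
Proof.
move=> mf mg; have := measurable_fun_ltr mf mg measurableT (Y := [set true]).
rewrite setTI (_ : _ @^-1` [set true] = [set x | f x < g x]); first exact.
by apply/seteqP; split => x /=.
Qed.

Lemma measurable_set_le f g : measurable_fun setT f -> measurable_fun setT g ->
  measurable [set x | f x <= g x].
Proof.
move=> mf mg; rewrite (_ : [set x | _] = ~` [set x | g x < f x]).
  exact/measurableC/measurable_set_lt.
by apply/seteqP; split => x /=; rewrite leNgt => /negP.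
Qed.

End comparison_sets.

Section almost_everywhere.
Context {d : measure_display} {T : measurableType d} {R : realType}.
Variable mu : {measure set T -> \bar R}.
Implicit Types f g : T -> R.

Lemma eq_intg_ae f g : measurable_fun setT g -> {ae mu, forall x, f x = g x} ->
  intg mu f -> intg mu g.
Proof.
move=> mg fg /integrableP[mf fi]; apply/integrableP; split.
  exact/measurable_EFinP.
rewrite (@ae_eq_integral _ _ _ mu setT (fun x => `|(f x)%:E|%E))//.
- by apply: measurableT_comp => //; exact/measurable_EFinP.
- exact: measurableT_comp.
- by apply: filterS fg => x -> _.
Qed.

Lemma eq_Rintegral_ae f g : measurable_fun setT f -> measurable_fun setT g ->
  {ae mu, forall x, f x = g x} -> \int[mu]_x f x = \int[mu]_x g x.
Proof.
move=> mf mg fg; congr fine; apply: ae_eq_integral => //.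
- exact/measurable_EFinP.
- exact/measurable_EFinP.
- by apply: filterS fg => x -> _.
Qed.

Lemma ae_eq0_ge0 f : intg mu f -> (forall x, 0 <= f x) ->
  \int[mu]_x f x <= 0 -> {ae mu, forall x, f x = 0}.
Proof.
move=> fi f0 fle.
have mf : measurable_fun setT (EFin \o f) by apply/measurable_EFinP; exact: intg_meas fi.
have E : (\int[mu]_x `|(f x)%:E| = 0)%E.
  under eq_integral do rewrite /= ger0_norm//.
  have ffin : (\int[mu]_x (f x)%:E)%E \is a fin_num by exact: integrable_fin_num.
  rewrite -[LHS]fineK//; congr EFin; apply: le_anti.
  by rewrite fle/= fine_ge0// integral_ge0// => x _; rewrite lee_fin.
have /(ae_eq_integral_abs mu measurableT mf) := E.
by apply: filterS => x /(_ I) [].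
Qed.

End almost_everywhere.

(** * Order and L2 contraction of conditional expectations *)

Section conditional_expectation.
Context {d dW : measure_display} {T : measurableType d}
  {TW : measurableType dW} {R : realType}.
Variables (P : probability T R) (W : {mfun T >-> TW}).
Implicit Types (f : T -> R) (g h : TW -> R).

(** The test set is {h < g}: there 1_B (g - h) is nonnegative with integral at most 0, hence zero
    almost everywhere. *)
Lemma ae_le_cond g h : measurable_fun setT g -> measurable_fun setT h ->
  intg P (fun x => g (W x)) -> intg P (fun x => h (W x)) ->
  (forall B, measurable B ->
    \int[P]_x (\1_B (W x) * g (W x)) <= \int[P]_x (\1_B (W x) * h (W x))) ->
  {ae P, forall x, g (W x) <= h (W x)}.
Proof.
move=> mg mh gi hi gh; pose B := [set w | h w < g w].
have mB : measurable B by exact: measurable_set_lt.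
have bB w : `|\1_B w : R| <= 1 by rewrite indicE; case: (_ \in _); rewrite ?normr1 ?normr0.
have m1 : measurable_fun setT (fun x => \1_B (W x) : R) by meas.
have Bg := intg_bddM m1 (fun x => bB (W x)) gi.
have Bh := intg_bddM m1 (fun x => bB (W x)) hi.
have k0 x : 0 <= \1_B (W x) * g (W x) - \1_B (W x) * h (W x).
  rewrite -mulrBr indicE; case: (boolP (W x \in B)); last by rewrite mul0r.
  by rewrite inE mul1r subr_ge0 => /ltW.
have := ae_eq0_ge0 (intgB Bg Bh) k0; rewrite RintegralB// subr_le0 => /(_ (gh _ mB)).
apply: filterS => x; rewrite -mulrBr indicE; case: (boolP (W x \in B)).
  by rewrite mul1r inE /B/= => + /eqP; rewrite subr_eq0 => /[swap] /eqP ->; rewrite ltxx.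
by rewrite notin_setE /B/= => /negP; rewrite -leNgt.
Qed.

Lemma int_indic_cond f g B : is_condE P W f g -> intg P f -> measurable B ->
  \int[P]_x (\1_B (W x) * g (W x)) = \int[P]_x (\1_B (W x) * f x).
Proof.
move=> Hg fi mB; have [mg gi _] := Hg.
have bB w : `|\1_B w : R| <= 1 by rewrite indicE; case: (_ \in _); rewrite ?normr1 ?normr0.
have m1 : measurable_fun setT (fun x => \1_B (W x) : R) by meas.
have Bf := intg_bddM m1 (fun x => bB (W x)) fi.
have Bg := intg_bddM m1 (fun x => bB (W x)) gi.
apply/esym/mean_zeroP => //.
under eq_fun do rewrite -mulrBr.
by apply: (pull_out (h := \1_B)) => //; meas.
Qed.

Lemma condE_le f f' g g' : is_condE P W f g -> is_condE P W f' g' ->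
  intg P f -> intg P f' -> {ae P, forall x, f x <= f' x} ->
  {ae P, forall x, g (W x) <= g' (W x)}.
Proof.
move=> Hg Hg' fi fi' ff'; have [mg gi _] := Hg; have [mg' gi' _] := Hg'.
apply: ae_le_cond => // B mB; rewrite (int_indic_cond Hg)// (int_indic_cond Hg')//.
have bB w : `|\1_B w : R| <= 1 by rewrite indicE; case: (_ \in _); rewrite ?normr1 ?normr0.
have m1 : measurable_fun setT (fun x => \1_B (W x) : R) by meas.
have Bf := intg_bddM m1 (fun x => bB (W x)) fi.
have Bf' := intg_bddM m1 (fun x => bB (W x)) fi'.
have mf := intg_meas fi; have mf' := intg_meas fi'.
(* The minimum agrees with [f] almost everywhere and is below f' at every point, as monotonicity of
   the integral requires. *)
have -> : \int[P]_x (\1_B (W x) * f x) = \int[P]_x (\1_B (W x) * Num.min (f x) (f' x)).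
  apply: eq_Rintegral_ae; [meas|meas|].
  by apply: filterS ff' => x ffx; rewrite min_l.
apply: le_Rintegral => //.
  apply: eq_intg_ae Bf; first by meas.
  by apply: filterS ff' => x ffx; rewrite min_l.
by move=> x _; rewrite ler_wpM2l ?ge_min ?lexx ?orbT// indicE.
Qed.

Lemma condE_cst k : is_condE P W (fun=> k) (fun=> k).
Proof.
by split => //; have := finite_measure_integrable_cst P k measurableT.
Qed.

Lemma condE_ae_le f g k : is_condE P W f g -> intg P f ->
  {ae P, forall x, `|f x| <= k} -> {ae P, forall x, `|g (W x)| <= k}.
Proof.
move=> Hg fi fk.
have ki := finite_measure_integrable_cst P k measurableT.
have nki := finite_measure_integrable_cst P (- k) measurableT.
have le1 : {ae P, forall x, g (W x) <= k}.
  apply: (condE_le Hg (condE_cst k)) => //.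
  by apply: filterS fk => x /ler_normlP[].
have le2 : {ae P, forall x, - k <= g (W x)}.
  apply: (condE_le (condE_cst (- k)) Hg) => //.
  by apply: filterS fk => x; rewrite ler_norml => /andP[].
by apply: filterS2 le1 le2 => x; rewrite ler_norml => -> ->.
Qed.

Lemma condE_ae_eq f g g' : is_condE P W f g -> measurable_fun setT g' ->
  {ae P, forall x, g (W x) = g' (W x)} -> is_condE P W f g'.
Proof.
move=> [mg gi fg] mg' gg'.
have mgW : measurable_fun setT (fun x => g (W x)) by meas.
have mgW' : measurable_fun setT (fun x => g' (W x)) by meas.
split => //; first exact: eq_intg_ae gi.
move=> B mB; rewrite -fg//; apply: ae_eq_integral.
- by rewrite -[X in measurable X]setTI; exact: measurable_funP.
- by apply: measurable_funTS; exact/measurable_EFinP.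
- by apply: measurable_funTS; exact/measurable_EFinP.
- by apply: filterS gg' => x ->.
Qed.

(** Square integrability of [g] is part of the claim, so [g] is first cut off outside {|g| <= n}.
    The truncation h_n is a bounded test function, whence |h_n|^2 = E[h_n f] <= |h_n| |f| in L2
    norms; monotone convergence removes the cutoff. *)
Lemma condE_jensen f g : is_condE P W f g -> L2 P f ->
  L2 P (fun x => g (W x)) /\ nrm P (fun x => g (W x)) <= nrm P f.
Proof.
move=> Hg L2f; have [mg gi _] := Hg.
have fi : intg P f.
  have := L2M L2f (L2_cst P 1).
  by congr (integrable P setT _); apply/funext => x /=; rewrite mulr1.
pose h n w := \1_[set w | `|g w| <= n%:R] w * g w.
have mS n : measurable [set w | `|g w| <= n%:R].
  by apply: (measurable_set_le (f := fun w => `|g w|) (g := fun=> n%:R)); meas.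
have mh n : measurable_fun setT (h n) by rewrite /h; meas; exact: mS.
have mhW n : measurable_fun setT (fun x => h n (W x)) by meas.
have hb n w : `|h n w| <= n%:R.
  rewrite /h indicE; case: (boolP (w \in _)) => [|_]; first by rewrite inE/= mul1r.
  by rewrite mul0r normr0.
have hg n w : `|h n w| <= `|g w|.
  by rewrite /h indicE; case: (_ \in _); rewrite ?mul1r ?mul0r ?normr0.
have L2h n : L2 P (fun x => h n (W x)).
  apply: (L2_le (mhW n) (L2_cst P n%:R)) => x.
  by rewrite (le_trans (hb n _))// ler_norm.
have nh n : nrm P (fun x => h n (W x)) <= nrm P f.
  have [->|n0] := eqVneq (nrm P (fun x => h n (W x))) 0; first exact: nrm_ge0.
  rewrite -(ler_pM2l (_ : 0 < nrm P (fun x => h n (W x)))); last by rewrite lt_def n0 nrm_ge0.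
  rewrite -expr2 nrm_sqr.
  rewrite (_ : \int[P]_x _ = \int[P]_x (h n (W x) * f x)).
    exact: le_trans (ler_norm _) (cauchy_schwarz (L2h n) L2f).
  have hfi := intg_bddM (mhW n) (fun x => hb n (W x)) fi.
  have hgi := intg_bddM (mhW n) (fun x => hb n (W x)) gi.
  transitivity (\int[P]_x (h n (W x) * g (W x))).
    apply: eq_Rintegral => x _; rewrite /h indicE.
    by case: (_ \in _); rewrite ?mul1r ?mul0r ?expr0n ?expr2.
  apply/esym/mean_zeroP => //; under eq_fun do rewrite -mulrBr.
  exact: pull_out.
have L : (\int[P]_x (h n (W x) ^+ 2)%:E)%E @[n --> \oo] --> (\int[P]_x (g (W x) ^+ 2)%:E)%E.
  rewrite (_ : (\int[P]_x (g (W x) ^+ 2)%:E)%E =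
      (\int[P]_x lim ((h n (W x) ^+ 2)%:E @[n --> \oo]))%E); last first.
    apply: eq_integral => x _; apply/esym/cvg_lim => //; apply: cvg_near_cst.
    near=> n; rewrite /h indicE mem_set/= ?mul1r//.
    near: n; exact: nbhs_infty_ger.
  apply: cvg_monotone_convergence => //.
  - by move=> n; apply/measurable_EFinP; meas.
  - by move=> n x _; rewrite lee_fin sqr_ge0.
  - move=> x _ m n mn; rewrite lee_fin /h !indicE.
    case: (boolP (W x \in [set w | `|g w| <= m%:R])) => [|_]; last by rewrite mul0r expr0n/= sqr_ge0.
    rewrite inE/= => gm; rewrite mem_set//=.
    by rewrite (le_trans gm)// ler_nat.
have bound : (\int[P]_x (g (W x) ^+ 2)%:E <= (nrm P f ^+ 2)%:E)%E.
  rewrite -(cvg_lim _ L)//; apply: lime_le; first by apply/cvg_ex; eexists; exact: L.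
  apply: nearW => n; have [_ hi] := L2h n.
  rewrite -[leLHS]fineK; last exact: integrable_fin_num.
  rewrite lee_fin -/(Rintegral P setT (fun x => h n (W x) ^+ 2)) -nrm_sqr.
  by rewrite lerXn2r// nnegrE nrm_ge0.
have L2g : L2 P (fun x => g (W x)).
  split; first by meas.
  apply/integrableP; split; first by apply/measurable_EFinP; meas.
  under eq_integral do rewrite /= ger0_norm ?sqr_ge0//.
  by apply: le_lt_trans bound _; rewrite ltry.
split => //; rewrite -(@ler_pXn2r _ 2)// ?nnegrE ?nrm_ge0// nrm_sqr.
rewrite -lee_fin fineK//; case: L2g => _; exact: integrable_fin_num.
Unshelve. all: by end_near. Qed.

End conditional_expectation.

(** * Triangle inequality and truncation in L2 *)

Section square_integrable_more.
Context {d : measure_display} {T : measurableType d} {R : realType}.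

Lemma nrmD (mu : {measure set T -> \bar R}) (f g : T -> R) : L2 mu f -> L2 mu g ->
  nrm mu (fun x => f x + g x) <= nrm mu f + nrm mu g.
Proof.
move=> L2f L2g; have fg := L2M L2f L2g; have CS := cauchy_schwarz L2f L2g.
rewrite -(@ler_pXn2r _ 2)// ?nnegrE ?addr_ge0 ?nrm_ge0//.
rewrite sqrrD !nrm_sqr; case: L2f L2g => [mf fi] [mg gi].
have -> : \int[mu]_x ((f x + g x) ^+ 2) =
    \int[mu]_x (f x ^+ 2) + 2 * \int[mu]_x (f x * g x) + \int[mu]_x (g x ^+ 2).
  rewrite -RintegralZl// -!RintegralD//;
    [|by first [exact: intgZ|exact: intgD fi (intgZ 2 fg)]..].
  by apply: eq_Rintegral => x _; ring.
by move: CS => /ler_normlP[_]; lra.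
Qed.

Lemma nrm_cst (P : probability T R) (k : R) : nrm P (fun=> k) = `|k|.
Proof.
by rewrite /nrm Rintegral_cst//= (@probability_setT _ _ _ P) mulr1 sqrtr_sqr.
Qed.

(** Dominated convergence under s^2. Since [Y] need only be measurable, the cutoff can be placed on
    [s] itself, on an integrand or on |gamma_0| + |eta_0|. *)
Lemma tail_nrm (P : probability T R) (s Y : T -> R) (eps : R) : L2 P s ->
  measurable_fun setT Y -> 0 < eps ->
  exists2 k : R, 0 <= k & nrm P (fun x => \1_[set x | k < `|Y x|] x * s x) <= eps.
Proof.
move=> [ms si] mY e0; pose A n := [set x | n%:R < `|Y x|].
have mA n : measurable (A n).
  by apply: (measurable_set_lt (f := fun=> n%:R) (g := fun x => `|Y x|)); meas.
pose f n x := ((\1_(A n) x * s x) ^+ 2)%:E.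
have cvg0 : (\int[P]_x f n x)%E @[n --> \oo] --> (\int[P]_x cst 0 x)%E.
  have [] := @dominated_convergence _ _ _ P setT measurableT f (cst 0%E)
      (fun x => (s x ^+ 2)%:E).
  - move=> n; apply/measurable_EFinP; meas; exact: mA.
  - exact: measurable_cst.
  - apply: aeW => x _; apply: cvg_near_cst; near=> n.
    rewrite /f indicE memNset/= ?mul0r ?expr0n//.
    apply/negP; rewrite -leNgt; near: n; exact: nbhs_infty_ger.
  - exact: si.
  - apply: aeW => x n _; rewrite /f /= lee_fin ger0_norm ?sqr_ge0// indicE.
    by case: (_ \in _); rewrite ?mul1r// mul0r expr0n/= sqr_ge0.
  by [].
rewrite integral0 in cvg0.
have e2 : 0 < eps ^+ 2 by rewrite exprn_gt0.
have [N _ HN] := cvg0 _ (nbhs_open_ereal_lt (f := fun=> eps ^+ 2) e2).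
exists N%:R => //.
rewrite -(@ler_pXn2r _ 2)//; [|by rewrite nnegrE nrm_ge0|by rewrite nnegrE ltW].
rewrite nrm_sqr -lee_fin fineK; first by apply/ltW/HN => /=.
rewrite ge0_fin_numE; last by apply: integral_ge0 => x _; rewrite lee_fin sqr_ge0.
by rewrite (lt_trans (HN N _))//= ltry.
Unshelve. all: by end_near. Qed.

(** For [u] small in L2 the product u s need not be small if [s] is only square integrable. The
    uniform bound [b] on [u] repairs this: where |s| <= k the factor [s] is bounded by [k],
    elsewhere [u] is bounded by [b]. *)
Lemma nrm_bdd_tail (P : probability T R) (u s : T -> R) (b k : R) :
  measurable_fun setT u -> (forall x, `|u x| <= b) -> L2 P s -> 0 <= k ->
  nrm P (fun x => u x * s x) ^+ 2 <= k ^+ 2 * \int[P]_x (u x ^+ 2)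
    + b ^+ 2 * nrm P (fun x => \1_[set x | k < `|s x|] x * s x) ^+ 2.
Proof.
move=> mu ub L2s k0; pose A := [set x | k < `|s x|].
have [ms si] := L2s.
have mA : measurable A.
  by apply: (measurable_set_lt (f := fun=> k) (g := fun x => `|s x|)); meas.
have A1 x : `|\1_A x : R| <= 1 by rewrite indicE; case: (_ \in _); rewrite ?normr1 ?normr0.
have [_ usi] := L2_bddM mu ub L2s.
have m1 : measurable_fun setT (\1_A : T -> R) by exact: measurable_indic.
have [_ Asi] := L2_bddM m1 A1 L2s.
have [_ ui] : L2 P u.
  apply: (L2_le mu (L2_cst P b)) => x; exact: le_trans (ub x) (ler_norm _).
rewrite !nrm_sqr -RintegralZl// -RintegralZl// -RintegralD//; [|exact: intgZ..].
apply: le_Rintegral => //; first by apply: intgD; exact: intgZ.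
move=> x _; rewrite indicE.
have ub2 : u x ^+ 2 <= b ^+ 2.
  by rewrite -(real_normK (num_real (u x))) lerXn2r ?nnegrE// (le_trans _ (ub x)).
have [xA|xA] := boolP (x \in A).
  rewrite mul1r exprMn -[leLHS]add0r; apply: lerD; first by rewrite mulr_ge0 ?sqr_ge0.
  by rewrite ler_wpM2r ?sqr_ge0.
rewrite mul0r expr0n/= mulr0 addr0 exprMn mulrC ler_wpM2r ?sqr_ge0//.
have : `|s x| <= k by move: xA; rewrite notin_setE /A/= => /negP; rewrite -leNgt.
by move=> sk; rewrite -(real_normK (num_real (s x))) lerXn2r ?nnegrE.
Qed.

End square_integrable_more.

(** * Nuisance functions and the von Mises expansion *)

Section nuisances.
Context {d dL : measure_display} {T : measurableType d}
  {TL : measurableType dL} {R : realType}.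
Variables (W : {mfun T >-> TL}) (D X Z : T -> R) (c e : R).
Hypotheses (mD : measurable_fun setT D) (mX : measurable_fun setT X)
  (mZ : measurable_fun setT Z).
Hypotheses (D_le1 : forall x, `|D x| <= 1) (Z_lec : forall x, `|Z x| <= c).
Hypothesis (e_gt0 : 0 < e).

Record nuisances := Nuisances {
  n_del : TL -> R; n_rho : TL -> R; n_kap : TL -> R;
  n_eta : TL -> R; n_gam : TL -> R }.

(* The bounds hold everywhere, so that the nuisance functions of one law can be
   integrated against another one. *)
Record is_nuisances (P : probability T R) (K : R) (n : nuisances) : Prop := {
  m_del : measurable_fun setT (n_del n);
  m_rho : measurable_fun setT (n_rho n);
  m_kap : measurable_fun setT (n_kap n);
  m_eta : measurable_fun setT (n_eta n);
  m_gam : measurable_fun setT (n_gam n);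
  del_le1 : forall l, `|n_del n l| <= 1;
  rho_lec : forall l, `|n_rho n l| <= c;
  kap_ge : forall l, e <= `|n_kap n l|;
  kap_le : forall l, `|n_kap n l| <= 2 * c + e;
  L2_X : L2 P X;
  L2_eta : L2 P (fun x => n_eta n (W x));
  L2_gam : L2 P (fun x => n_gam n (W x));
  nrm_X : nrm P X <= K;
  nrm_eta : nrm P (fun x => n_eta n (W x)) <= K;
  nrm_gam : nrm P (fun x => n_gam n (W x)) <= K;
  res_D : forall h : TL -> R, measurable_fun setT h -> intg P (fun x => h (W x)) ->
    mean_zero P (fun x => h (W x) * (D x - n_del n (W x)));
  res_Z : forall h : TL -> R, measurable_fun setT h -> intg P (fun x => h (W x)) ->
    mean_zero P (fun x => h (W x) * (Z x - n_rho n (W x)));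
  res_DZ : forall h : TL -> R, measurable_fun setT h -> intg P (fun x => h (W x)) ->
    mean_zero P (fun x => h (W x) *
      (D x * Z x - (n_kap n (W x) + n_del n (W x) * n_rho n (W x))));
  res_X : forall (h : TL -> R) (k : R), measurable_fun setT h -> (forall l, `|h l| <= k) ->
    mean_zero P (fun x => h (W x) * (X x - n_eta n (W x)));
  res_XZ : forall (h : TL -> R) (k : R), measurable_fun setT h -> (forall l, `|h l| <= k) ->
    mean_zero P (fun x => h (W x) *
      (X x * Z x - (n_gam n (W x) * n_kap n (W x) + n_eta n (W x) * n_rho n (W x))))
}.

Definition outcome (n : nuisances) x := (1 - D x) * n_gam n (W x) + X x.

Definition wgt (m : nuisances) l := (1 - n_del m l) / n_kap m l.

Definition xi (m : nuisances) x := wgt m (W x) * (Z x - n_rho m (W x)).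

Definition resid (n : nuisances) x :=
  X x - n_eta n (W x) - n_gam n (W x) * (D x - n_del n (W x)).

(** For equal arguments this is the efficient influence function plus the constant psi. *)
Definition Phi (n m : nuisances) x := outcome n x + xi m x * resid n x.

Lemma intg_L2 (P : probability T R) f : L2 P f -> intg P f.
Proof.
move=> L2f; have := L2M L2f (L2_cst P 1).
by congr (integrable P setT _); apply/funext => x /=; rewrite mulr1.
Qed.

Lemma indic_le1 (F : set TL) l : `|\1_F l : R| <= 1.
Proof. by rewrite indicE; case: (_ \in _); rewrite ?normr1 ?normr0. Qed.

Lemma measurable_wgt P K m : is_nuisances P K m -> measurable_fun setT (wgt m).
Proof. by case=> *; rewrite /wgt; meas. Qed.

Lemma measurable_xi P K m : is_nuisances P K m -> measurable_fun setT (xi m).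
Proof. by move=> Hm; have := measurable_wgt Hm; case: Hm => *; rewrite /xi; meas. Qed.

Lemma measurable_resid P K m : is_nuisances P K m -> measurable_fun setT (resid m).
Proof. by case=> *; rewrite /resid; meas. Qed.

Lemma measurable_outcome P K m : is_nuisances P K m -> measurable_fun setT (outcome m).
Proof. by case=> *; rewrite /outcome; meas. Qed.

Lemma wgt_le P K m l : is_nuisances P K m -> `|wgt m l| <= 2 / e.
Proof.
move=> Hm; rewrite /wgt normrM normfV ler_pM ?invr_ge0//.
  apply: le_trans (ler_normB _ _) _; rewrite normr1.
  by have := del_le1 Hm l; lra.
have ke := kap_ge Hm l.
by rewrite lef_pV2// posrE// (lt_le_trans e_gt0).
Qed.

Lemma xi_le P K m x : is_nuisances P K m -> `|xi m x| <= 2 / e * (2 * c).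
Proof.
move=> Hm; rewrite /xi normrM ler_pM//; first exact: wgt_le Hm.
apply: le_trans (ler_normB _ _) _.
by have := rho_lec Hm (W x); have := Z_lec x; lra.
Qed.

(** The weight of another law is allowed because [wgt m] and [n_rho m] depend on L alone. The
    product is expanded in X Z, X, Z, D Z and D, each centred at its conditional mean under [P]; the
    terms gamma kappa coming from X Z and from D Z cancel. The unbounded X and X Z meet bounded
    coefficients only, whereas gamma and eta, merely integrable, multiply the bounded Z, D and D
    Z. *)
Lemma mean_zero_xi_resid P K n Q K' m F : is_nuisances P K n -> is_nuisances Q K' m ->
  measurable F -> mean_zero P (fun x => \1_F (W x) * (xi m x * resid n x)).
Proof.
move=> Hn Hm mF; have mw := measurable_wgt Hm; have wl l := wgt_le l Hm.
have [? ? ? ? ? dl rl _ _ L2x L2e L2g _ _ _ rD rZ rDZ rX rXZ] := Hn.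
have mrho' := m_rho Hm; have rl' := rho_lec Hm.
have ig := intg_L2 L2g; have ie := intg_L2 L2e.
have m1 : measurable_fun setT (\1_F : TL -> R) by exact: measurable_indic.
pose w1 l := \1_F l * wgt m l.
have mw1 : measurable_fun setT w1 by rewrite /w1; meas.
have w1l l : `|w1 l| <= 2 / e.
  rewrite /w1 normrM -[leRHS]mul1r ler_pM//; exact: indic_le1.
have bM (h : TL -> R) (f : TL -> R) (k : R) : measurable_fun setT h ->
    (forall l, `|h l| <= k) -> intg P (fun x => f (W x)) ->
    intg P (fun x => h (W x) * f (W x)).
  by move=> mh hk fi; apply: (intg_bddM _ (fun x => hk (W x))) => //; meas.
have w1r l : `|w1 l * n_rho m l| <= 2 / e * c by rewrite normrM ler_pM.
have mw1r : measurable_fun setT (fun l => w1 l * n_rho m l) by meas.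
have iw1g : intg P (fun x => w1 (W x) * n_gam n (W x)) by exact: bM ig.
have z1 := rXZ w1 _ mw1 w1l.
have z2 := rX (fun l => w1 l * n_rho m l) _ mw1r w1r.
have z3 : mean_zero P (fun x => w1 (W x) * (n_eta n (W x) - n_gam n (W x) * n_del n (W x))
    * (Z x - n_rho n (W x))).
  apply: (rZ (fun l => w1 l * (n_eta n l - n_gam n l * n_del n l))); first by meas.
  apply: (bM w1 (fun l => n_eta n l - n_gam n l * n_del n l) _ mw1 w1l).
  apply: intgB => //; under eq_fun do rewrite mulrC.
  exact: (bM _ _ _ _ dl).
have z4 := rDZ (fun l => w1 l * n_gam n l) ltac:(meas) iw1g.
have z5 : mean_zero P (fun x => w1 (W x) * n_rho m (W x) * n_gam n (W x)
    * (D x - n_del n (W x))).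
  apply: (rD (fun l => w1 l * n_rho m l * n_gam n l)); first by meas.
  exact: (bM (fun l => w1 l * n_rho m l) _ _ mw1r w1r ig).
have := mean_zeroD (mean_zeroB (mean_zeroB (mean_zeroB z1 z2) z3) z4) z5.
congr (mean_zero P _); apply/funext => x; rewrite /xi /resid /w1; ring.
Qed.

(** Given L, Cov_Q(X - gamma_n D, Z) = (gamma_m - gamma_n) kappa_m under [Q], and the weight divides
    by kappa_m. What remains is (1 - delta_m)(gamma_m - gamma_n), the conditional mean of the first
    term. Of [n] only its measurability and the bound on [n_del] are used, besides square
    integrability on [F] under [Q]. *)
Lemma mean_zero_gam_diff Q K' m n F : is_nuisances Q K' m ->
  (exists P K, is_nuisances P K n) ->
  measurable F -> L2 Q (fun x => \1_F (W x) * n_gam n (W x)) ->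
  L2 Q (fun x => \1_F (W x) * n_eta n (W x)) ->
  mean_zero Q (fun x => \1_F (W x) * ((1 - D x) * (n_gam m (W x) - n_gam n (W x))
    - xi m x * resid n x)).
Proof.
move=> Hm [P [K Hn]] mF L2gn L2en; have mw := measurable_wgt Hm; have wl l := wgt_le l Hm.
have kap0 l : n_kap m l != 0.
  by rewrite -normr_gt0 (lt_le_trans e_gt0)// (kap_ge Hm).
have [? ? ? ? ? dl rl _ _ L2x L2e L2g _ _ _ rD rZ rDZ rX rXZ] := Hm.
have ? := m_gam Hn; have ? := m_eta Hn; have ? := m_del Hn; have dl' := del_le1 Hn.
have ig := intg_L2 L2g; have ign := intg_L2 L2gn; have ien := intg_L2 L2en.
have m1 : measurable_fun setT (\1_F : TL -> R) by exact: measurable_indic.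
pose g1 l := \1_F l * n_gam n l; pose e1 l := \1_F l * n_eta n l.
have mg1 : measurable_fun setT g1 by rewrite /g1; meas.
have me1 : measurable_fun setT e1 by rewrite /e1; meas.
have bM (h : TL -> R) (f : TL -> R) (k : R) : measurable_fun setT h ->
    (forall l, `|h l| <= k) -> intg Q (fun x => f (W x)) ->
    intg Q (fun x => h (W x) * f (W x)).
  by move=> mh hk fi; apply: (intg_bddM _ (fun x => hk (W x))) => //; meas.
pose w1 l := \1_F l * wgt m l.
have mw1 : measurable_fun setT w1 by rewrite /w1; meas.
have w1l l : `|w1 l| <= 2 / e.
  rewrite /w1 normrM -[leRHS]mul1r ler_pM//; exact: indic_le1.
have w1r l : `|w1 l * n_rho m l| <= 2 / e * c by rewrite normrM ler_pM.
have wr l : `|wgt m l * n_rho m l| <= 2 / e * c by rewrite normrM ler_pM.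
have mw1r : measurable_fun setT (fun l => w1 l * n_rho m l) by meas.
have mwr : measurable_fun setT (fun l => wgt m l * n_rho m l) by meas.
have z1 := rXZ w1 _ mw1 w1l.
have z2 := rX (fun l => w1 l * n_rho m l) _ mw1r w1r.
have z3 : mean_zero Q (fun x => wgt m (W x) * (e1 (W x) - n_del n (W x) * g1 (W x))
    * (Z x - n_rho m (W x))).
  apply: (rZ (fun l => wgt m l * (e1 l - n_del n l * g1 l))); first by meas.
  apply: (bM (wgt m) (fun l => e1 l - n_del n l * g1 l) _ mw wl).
  by apply: intgB => //; exact: (bM _ g1 _ _ dl').
have z4 : mean_zero Q (fun x => wgt m (W x) * g1 (W x) *
    (D x * Z x - (n_kap m (W x) + n_del m (W x) * n_rho m (W x)))).
  apply: (rDZ (fun l => wgt m l * g1 l)); first by meas.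
  exact: (bM _ g1 _ mw wl).
have z5 : mean_zero Q (fun x => wgt m (W x) * n_rho m (W x) * g1 (W x)
    * (D x - n_del m (W x))).
  apply: (rD (fun l => wgt m l * n_rho m l * g1 l)); first by meas.
  exact: (bM (fun l => wgt m l * n_rho m l) g1 _ mwr wr).
have z6 : mean_zero Q (fun x => (\1_F (W x) * n_gam m (W x) - g1 (W x))
    * (D x - n_del m (W x))).
  apply: (rD (fun l => \1_F l * n_gam m l - g1 l)); first by meas.
  by apply: intgB => //; exact: (bM _ _ 1 m1 (indic_le1 F)).
have := mean_zeroB (mean_zeroB (mean_zeroD (mean_zeroD (mean_zeroB z2 z1) z3) z4) z5) z6.
congr (mean_zero Q _); apply/funext => x; rewrite /xi /resid /w1 /g1 /e1 /wgt.
by field.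
Qed.

Lemma L2_outcome P K n : is_nuisances P K n -> L2 P (outcome n).
Proof.
move=> Hn; apply: L2D; last exact: L2_X Hn.
apply: (L2_bddM (K := 2)); [by meas| |exact: L2_gam Hn].
by move=> x; rewrite (le_trans (ler_normB _ _))// normr1; have := D_le1 x; lra.
Qed.

(** Under [Q] the correction [xi m * resid n] compensates exactly for writing [outcome n] in place
    of [outcome m]; under [P] it has mean zero. *)
Lemma von_mises P K n Q K' m F : is_nuisances P K n -> is_nuisances Q K' m ->
  measurable F -> L2 Q (fun x => \1_F (W x) * n_gam n (W x)) ->
  L2 Q (fun x => \1_F (W x) * n_eta n (W x)) ->
  \int[Q]_x (\1_F (W x) * outcome m x) - \int[P]_x (\1_F (W x) * outcome n x) =
  \int[Q]_x (\1_F (W x) * Phi n m x) - \int[P]_x (\1_F (W x) * Phi n m x).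
Proof.
move=> Hn Hm mF L2gn L2en.
have m0 : measurable_fun setT (\1_F : TL -> R) by exact: measurable_indic.
have m1 : measurable_fun setT (fun x => \1_F (W x) : R) by meas.
have iom := intg_bddM m1 (fun x => indic_le1 F (W x)) (intg_L2 (L2_outcome Hm)).
have ion := intg_bddM m1 (fun x => indic_le1 F (W x)) (intg_L2 (L2_outcome Hn)).
have [z1i z1] := mean_zero_gam_diff Hm (ex_intro _ P (ex_intro _ K Hn)) mF L2gn L2en.
have [z2i z2] := mean_zero_xi_resid Hn Hm mF.
congr (_ - _).
  rewrite -[LHS]subr0 -z1 -RintegralB//.
  by apply: eq_Rintegral => x _; rewrite /Phi /outcome; ring.
rewrite -[LHS]addr0 -z2 -RintegralD//.
by apply: eq_Rintegral => x _; rewrite /Phi /outcome; ring.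
Qed.

(* Differentiability in quadratic mean with score s provides this bound for
   P = P0 and Q = P_t, with tau = |t| and r = o(|t|). *)
Definition close (s : T -> R) (P0 P Q : probability T R) (tau r : R) :=
  forall (h f : T -> R) (K : R), measurable_fun setT h -> (forall x, `|h x| <= K) ->
  L2 P f -> L2 Q f ->
  `|\int[Q]_x (h x * f x) - \int[P]_x (h x * f x)| <=
  (nrm P f + nrm Q f) * (tau * nrm P0 (fun x => h x * s x) + K * r).

Lemma close_sym s P0 P Q tau r : close s P0 P Q tau r -> close s P0 Q P tau r.
Proof. by move=> H h f K mh hK Lp Lq; rewrite distrC [nrm Q f + _]addrC; exact: H. Qed.

(** * Bounds for two laws that are close *)

Section pair.
Variables (s : T -> R) (P0 : probability T R) (tau r K : R).
Hypotheses (L2s : L2 P0 s) (tau0 : 0 <= tau) (r0 : 0 <= r) (c0 : 0 <= c).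
Implicit Types (P Q : probability T R) (n m : nuisances).

(** [Kxi] bounds |xi|: 2 / e for the weight, 2 c for Z - rho. [K1] bounds the three coefficients
    into which [lipschitz_step] splits [Phi]; the largest is |1 - D| + |xi| |D - delta| <= 2 + 2
    Kxi. *)
Local Notation Kxi := (2 / e * (2 * c)).
Local Notation K1 := (2 + 2 * Kxi).

Lemma Kxi_ge0 : 0 <= Kxi.
Proof. by apply: mulr_ge0; [apply: divr_ge0 => //; exact: ltW|exact: mulr_ge0]. Qed.

(** The indicator of [F] is kept on the score: its norm there is the only source of smallness of the
    first-order term when [F] is a tail event. *)
Lemma close_indic P Q F (h f : T -> R) (k : R) : close s P0 P Q tau r -> measurable F -> measurable_fun setT h ->
  (forall x, `|h x| <= K1 * \1_F (W x)) ->
  L2 P f -> L2 Q f -> nrm P f <= k -> nrm Q f <= k ->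
  `|\int[Q]_x (h x * f x) - \int[P]_x (h x * f x)| <=
  2 * k * (K1 * (tau * nrm P0 (fun x => \1_F (W x) * s x) + r)).
Proof.
move=> PQ mF mh hF Lp Lq pk qk.
have K10 : 0 <= K1 by have := Kxi_ge0; lra.
have m0 : measurable_fun setT (\1_F : TL -> R) by exact: measurable_indic.
have m1 : measurable_fun setT (fun x => \1_F (W x) : R) by meas.
have hK x : `|h x| <= K1.
  apply: le_trans (hF x) _; rewrite -[leRHS]mulr1 ler_wpM2l//.
apply: le_trans (PQ _ _ _ mh hK Lp Lq) _.
have L2Fs := L2_bddM m1 (fun x => indic_le1 F (W x)) L2s.
have hs : nrm P0 (fun x => h x * s x) <= K1 * nrm P0 (fun x => \1_F (W x) * s x).
  rewrite -[K1 in leRHS]ger0_norm// -nrmZ//; apply: le_nrm; last 2 first.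
  - exact: L2Z.
  - move=> x; rewrite !normrM mulrA ler_wpM2r// (ger0_norm K10).
    apply: le_trans (hF x) _; rewrite ler_wpM2l//; exact: ler_norm.
  - by case: L2s => ms _; meas.
rewrite ler_pM ?addr_ge0 ?nrm_ge0 ?mulr_ge0 ?(le_trans _ (hK _)) ?nrm_ge0//.
- lra.
- by rewrite mulrDr lerD2r mulrCA ler_wpM2l.
Qed.

Lemma lipschitz_step P Q n m F (k : R) : close s P0 P Q tau r ->
  is_nuisances P K n -> is_nuisances Q K m -> measurable F -> K <= k ->
  L2 Q (fun x => \1_F (W x) * n_gam n (W x)) ->
  L2 Q (fun x => \1_F (W x) * n_eta n (W x)) ->
  nrm Q (fun x => \1_F (W x) * n_gam n (W x)) <= k ->
  nrm Q (fun x => \1_F (W x) * n_eta n (W x)) <= k ->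
  `|\int[Q]_x (\1_F (W x) * outcome m x) - \int[P]_x (\1_F (W x) * outcome n x)| <=
  6 * k * (K1 * (tau * nrm P0 (fun x => \1_F (W x) * s x) + r)).
Proof.
move=> PQ Pn Qm mF Kk Lg Le ng ne.
rewrite (von_mises Pn Qm mF Lg Le).
have mxi := measurable_xi Qm; have xil := fun x => xi_le x Qm; have K0 := Kxi_ge0.
have [mdel mrho mkap meta mgam dl rl _ _ L2X L2e L2g nX neta ngam _ _ _ _ _] := Pn.
have m0 : measurable_fun setT (\1_F : TL -> R) by exact: measurable_indic.
have m1 : measurable_fun setT (fun x => \1_F (W x) : R) by meas.
have i1 := fun x => indic_le1 F (W x).
(* On [F], [Phi n m] is a combination of gamma, X and eta with the bounded coefficients [h1], [h2],
   [h3]. Each of the three terms costs 2 k, whence the factor 6 k. *)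
pose h1 x := \1_F (W x) * (1 - D x - xi m x * (D x - n_del n (W x))).
pose h2 x := \1_F (W x) * (1 + xi m x).
pose h3 x := \1_F (W x) * - xi m x.
have mh1 : measurable_fun setT h1 by rewrite /h1; meas.
have mh2 : measurable_fun setT h2 by rewrite /h2; meas.
have mh3 : measurable_fun setT h3 by rewrite /h3; meas.
have hb (u : T -> R) x : `|u x| <= K1 -> `|\1_F (W x) * u x| <= K1 * \1_F (W x).
  by move=> uK; rewrite normrM mulrC (ger0_norm (_ : 0 <= \1_F (W x)))// ?ler_wpM2r// indicE.
have b1 x : `|h1 x| <= K1 * \1_F (W x).
  apply: (hb (fun x => 1 - D x - xi m x * (D x - n_del n (W x)))).
  apply: le_trans (ler_normB _ _) _; rewrite lerD//.
    by apply: le_trans (ler_normB _ _) _; rewrite normr1; have := D_le1 x; lra.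
  rewrite normrM mulrC ler_pM//.
  by apply: le_trans (ler_normB _ _) _; have := D_le1 x; have := dl (W x); lra.
have b2 x : `|h2 x| <= K1 * \1_F (W x).
  apply: (hb (fun x => 1 + xi m x)); apply: le_trans (ler_normD _ _) _.
  by rewrite normr1; have := xil x; lra.
have b3 x : `|h3 x| <= K1 * \1_F (W x).
  by apply: (hb (fun x => - xi m x)); rewrite normrN; have := xil x; lra.
have L2g' := L2_bddM m1 i1 L2g; have L2e' := L2_bddM m1 i1 L2e.
have nle (u : T -> R) : L2 P u -> nrm P u <= K -> nrm P (fun x => \1_F (W x) * u x) <= k.
  move=> L2u uK; apply: le_trans (nrm_bddM m1 i1 L2u) _.
  by rewrite normr1 mul1r (le_trans uK).
have L2Qx := L2_X Qm.
have nQX : nrm Q X <= k by exact: le_trans (nrm_X Qm) Kk.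
have nPX : nrm P X <= k by exact: le_trans nX Kk.
have c1 := close_indic PQ mF mh1 b1 L2g' Lg (nle _ L2g ngam) ng.
have c2 := close_indic PQ mF mh2 b2 L2X L2Qx nPX nQX.
have c3 := close_indic PQ mF mh3 b3 L2e' Le (nle _ L2e neta) ne.
have bK (h : T -> R) : (forall x, `|h x| <= K1 * \1_F (W x)) -> forall x, `|h x| <= K1.
  move=> hF x; apply: le_trans (hF x) _; rewrite -[leRHS]mulr1 ler_wpM2l//.
  by lra.
have split_int (S : probability T R) : L2 S X ->
    L2 S (fun x => \1_F (W x) * n_gam n (W x)) ->
    L2 S (fun x => \1_F (W x) * n_eta n (W x)) ->
    \int[S]_x (\1_F (W x) * Phi n m x) =
    \int[S]_x (h1 x * (\1_F (W x) * n_gam n (W x))) + \int[S]_x (h2 x * X x) +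
    \int[S]_x (h3 x * (\1_F (W x) * n_eta n (W x))).
  move=> SX Sg Se.
  have j1 := intg_bddM mh1 (bK _ b1) (intg_L2 Sg).
  have j2 := intg_bddM mh2 (bK _ b2) (intg_L2 SX).
  have j3 := intg_bddM mh3 (bK _ b3) (intg_L2 Se).
  rewrite -RintegralD// -RintegralD//; last exact: intgD.
  apply: eq_Rintegral => x _; rewrite /h1 /h2 /h3 /Phi /outcome /resid indicE.
  by case: (_ \in _); rewrite ?mul0r//=; ring.
rewrite !split_int//.
move: c1 c2 c3 => /ler_normlP[c1 c1'] /ler_normlP[c2 c2'] /ler_normlP[c3 c3'].
by apply/ler_normlP; split; lra.
Qed.

Lemma lipschitz P Q n m G : close s P0 P Q tau r ->
  is_nuisances P K n -> is_nuisances Q K m -> measurable G ->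
  `|\int[Q]_x (\1_G (W x) * outcome m x) - \int[P]_x (\1_G (W x) * outcome n x)| <=
  24 * K * (K1 * (tau * nrm P0 (fun x => \1_G (W x) * s x) + r)).
Proof.
move=> PQ Pn Qm mG.
have K0 : 0 <= K by exact: le_trans (nrm_ge0 _ _) (nrm_X Pn).
have K10 : 0 <= K1 by have := Kxi_ge0; lra.
pose b n l := `|n_gam n l| + `|n_eta n l|.
have mb S k : is_nuisances S K k -> measurable_fun setT (b k).
  by case=> *; rewrite /b; meas.
(* On [E] the gamma and eta of [n] are dominated by [b m], which has norm at most 2 K under [Q]; off
   [E] the two laws exchange roles. Each piece costs 6 * (2 * K) by [lipschitz_step], hence 24 in
   total. *)
pose E := [set l | b n l <= b m l].
have mE : measurable E by apply: measurable_set_le; [exact: mb Pn|exact: mb Qm].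
have L2b S k : is_nuisances S K k ->
    L2 S (fun x => b k (W x)) /\ nrm S (fun x => b k (W x)) <= 2 * K.
  move=> Sk; have [? ? ? ? ? _ _ _ _ _ Le [Lg1 Lg2] _ ne ng _ _ _ _ _] := Sk.
  have Lg : L2 S (fun x => n_gam k (W x)) by [].
  have Lg' : L2 S (fun x => `|n_gam k (W x)|).
    by apply: (L2_le _ Lg); [meas|move=> x; rewrite normr_id].
  have Le' : L2 S (fun x => `|n_eta k (W x)|).
    by apply: (L2_le _ Le); [meas|move=> x; rewrite normr_id].
  split; first exact: L2D.
  apply: le_trans (nrmD Lg' Le') _.
  rewrite (_ : 2 * K = K + K); last by ring.
  apply: lerD; [apply: le_trans ng|apply: le_trans ne]; apply: le_nrm => //; try meas.
    by move=> x; rewrite normr_id.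
  by move=> x; rewrite normr_id.
have step S S' k k' F : close s P0 S S' tau r -> is_nuisances S K k ->
    is_nuisances S' K k' -> measurable F -> F `<=` G ->
    (forall l, F l -> b k l <= b k' l) ->
    `|\int[S']_x (\1_F (W x) * outcome k' x) - \int[S]_x (\1_F (W x) * outcome k x)| <=
    12 * K * (K1 * (tau * nrm P0 (fun x => \1_G (W x) * s x) + r)).
  move=> SS Sk Sk' mF FG Fb; have [Lb nb] := L2b _ _ Sk'.
  have [? ? ? ? ? _ _ _ _ _ _ _ _ _ _ _ _ _ _ _] := Sk.
  have m0 : measurable_fun setT (\1_F : TL -> R) by exact: measurable_indic.
  have m1 : measurable_fun setT (fun x => \1_F (W x) : R) by meas.
  have m0G : measurable_fun setT (\1_G : TL -> R) by exact: measurable_indic.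
  have m1G : measurable_fun setT (fun x => \1_G (W x) : R) by meas.
  have le1 x : `|\1_F (W x) * n_gam k (W x)| <= `|b k' (W x)|.
    rewrite [leRHS]ger0_norm ?addr_ge0// indicE; case: (boolP (_ \in _)) => [|_]; last first.
      by rewrite mul0r normr0 addr_ge0.
    by rewrite inE mul1r => /Fb; apply: le_trans; rewrite lerDl.
  have le2 x : `|\1_F (W x) * n_eta k (W x)| <= `|b k' (W x)|.
    rewrite [leRHS]ger0_norm ?addr_ge0// indicE; case: (boolP (_ \in _)) => [|_]; last first.
      by rewrite mul0r normr0 addr_ge0.
    by rewrite inE mul1r => /Fb; apply: le_trans; rewrite lerDr.
  have mg1 : measurable_fun setT (fun x => \1_F (W x) * n_gam k (W x)) by meas.
  have me1 : measurable_fun setT (fun x => \1_F (W x) * n_eta k (W x)) by meas.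
  have := lipschitz_step SS Sk Sk' mF (_ : K <= 2 * K) (L2_le mg1 Lb le1)
    (L2_le me1 Lb le2) (le_trans (le_nrm mg1 Lb le1) nb) (le_trans (le_nrm me1 Lb le2) nb).
  move=> /(_ ltac:(lra)) /le_trans; apply.
  rewrite (_ : 6 * (2 * K) = 12 * K); last by ring.
  rewrite ler_wpM2l// ?mulr_ge0// ler_wpM2l// lerD2r ler_wpM2l//.
  have L2G := L2_bddM m1G (fun x => indic_le1 G (W x)) L2s.
  apply: le_nrm => //; first by case: L2s => *; meas.
  move=> x; rewrite !normrM ler_wpM2r// !indicE.
  case: (boolP (W x \in F)); rewrite ?normr0//.
  by rewrite inE => /FG/mem_set ->.
have s1 := step P Q n m (G `&` E) PQ Pn Qm (measurableI _ _ mG mE) (@subIsetl _ _ _)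
  (fun l => @proj2 _ _).
have notE l : (G `&` ~` E) l -> b m l <= b n l.
  by move=> [_ /negP]; rewrite -ltNge => /ltW.
have s2 := step Q P m n (G `&` ~` E) (close_sym PQ) Qm Pn
  (measurableI _ _ mG (measurableC mE)) (@subIsetl _ _ _) notE.
have split_int S k : is_nuisances S K k -> \int[S]_x (\1_G (W x) * outcome k x) =
    \int[S]_x (\1_(G `&` E) (W x) * outcome k x) +
    \int[S]_x (\1_(G `&` ~` E) (W x) * outcome k x).
  move=> Sk; have Lo := intg_L2 (L2_outcome Sk).
  have m0 F : measurable F -> measurable_fun setT (fun x => \1_F (W x) : R).
    move=> mF; have : measurable_fun setT (\1_F : TL -> R) by exact: measurable_indic.
    by move=> m0; meas.
  rewrite -RintegralD//.
  - apply: eq_Rintegral => x _; rewrite -mulrDl; congr (_ * _).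
    rewrite !indicE !in_setI in_setC.
    by case: (_ \in G); case: (_ \in E); rewrite ?addr0 ?add0r.
  - by apply: (intg_bddM _ (fun x => indic_le1 _ (W x)) Lo); apply: m0; exact: measurableI.
  - apply: (intg_bddM _ (fun x => indic_le1 _ (W x)) Lo); apply: m0.
    by apply: measurableI => //; exact: measurableC.
rewrite (split_int _ _ Pn) (split_int _ _ Qm).
move: s1 s2 => /ler_normlP[s1 s1'] /ler_normlP[s2 s2'].
by apply/ler_normlP; split; lra.
Qed.

(** The expansion on [G] carries the weight [xi m]; changing it to [xi n] costs (E_Q -
    E_0)[(xi m - xi n) 1_G resid n]. Taking h = xi m - xi n in [close] puts this difference next to
    the score. On [G] both |resid n| and |outcome n| are at most |X| + 3 k, so they are square
    integrable under either law. *)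
Lemma good_part Q n m (k : R) (G := [set l | `|n_gam n l| + `|n_eta n l| <= k]) :
  close s P0 P0 Q tau r -> is_nuisances P0 K n -> is_nuisances Q K m ->
  measurable G -> 0 <= k ->
  `|\int[Q]_x (\1_G (W x) * outcome m x) - \int[P0]_x (\1_G (W x) * outcome n x)
    - (\int[Q]_x (\1_G (W x) * Phi n n x) - \int[P0]_x (\1_G (W x) * Phi n n x))| <=
  2 * (K + 3 * k) * (tau * nrm P0 (fun x => (xi m x - xi n x) * s x) + 2 * Kxi * r).
Proof.
move=> PQ Pn Qm mG k0.
have mxi := measurable_xi Qm; have mxi' := measurable_xi Pn.
have mres := measurable_resid Pn; have mout := measurable_outcome Pn.
have xil := fun x => xi_le x Qm; have xil' := fun x => xi_le x Pn.
have dl := del_le1 Pn; have ? := m_gam Pn; have ? := m_eta Pn.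
have m0 : measurable_fun setT (\1_G : TL -> R) by exact: measurable_indic.
have m1 : measurable_fun setT (fun x => \1_G (W x) : R) by meas.
have i1 := fun x => indic_le1 G (W x).
have L2c (S : probability T R) (a : R) : L2 S X -> L2 S (fun x => `|X x| + a).
  move=> LX; apply: L2D; last exact: L2_cst.
  by apply: (L2_le _ LX); [meas|move=> x; rewrite normr_id].
have Gb (S : probability T R) (u : T -> R) : measurable_fun setT u ->
    (forall x, G (W x) -> `|u x| <= `|X x| + 3 * k) -> L2 S X ->
    L2 S (fun x => \1_G (W x) * u x) /\
    nrm S (fun x => \1_G (W x) * u x) <= nrm S X + 3 * k.
  move=> mu ub LX.
  have le x : `|\1_G (W x) * u x| <= `| `|X x| + 3 * k|.
    rewrite [leRHS]ger0_norm ?addr_ge0 ?mulr_ge0// indicE.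
    case: (boolP (_ \in _)) => [|_]; first by rewrite inE mul1r; exact: ub.
    by rewrite mul0r normr0 addr_ge0 ?mulr_ge0.
  have mGu : measurable_fun setT (fun x => \1_G (W x) * u x) by meas.
  split; first exact: L2_le mGu (L2c _ _ LX) le.
  apply: le_trans (le_nrm mGu (L2c _ _ LX) le) _.
  have LX' : L2 S (fun x => `|X x|).
    by apply: (L2_le _ LX); [meas|move=> x; rewrite normr_id].
  apply: le_trans (nrmD LX' (L2_cst S (3 * k))) _.
  rewrite nrm_cst (ger0_norm (_ : 0 <= 3 * k)) ?mulr_ge0// lerD2r.
  by apply: le_nrm => //; [meas|move=> x; rewrite normr_id].
have Gg x : G (W x) -> `|n_gam n (W x)| <= k.
  by rewrite /G/= => ?; have := normr_ge0 (n_eta n (W x)); lra.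
have resb x : G (W x) -> `|resid n x| <= `|X x| + 3 * k.
  move=> Gx; apply: le_trans (ler_normB _ _) _.
  have : `|n_gam n (W x) * (D x - n_del n (W x))| <= k * 2.
    rewrite normrM ler_pM// ?Gg//; apply: le_trans (ler_normB _ _) _.
    by have := D_le1 x; have := dl (W x); lra.
  have := ler_normB (X x) (n_eta n (W x)); move: Gx; rewrite /G/=.
  by have := normr_ge0 (n_gam n (W x)); lra.
have outb x : G (W x) -> `|outcome n x| <= `|X x| + 3 * k.
  move=> Gx; apply: le_trans (ler_normD _ _) _.
  have : `|(1 - D x) * n_gam n (W x)| <= 2 * k.
    rewrite normrM ler_pM// ?Gg//; apply: le_trans (ler_normB _ _) _.
    by rewrite normr1; have := D_le1 x; lra.
  lra.
have Lg (S : probability T R) : L2 S X -> L2 S (fun x => \1_G (W x) * n_gam n (W x)).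
  move=> LX; apply: (Gb S (fun x => n_gam n (W x)) _ _ LX).1; first by meas.
  by move=> x /Gg; have := normr_ge0 (X x); lra.
have Le (S : probability T R) : L2 S X -> L2 S (fun x => \1_G (W x) * n_eta n (W x)).
  move=> LX; apply: (Gb S (fun x => n_eta n (W x)) _ _ LX).1; first by meas.
  move=> x; rewrite /G/=; have := normr_ge0 (X x); have := normr_ge0 (n_gam n (W x)).
  lra.
have LX := L2_X Pn; have LX' := L2_X Qm.
rewrite (von_mises Pn Qm mG (Lg _ LX') (Le _ LX')).
have dPhi (S : probability T R) : L2 S X ->
    \int[S]_x (\1_G (W x) * Phi n m x) - \int[S]_x (\1_G (W x) * Phi n n x) =
    \int[S]_x ((xi m x - xi n x) * (\1_G (W x) * resid n x)).
  move=> SX; have io := intg_L2 (Gb _ _ mout outb SX).1.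
  have ir := intg_L2 (Gb _ _ mres resb SX).1.
  have j1 := intgD io (intg_bddM mxi xil ir).
  have j2 := intgD io (intg_bddM mxi' xil' ir).
  transitivity (\int[S]_x (\1_G (W x) * outcome n x + xi m x * (\1_G (W x) * resid n x))
    - \int[S]_x (\1_G (W x) * outcome n x + xi n x * (\1_G (W x) * resid n x))).
    by congr (_ - _); apply: eq_Rintegral => x _; rewrite /Phi; ring.
  by rewrite -RintegralB//; apply: eq_Rintegral => x _; ring.
have E (a b a' b' : R) : a - b - (a' - b') = (a - a') - (b - b') by ring.
rewrite E dPhi// dPhi//.
have mxx : measurable_fun setT (fun x => xi m x - xi n x) by meas.
have xxl x : `|xi m x - xi n x| <= 2 * Kxi.
  by apply: le_trans (ler_normB _ _) _; have := xil x; have := xil' x; lra.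
apply: le_trans (PQ _ _ _ mxx xxl (Gb _ _ mres resb LX).1 (Gb _ _ mres resb LX').1) _.
rewrite ler_wpM2r//.
  by rewrite addr_ge0// mulr_ge0 ?nrm_ge0// mulr_ge0// Kxi_ge0.
have [_ ] := Gb _ _ mres resb LX; have [_] := Gb _ _ mres resb LX'.
by have := nrm_X Pn; have := nrm_X Qm; lra.
Qed.

(** With u = gQ - gP, the function h = u (2 V - gP - gQ) has mean E_Q[u^2] under [Q] and - E_P0[u^2]
    under [P0]. The difference of the two means is thus a sum of squares, and [close] applies to [h]
    and the constant 1. The bound |h| <= 2b * 4b, doubled by the two norms of 1, gives 16 b^2. *)
Lemma sq_diff_cond Q (V : T -> R) (gP gQ : TL -> R) (b : R) : close s P0 P0 Q tau r ->
  measurable_fun setT V -> measurable_fun setT gP -> measurable_fun setT gQ ->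
  (forall x, `|V x| <= b) -> (forall l, `|gP l| <= b) -> (forall l, `|gQ l| <= b) ->
  (forall h : TL -> R, measurable_fun setT h -> intg P0 (fun x => h (W x)) ->
    mean_zero P0 (fun x => h (W x) * (V x - gP (W x)))) ->
  (forall h : TL -> R, measurable_fun setT h -> intg Q (fun x => h (W x)) ->
    mean_zero Q (fun x => h (W x) * (V x - gQ (W x)))) ->
  \int[P0]_x ((gQ (W x) - gP (W x)) ^+ 2) <= 16 * b ^+ 2 * (tau * nrm P0 s + r).
Proof.
move=> PQ mV mgP mgQ Vb gPb gQb zP zQ.
pose u l := gQ l - gP l.
have mu : measurable_fun setT u by rewrite /u; meas.
have ub l : `|u l| <= 2 * b.
  by apply: le_trans (ler_normB _ _) _; have := gPb l; have := gQb l; lra.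
have muW : measurable_fun setT (fun x => u (W x)) by meas.
have iu (S : probability T R) : intg S (fun x => u (W x)).
  apply: intg_L2; apply: (L2_le muW (L2_cst S (2 * b))) => x.
  exact: le_trans (ub _) (ler_norm _).
have iu2 (S : probability T R) : intg S (fun x => u (W x) ^+ 2).
  by under eq_fun do rewrite expr2; exact: intg_bddM (iu S).
pose h x := u (W x) * (2 * V x - gP (W x) - gQ (W x)).
have mh : measurable_fun setT h by rewrite /h; meas.
have hb x : `|h x| <= 8 * b ^+ 2.
  rewrite normrM (_ : 8 * b ^+ 2 = 2 * b * (4 * b)); last by ring.
  rewrite ler_pM//; apply: le_trans (ler_normB _ _) _.
  have := ler_normB (2 * V x) (gP (W x)); rewrite normrM (ger0_norm (ler0n _ 2)).
  by have := Vb x; have := gPb (W x); have := gQb (W x); lra.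
have hQ : \int[Q]_x (h x * 1) = \int[Q]_x (u (W x) ^+ 2).
  have [z1 z2] := zQ _ mu (iu Q).
  rewrite -[RHS]addr0 -[X in _ + X](mulr0 2) -z2 -RintegralZl// -RintegralD//; [|exact: iu2|exact: intgZ].
  by apply: eq_Rintegral => x _; rewrite /h /u; ring.
have hP : \int[P0]_x (h x * 1) = - \int[P0]_x (u (W x) ^+ 2).
  have [z1 z2] := zP _ mu (iu P0).
  rewrite -[RHS]add0r -[X in X - _](mulr0 2) -z2 -RintegralZl// -RintegralB//; [|exact: intgZ|exact: iu2].
  by apply: eq_Rintegral => x _; rewrite /h /u; ring.
have := PQ _ _ _ mh hb (L2_cst P0 1) (L2_cst Q 1); rewrite hQ hP !nrm_cst normr1 opprK.
have -> : \int[P0]_x ((gQ (W x) - gP (W x)) ^+ 2) = \int[P0]_x (u (W x) ^+ 2) by [].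
have uQ := int_sqr_ge0 Q (fun x => u (W x)); have uP := int_sqr_ge0 P0 (fun x => u (W x)).
rewrite ger0_norm ?addr_ge0// => H.
have hs : nrm P0 (fun x => h x * s x) <= 8 * b ^+ 2 * nrm P0 s.
  apply: le_trans (nrm_bddM mh hb L2s) _.
  by rewrite (ger0_norm (_ : 0 <= 8 * b ^+ 2))//; apply: mulr_ge0 => //; exact: sqr_ge0.
have : tau * nrm P0 (fun x => h x * s x) <= tau * (8 * b ^+ 2 * nrm P0 s).
  by rewrite ler_wpM2l.
have -> : 16 * b ^+ 2 * (tau * nrm P0 s + r) =
  (1 + 1) * (tau * (8 * b ^+ 2 * nrm P0 s) + 8 * b ^+ 2 * r) by ring.
lra.
Qed.

Local Notation Axi := (2 * c / e + 4 * c ^+ 2 / e ^+ 2 + 4 * c / e ^+ 2 + 2 / e).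

(** kappa enters through kappa + delta rho = E[D Z | L], because [sq_diff_cond] compares conditional
    means and not covariances. *)
Lemma xi_diff_le P Q n m x : is_nuisances P K n -> is_nuisances Q K m ->
  `|xi m x - xi n x| <= Axi * (`|n_del m (W x) - n_del n (W x)|
    + `|n_kap m (W x) + n_del m (W x) * n_rho m (W x)
        - (n_kap n (W x) + n_del n (W x) * n_rho n (W x))|
    + `|n_rho m (W x) - n_rho n (W x)|).
Proof.
move=> Pn Qm; rewrite /xi /wgt; move: (W x) => l.
have := del_le1 Pn l; have := del_le1 Qm l; have := rho_lec Pn l; have := rho_lec Qm l.
have := kap_ge Pn l; have := kap_ge Qm l; have := Z_lec x.
move: (n_del n l) (n_del m l) (n_rho n l) (n_rho m l) (n_kap n l) (n_kap m l) (Z x).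
move=> dn dm rn rm kn km z zc kme kne rmc rnc dm1 dn1.
have km0 : km != 0 by rewrite -normr_gt0 (lt_le_trans e_gt0).
have kn0 : kn != 0 by rewrite -normr_gt0 (lt_le_trans e_gt0).
have ime : `|km^-1| <= e^-1 by rewrite normfV lef_pV2 ?posrE// normr_gt0.
have ine : `|kn^-1| <= e^-1 by rewrite normfV lef_pV2 ?posrE// normr_gt0.
set q := km + dm * rm - (kn + dn * rn); set dd := dm - dn; set dr := rm - rn.
(* One factor is changed at a time; [rm * dd + dn * dr - q] equals [kn - km]. *)
have -> : (1 - dm) / km * (z - rm) - (1 - dn) / kn * (z - rn) =
  - (dd * km^-1 * (z - rm))
  + (1 - dn) * (z - rm) * (km^-1 * kn^-1) * (rm * dd + dn * dr - q)
  - (1 - dn) * kn^-1 * dr.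
  by rewrite /q /dd /dr; field; rewrite km0 kn0.
have ie0 : 0 <= e^-1 by rewrite invr_ge0 ltW.
have zr : `|z - rm| <= 2 * c by apply: le_trans (ler_normB _ _) _; lra.
have d2 : `|1 - dn| <= 2 by apply: le_trans (ler_normB _ _) _; rewrite normr1; lra.
have t1 : `|dd * km^-1 * (z - rm)| <= `|dd| * e^-1 * (2 * c).
  by rewrite !normrM ler_pM// ?mulr_ge0// ler_pM.
have t3 : `|(1 - dn) * kn^-1 * dr| <= 2 * e^-1 * `|dr|.
  by rewrite !normrM ler_pM// ?mulr_ge0// ler_pM.
have t20 : `|rm * dd + dn * dr - q| <= c * `|dd| + `|dr| + `|q|.
  apply: le_trans (ler_normB _ _) _; rewrite lerD2r.
  apply: le_trans (ler_normD _ _) _; rewrite !normrM lerD// ?ler_wpM2r//.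
  by rewrite -[leRHS]mul1r ler_wpM2r.
have t2 : `|(1 - dn) * (z - rm) * (km^-1 * kn^-1) * (rm * dd + dn * dr - q)| <=
    2 * (2 * c) * (e^-1 * e^-1) * (c * `|dd| + `|dr| + `|q|).
  rewrite normrM ler_pM// normrM ler_pM//; rewrite normrM ler_pM//.
apply: le_trans (ler_normB _ _) _; apply: le_trans (lerD (ler_normD _ _) (lexx _)) _.
rewrite normrN; apply: le_trans (lerD (lerD t1 t2) t3) _.
have q0 := normr_ge0 q; have dd0 := normr_ge0 dd; have dr0 := normr_ge0 dr.
rewrite -subr_ge0.
have -> : Axi = 2 * c * e^-1 + 4 * c ^+ 2 * (e^-1 * e^-1) + 4 * c * (e^-1 * e^-1) + 2 * e^-1.
  by field; rewrite gt_eqF.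
move: (e^-1) ie0 => i i0.
have -> : (2 * c * i + 4 * c ^+ 2 * (i * i) + 4 * c * (i * i) + 2 * i) * (`|dd| + `|q| + `|dr|) -
  (`|dd| * i * (2 * c) + 2 * (2 * c) * (i * i) * (c * `|dd| + `|dr| + `|q|) + 2 * i * `|dr|) =
  (2 * i + 4 * c * (i * i)) * `|dd|
  + (2 * c * i + 4 * c ^+ 2 * (i * i) + 2 * i) * `|q|
  + (2 * c * i + 4 * c ^+ 2 * (i * i)) * `|dr| by ring.
by rewrite !addr_ge0// mulr_ge0// ?addr_ge0// ?mulr_ge0// ?sqr_ge0.
Qed.

(** A common bound for D, Z, D Z and their conditional means; for the last one, 2 c + e bounds kappa
    and c bounds delta rho. *)
Local Notation bxi := (1 + 3 * c + e).

(** The outer 3 is that of (x + y + z)^2 <= 3 (x^2 + y^2 + z^2); the inner 3 counts the uses of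
    [sq_diff_cond], for D, Z and D Z. *)
Lemma sq_xi_diff Q n m : close s P0 P0 Q tau r -> is_nuisances P0 K n ->
  is_nuisances Q K m ->
  \int[P0]_x ((xi m x - xi n x) ^+ 2) <=
  3 * Axi ^+ 2 * (3 * (16 * bxi ^+ 2 * (tau * nrm P0 s + r))).
Proof.
move=> PQ Pn Qm.
have mxi := measurable_xi Qm; have mxi' := measurable_xi Pn.
have c0' := c0; have e0' := ltW e_gt0.
have D1 : forall x, `|D x| <= bxi by move=> x; have := D_le1 x; lra.
have Z1 : forall x, `|Z x| <= bxi by move=> x; have := Z_lec x; lra.
have DZ1 x : `|D x * Z x| <= bxi.
  rewrite normrM; apply: le_trans (_ : 1 * c <= _); last by lra.
  by rewrite ler_pM.
pose q n l := n_kap n l + n_del n l * n_rho n l.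
have qb S k l : is_nuisances S K k -> `|q k l| <= bxi.
  move=> Sk; apply: le_trans (ler_normD _ _) _; rewrite normrM.
  have : `|n_del k l| * `|n_rho k l| <= 1 * c by rewrite ler_pM// ?(del_le1 Sk)// (rho_lec Sk).
  have := kap_le Sk l; lra.
have db S k l : is_nuisances S K k -> `|n_del k l| <= bxi.
  by move=> Sk; have := del_le1 Sk l; lra.
have rb S k l : is_nuisances S K k -> `|n_rho k l| <= bxi.
  by move=> Sk; have := rho_lec Sk l; lra.
have [? ? ? ? ? _ _ _ _ _ _ _ _ _ _ pD pZ pDZ _ _] := Pn.
have [? ? ? ? ? _ _ _ _ _ _ _ _ _ _ qD qZ qDZ _ _] := Qm.
have mDZ : measurable_fun setT (fun x => D x * Z x) by meas.
have mqn : measurable_fun setT (q n) by rewrite /q; meas.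
have mqm : measurable_fun setT (q m) by rewrite /q; meas.
have e1 := @sq_diff_cond Q D (n_del n) (n_del m) bxi PQ mD ltac:(meas) ltac:(meas) D1
  (fun l => db _ _ l Pn) (fun l => db _ _ l Qm) pD qD.
have e2 := @sq_diff_cond Q Z (n_rho n) (n_rho m) bxi PQ mZ ltac:(meas) ltac:(meas) Z1
  (fun l => rb _ _ l Pn) (fun l => rb _ _ l Qm) pZ qZ.
have e3 := @sq_diff_cond Q _ (q n) (q m) bxi PQ mDZ mqn mqm DZ1
  (fun l => qb _ _ l Pn) (fun l => qb _ _ l Qm) pDZ qDZ.
have bi (u : T -> R) (b : R) : measurable_fun setT u -> (forall x, `|u x| <= b) -> intg P0 (fun x => u x ^+ 2).
  move=> mu ub; have [] // : L2 P0 u.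
  by apply: (L2_le mu (L2_cst P0 b)) => x; exact: le_trans (ub x) (ler_norm _).
have diffb (g g' : TL -> R) x : `|g' (W x)| <= bxi -> `|g (W x)| <= bxi -> `|g' (W x) - g (W x)| <= 2 * bxi.
  by move=> ? ?; apply: le_trans (ler_normB _ _) _; lra.
have j1 : intg P0 (fun x => (n_del m (W x) - n_del n (W x)) ^+ 2).
  by apply: (bi _ (2 * bxi)); [meas|move=> x; apply: diffb; [exact: db Qm|exact: db Pn]].
have j2 : intg P0 (fun x => (n_rho m (W x) - n_rho n (W x)) ^+ 2).
  by apply: (bi _ (2 * bxi)); [meas|move=> x; apply: diffb; [exact: rb Qm|exact: rb Pn]].
have j3 : intg P0 (fun x => (q m (W x) - q n (W x)) ^+ 2).
  by apply: (bi _ (2 * bxi)); [meas|move=> x; apply: diffb; [exact: qb Qm|exact: qb Pn]].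
apply: (@le_trans _ _ (3 * Axi ^+ 2 * (\int[P0]_x ((n_del m (W x) - n_del n (W x)) ^+ 2)
   + \int[P0]_x ((n_rho m (W x) - n_rho n (W x)) ^+ 2)
   + \int[P0]_x ((q m (W x) - q n (W x)) ^+ 2)))); last first.
  apply: ler_wpM2l; first by apply: mulr_ge0 => //; exact: sqr_ge0.
  rewrite (_ : 3 * _ = 16 * bxi ^+ 2 * (tau * nrm P0 s + r) +
    16 * bxi ^+ 2 * (tau * nrm P0 s + r) + 16 * bxi ^+ 2 * (tau * nrm P0 s + r)).
    exact: lerD (lerD e1 e2) e3.
  by ring.
have j12 := intgD j1 j2; have j123 := intgD j12 j3.
rewrite -RintegralD// -RintegralD// -RintegralZl//; apply: le_Rintegral => //.
- apply: (bi _ (2 * Kxi)); first by meas.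
  move=> x; apply: le_trans (ler_normB _ _) _.
  by have := xi_le x Pn; have := xi_le x Qm; lra.
- exact: intgZ.
move=> x _; have := xi_diff_le x Pn Qm; rewrite -/(q m (W x)) -/(q n (W x)).
set a := n_del m _ - _; set b := q m _ - _; set g := n_rho m _ - _; set A := Axi => H.
rewrite -(real_normK (num_real (_ - _))).
apply: (@le_trans _ _ ((A * (`|a| + `|b| + `|g|)) ^+ 2)).
  by rewrite lerXn2r// nnegrE// (le_trans _ H).
rewrite exprMn -(real_normK (num_real a)) -(real_normK (num_real b)) -(real_normK (num_real g)).
rewrite -[leRHS]mulrA [leRHS]mulrCA; apply: ler_wpM2l; first exact: sqr_ge0.
have := sqr_ge0 (`|a| - `|b|); have := sqr_ge0 (`|a| - `|g|); have := sqr_ge0 (`|b| - `|g|).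
nra.
Qed.

End pair.

(** * The derivative along a path *)

Section pathwise_derivative.
Variables (s : T -> R) (P0 : probability T R) (K : R) (n0 : nuisances).
Variables (Pt : R -> probability T R) (nt : R -> nuisances) (r : R -> R).
Hypotheses (L2s : L2 P0 s) (c0 : 0 <= c) (r0 : forall t, 0 <= r t).
Hypothesis r_small : forall eps, 0 < eps -> \forall t \near (0 : R)^', r t <= eps * `|t|.
Hypothesis Pt_close : \forall t \near (0 : R)^', close s P0 P0 (Pt t) `|t| (r t).
Hypothesis Pt_linear : \forall t \near (0 : R)^', forall (f : T -> R) (k : R),
  measurable_fun setT f -> (forall x, `|f x| <= k) ->
  `|\int[Pt t]_x f x - \int[P0]_x f x - t * \int[P0]_x (f x * s x)| <= k * r t.
Hypothesis n0_nuis : is_nuisances P0 K n0.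
Hypothesis nt_nuis : \forall t \near (0 : R)^', is_nuisances (Pt t) K (nt t).

Local Notation Kxi := (2 / e * (2 * c)).

Lemma scale_eps (a eps : R) : 0 <= a -> 0 < eps -> exists2 e' : R, 0 < e' & a * e' <= eps.
Proof.
move=> a0 e0; exists (eps / (a + 1)); first by rewrite divr_gt0// ltr_wpDl.
rewrite mulrA ler_pdivrMr ?ltr_wpDl// mulrC ler_wpM2l ?lerDl//; exact: ltW.
Qed.

(** All laws of the path have mass one, so [Pt_linear] for the constant 1 reads |t| |E_0 s| <= r t =
    o(|t|). *)
Lemma mean_score : \int[P0]_x s x = 0.
Proof.
apply/eqP; rewrite -normr_le0; apply/ler_addgt0Pr => eps eps0; rewrite add0r.
near (0 : R)^' => t.
have t0 : 0 < `|t| by rewrite normr_gt0; near: t; exact: nbhs_dnbhs_neq.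
have rt : r t <= eps * `|t| by near: t; exact: r_small.
have lt : forall (f : T -> R) (k : R),
  measurable_fun setT f -> (forall x, `|f x| <= k) ->
  `|\int[Pt t]_x f x - \int[P0]_x f x - t * \int[P0]_x (f x * s x)| <= k * r t.
  by near: t; exact: Pt_linear.
have := lt (cst 1) 1 (measurable_cst _) (fun=> ltac:(by rewrite normr1)).
rewrite !Rintegral_cst//= (@probability_setT _ _ _ P0) (@probability_setT _ _ _ (Pt t)) !mul1r.
rewrite subrr sub0r normrN normrM => H.
rewrite -(ler_pM2l t0) [leRHS]mulrC (le_trans _ rt)// (le_trans _ H)//.
have -> // : \int[P0]_x (1 * s x) = \int[P0]_x s x.
by apply: eq_Rintegral => x _; rewrite mul1r.
Unshelve. all: by end_near. Qed.

(** [Pt_linear] covers the part of [f] below a cutoff k. The part above it is controlled by [close]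
    with h the indicator of {k < |f|}, which leaves the tail of [s] on that event. *)
Lemma linear_L2 (f : T -> R) (C : R) : L2 P0 f ->
  (\forall t \near (0 : R)^', L2 (Pt t) f /\ nrm (Pt t) f <= C) ->
  forall eps, 0 < eps -> \forall t \near (0 : R)^',
  `|\int[Pt t]_x f x - \int[P0]_x f x - t * \int[P0]_x (f x * s x)| <= eps * `|t|.
Proof.
move=> Lf Ltf eps eps0; have [mf _] := Lf; have [ms _] := L2s.
have C0 : 0 <= nrm P0 f + `|C| by rewrite addr_ge0 ?nrm_ge0.
have [e1 e10 e1s] := @scale_eps (2 * nrm P0 f + `|C|) (eps / 2)
  ltac:(by have := nrm_ge0 P0 f; lra) ltac:(by rewrite divr_gt0).
have [k k0 kP] := tail_nrm L2s mf e10.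
pose A := [set x | k < `|f x|].
have mA : measurable A.
  by apply: (measurable_set_lt (f := fun=> k) (g := fun x => `|f x|)); meas.
have m1 : measurable_fun setT (\1_A : T -> R) by exact: measurable_indic.
have A1 x : `|\1_A x : R| <= 1 by rewrite indicE; case: (_ \in _); rewrite ?normr1 ?normr0.
pose g x : R := (1 - \1_A x) * f x.
have mg : measurable_fun setT g by rewrite /g; meas.
have gk x : `|g x| <= k.
  rewrite /g indicE; case: (boolP (x \in A)) => [_|]; first by rewrite subrr mul0r normr0.
  by rewrite subr0 mul1r notin_setE /A/= => /negP; rewrite -leNgt.
have [e2 e20 e2s] := @scale_eps (k + (nrm P0 f + `|C|)) (eps / 2)
  ltac:(lra) ltac:(by rewrite divr_gt0).
near=> t.
have [Lt nt_f] : L2 (Pt t) f /\ nrm (Pt t) f <= C by near: t.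
have rt : r t <= e2 * `|t| by near: t; exact: r_small.
have lin : forall (f : T -> R) (k : R),
  measurable_fun setT f -> (forall x, `|f x| <= k) ->
  `|\int[Pt t]_x f x - \int[P0]_x f x - t * \int[P0]_x (f x * s x)| <= k * r t.
  by near: t; exact: Pt_linear.
have cl : close s P0 P0 (Pt t) `|t| (r t) by near: t; exact: Pt_close.
have H1 := lin _ _ mg gk.
have H2 := cl _ _ _ m1 A1 Lf Lt.
have gi (S : probability T R) : intg S g.
  by apply: intg_L2; apply: (L2_le mg (L2_cst S k)) => x; exact: le_trans (gk x) (ler_norm _).
have fE (S : probability T R) : L2 S f ->
    \int[S]_x f x = \int[S]_x g x + \int[S]_x (\1_A x * f x).
  move=> Sf; rewrite -RintegralD//; [|exact: gi|exact: intg_bddM m1 A1 (intg_L2 Sf)].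
  by apply: eq_Rintegral => x _; rewrite /g; ring.
have LAf := L2_bddM m1 A1 Lf; have LAs := L2_bddM m1 A1 L2s.
have Lg : L2 P0 g by apply: (L2_le mg Lf) => x; rewrite /g indicE; case: (_ \in _);
  rewrite ?subrr ?mul0r ?normr0// subr0 mul1r.
have fsE : \int[P0]_x (f x * s x) = \int[P0]_x (g x * s x) + \int[P0]_x (f x * (\1_A x * s x)).
  rewrite -RintegralD//; [|exact: L2M|exact: L2M].
  by apply: eq_Rintegral => x _; rewrite /g; ring.
have H3 : `|\int[P0]_x (f x * (\1_A x * s x))| <= nrm P0 f * e1.
  by apply: le_trans (cauchy_schwarz Lf LAs) _; rewrite ler_wpM2l ?nrm_ge0.
rewrite (fE _ Lf) (fE _ Lt) fsE.
have H4 : `|t * \int[P0]_x (f x * (\1_A x * s x))| <= `|t| * (nrm P0 f * e1).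
  by rewrite normrM ler_wpM2l.
have H5 : (nrm P0 f + nrm (Pt t) f) * (`|t| * nrm P0 (fun x => \1_A x * s x) + 1 * r t)
    <= (nrm P0 f + `|C|) * (`|t| * e1 + r t).
  rewrite mul1r ler_pM ?addr_ge0 ?mulr_ge0 ?nrm_ge0//.
    by rewrite lerD2l (le_trans nt_f)// ler_norm.
  by rewrite lerD2r ler_wpM2l.
have H6 : (k + (nrm P0 f + `|C|)) * r t <= eps / 2 * `|t|.
  apply: le_trans (_ : (k + (nrm P0 f + `|C|)) * (e2 * `|t|) <= _).
    by rewrite ler_wpM2l// addr_ge0.
  by rewrite mulrA ler_wpM2r.
have H7 : (2 * nrm P0 f + `|C|) * e1 * `|t| <= eps / 2 * `|t| by rewrite ler_wpM2r.
move: H1 H2 H4 H5 H6 H7.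
move: (\int[Pt t]_x g x) (\int[P0]_x g x) (\int[P0]_x (g x * s x)) => a b ab.
move: (\int[Pt t]_x (\1_A x * f x)) (\int[P0]_x (\1_A x * f x))
  (\int[P0]_x (f x * (\1_A x * s x))) => a' b' ab'.
move=> /ler_normlP[H1 H1'] H2 /ler_normlP[H4 H4'] H5 H6 H7.
have {H2}H2 := le_trans H2 H5; move: H2 => /ler_normlP[H2 H2'].
by apply/ler_normlP; split; nra.
Unshelve. all: by end_near. Qed.

(** [sq_xi_diff] gives mean-square convergence of xi_t, but [s] is unbounded. As |xi_t - xi_0| <= 2
    Kxi for all t near 0, a cutoff of [s] at a level chosen before t suffices. *)
Lemma xi_cvg (eps : R) : 0 < eps -> \forall t \near (0 : R)^',
  nrm P0 (fun x => (xi (nt t) x - xi n0 x) * s x) <= eps.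
Proof.
move=> eps0; have [ms _] := L2s; have Kx := Kxi_ge0 c0.
have [e1 e10 e1s] := @scale_eps (2 * Kxi) (eps / 2) ltac:(lra) ltac:(by rewrite divr_gt0).
have [k k0 kP] := tail_nrm L2s ms e10.
have [A A0 Abound] : exists2 A : R, 0 <= A & forall t, close s P0 P0 (Pt t) `|t| (r t) ->
    is_nuisances (Pt t) K (nt t) ->
    \int[P0]_x ((xi (nt t) x - xi n0 x) ^+ 2) <= A * (`|t| * nrm P0 s + r t).
  exists (3 * (2 * c / e + 4 * c ^+ 2 / e ^+ 2 + 4 * c / e ^+ 2 + 2 / e) ^+ 2 *
    (3 * (16 * (1 + 3 * c + e) ^+ 2))).
    apply: mulr_ge0; first by apply: mulr_ge0 => //; exact: sqr_ge0.
    by apply: mulr_ge0 => //; apply: mulr_ge0 => //; exact: sqr_ge0.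
  move=> t cl nn; apply: le_trans (sq_xi_diff L2s (normr_ge0 t) c0 cl n0_nuis nn) _.
  by rewrite le_eqVlt; apply/orP; left; apply/eqP; ring.
have [e2 e20 e2s] := @scale_eps (k ^+ 2 * A * (nrm P0 s + 1)) (eps ^+ 2 / 2)
  ltac:(by apply: mulr_ge0; [apply: mulr_ge0 => //; exact: sqr_ge0|rewrite addr_ge0 ?nrm_ge0])
  ltac:(by rewrite divr_gt0 ?exprn_gt0).
near=> t.
have rt : r t <= 1 * `|t| by near: t; exact: r_small.
have tt : `|t| <= e2 by near: t; exact: dnbhs0_le.
have cl : close s P0 P0 (Pt t) `|t| (r t) by near: t; exact: Pt_close.
have nn : is_nuisances (Pt t) K (nt t) by near: t; exact: nt_nuis.
have mx : measurable_fun setT (fun x => xi (nt t) x - xi n0 x).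
  by have := measurable_xi nn; have := measurable_xi n0_nuis => ? ?; meas.
have xb x : `|xi (nt t) x - xi n0 x| <= 2 * Kxi.
  by apply: le_trans (ler_normB _ _) _; have := xi_le x nn; have := xi_le x n0_nuis; lra.
rewrite -(@ler_pXn2r _ 2)//; [|by rewrite nnegrE nrm_ge0|by rewrite nnegrE ltW].
apply: le_trans (nrm_bdd_tail mx xb L2s k0) _.
have H1 : (2 * Kxi) ^+ 2 * nrm P0 (fun x => \1_[set x | k < `|s x|] x * s x) ^+ 2
    <= (eps / 2) ^+ 2.
  rewrite -exprMn lerXn2r//.
  - by rewrite nnegrE mulr_ge0 ?nrm_ge0//; lra.
  - by rewrite nnegrE; lra.
  - by apply: le_trans e1s; apply: ler_wpM2l => //; lra.
have H2 : k ^+ 2 * \int[P0]_x ((xi (nt t) x - xi n0 x) ^+ 2) <= eps ^+ 2 / 2.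
  apply: le_trans e2s.
  rewrite (_ : k ^+ 2 * A * (nrm P0 s + 1) * e2 = k ^+ 2 * (A * ((nrm P0 s + 1) * e2))); last by ring.
  apply: ler_wpM2l; first exact: sqr_ge0.
  apply: le_trans (Abound t cl nn) _; apply: ler_wpM2l => //.
  have N0 := nrm_ge0 P0 s.
  apply: le_trans (_ : `|t| * (nrm P0 s + 1) <= _); first by lra.
  by rewrite mulrC ler_wpM2l// addr_ge0.
have e00 := sqr_ge0 eps; apply: le_trans (lerD H2 H1) _.
rewrite (_ : eps ^+ 2 / 2 + (eps / 2) ^+ 2 = 3 / 4 * eps ^+ 2); last by field.
lra.
Unshelve. all: by end_near. Qed.

(** On [G] the function Phi_0 grows at most linearly in |X|, so it is square integrable under every
    law of the path, with a uniform bound: this is what [linear_L2] asks. *)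
Lemma L2_indic_Phi (S : probability T R) (k : R) (G := [set l | `|n_gam n0 l| + `|n_eta n0 l| <= k]) :
  0 <= k -> L2 S X -> L2 S (fun x => \1_G (W x) * Phi n0 n0 x) /\
  nrm S (fun x => \1_G (W x) * Phi n0 n0 x) <=
    (1 + Kxi) * nrm S X + (2 * k + Kxi * (3 * k)).
Proof.
move=> k0 LX; have Kx := Kxi_ge0 c0.
have mxi := measurable_xi n0_nuis; have mres := measurable_resid n0_nuis.
have mout := measurable_outcome n0_nuis.
have xil := fun x => xi_le x n0_nuis; have dl := del_le1 n0_nuis.
have ? := m_gam n0_nuis; have ? := m_eta n0_nuis.
have mG : measurable G.
  by apply: (measurable_set_le (f := fun l => `|n_gam n0 l| + `|n_eta n0 l|) (g := fun=> k)); meas.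
have m0 : measurable_fun setT (\1_G : TL -> R) by exact: measurable_indic.
have m1 : measurable_fun setT (fun x => \1_G (W x) : R) by meas.
pose B x := (1 + Kxi) * `|X x| + (2 * k + Kxi * (3 * k)).
have b1 : 0 <= 1 + Kxi by lra.
have b2 : 0 <= 2 * k + Kxi * (3 * k).
  by apply: addr_ge0; [lra|apply: mulr_ge0 => //; lra].
have B0 x : 0 <= B x by rewrite /B addr_ge0// mulr_ge0.
have LX' : L2 S (fun x => `|X x|) by apply: (L2_le _ LX); [meas|move=> x; rewrite normr_id].
have LKX := L2Z (1 + Kxi) LX'.
have LB : L2 S B by apply: L2D => //; exact: L2_cst.
have mGP : measurable_fun setT (fun x => \1_G (W x) * Phi n0 n0 x) by rewrite /Phi; meas.
have le x : `|\1_G (W x) * Phi n0 n0 x| <= `|B x|.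
  rewrite [leRHS]ger0_norm// indicE; case: (boolP (_ \in _)) => [|_]; last first.
    by rewrite mul0r normr0.
  rewrite inE mul1r /G/= => Gx.
  have g0 := normr_ge0 (n_gam n0 (W x)); have e0 := normr_ge0 (n_eta n0 (W x)).
  apply: le_trans (ler_normD _ _) _.
  have o1 : `|outcome n0 x| <= 2 * k + `|X x|.
    apply: le_trans (ler_normD _ _) _; rewrite lerD2r normrM ler_pM//; last by lra.
    by apply: le_trans (ler_normB _ _) _; rewrite normr1; have := D_le1 x; lra.
  have r1 : `|resid n0 x| <= `|X x| + 3 * k.
    apply: le_trans (ler_normB _ _) _.
    have : `|n_gam n0 (W x) * (D x - n_del n0 (W x))| <= k * 2.
      rewrite normrM ler_pM//; first by lra.
      by apply: le_trans (ler_normB _ _) _; have := D_le1 x; have := dl (W x); lra.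
    by have := ler_normB (X x) (n_eta n0 (W x)); lra.
  have : `|xi n0 x * resid n0 x| <= Kxi * (`|X x| + 3 * k) by rewrite normrM ler_pM.
  rewrite /B; lra.
split; first exact: L2_le mGP LB le.
apply: le_trans (le_nrm mGP LB le) _; apply: le_trans (nrmD LKX (L2_cst S _)) _.
rewrite nrmZ// nrm_cst (ger0_norm b1) (ger0_norm b2) lerD2r ler_wpM2l//.
by apply: le_nrm => //; [meas|move=> x; rewrite normr_id].
Qed.

Lemma L2_Phi : L2 P0 (Phi n0 n0).
Proof.
have Lr : L2 P0 (resid n0).
  apply: L2B; first by apply: L2B; [exact: L2_X n0_nuis|exact: L2_eta n0_nuis].
  have md := m_del n0_nuis.
  have mDd : measurable_fun setT (fun x => D x - n_del n0 (W x)) by meas.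
  have Db x : `|D x - n_del n0 (W x)| <= 2.
    by apply: le_trans (ler_normB _ _) _; have := D_le1 x; have := del_le1 n0_nuis (W x); lra.
  have := L2_bddM mDd Db (L2_gam n0_nuis).
  by congr (L2 P0 _); apply/funext => x; rewrite mulrC.
apply: L2D; first exact: L2_outcome n0_nuis.
exact: L2_bddM (measurable_xi n0_nuis) (fun x => xi_le x n0_nuis) Lr.
Qed.

Lemma pathwise_derivative (a eps : R) : 0 < eps -> \forall t \near (0 : R)^',
  `|\int[Pt t]_x outcome (nt t) x - \int[P0]_x outcome n0 x
    - t * \int[P0]_x ((Phi n0 n0 x - a) * s x)| <= eps * `|t|.
Proof.
move=> eps0; have [ms _] := L2s; have Kx := Kxi_ge0 c0; have LP := L2_Phi.
have mean_s := mean_score; have si := intg_L2 L2s.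
have K0 : 0 <= K by exact: le_trans (nrm_ge0 _ _) (nrm_X n0_nuis).
have -> : \int[P0]_x ((Phi n0 n0 x - a) * s x) = \int[P0]_x (Phi n0 n0 x * s x).
  rewrite -[RHS]subr0 -(mulr0 a) -mean_s -RintegralZl// -RintegralB//; last 2 first.
  - exact: L2M.
  - exact: intgZ.
  by apply: eq_Rintegral => x _; ring.
(* Naming the constants through existentials makes them atoms for the final linear arithmetic. *)
have [CL CLE] : exists y, y = 24 * K * (2 + 2 * Kxi) by eexists.
have [KX KXE] : exists y, y = 2 * Kxi by eexists.
have CL0 : 0 <= CL by rewrite CLE; apply: mulr_ge0; [exact: mulr_ge0|lra].
pose C := CL + nrm P0 (Phi n0 n0).
have C0 : 0 <= C by rewrite addr_ge0 ?nrm_ge0.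
have e4 : 0 < eps / 4 by rewrite divr_gt0.
have [e1 e10 e1s] := scale_eps C0 e4.
pose Yg x := `|n_gam n0 (W x)| + `|n_eta n0 (W x)|.
have mgam := m_gam n0_nuis; have meta := m_eta n0_nuis.
have mY : measurable_fun setT Yg by rewrite /Yg; meas.
(* The order of choices matters: the cutoff k depends on [e1] alone; [Cg] grows with k, and [e2],
   [e3] are fixed after it. *)
have [k k0 kP] := tail_nrm L2s mY e10.
pose G := [set l | `|n_gam n0 l| + `|n_eta n0 l| <= k].
have mG : measurable G.
  by apply: (measurable_set_le (f := fun l => `|n_gam n0 l| + `|n_eta n0 l|) (g := fun=> k)); meas.
have mGc := measurableC mG.
have m0 : measurable_fun setT (\1_G : TL -> R) by exact: measurable_indic.
have m1 : measurable_fun setT (fun x => \1_G (W x) : R) by meas.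
have m0' : measurable_fun setT (\1_(~` G) : TL -> R) by exact: measurable_indic.
have m1' : measurable_fun setT (fun x => \1_(~` G) (W x) : R) by meas.
have tailG : nrm P0 (fun x => \1_(~` G) (W x) * s x) <= e1.
  apply: le_trans kP; rewrite le_eqVlt; apply/orP; left; apply/eqP; congr nrm.
  apply/funext => x; rewrite !indicE; congr (_%:R * _); congr nat_of_bool.
  have Y0 : 0 <= Yg x by rewrite addr_ge0.
  by apply/idP/idP; rewrite !inE/= (ger0_norm Y0) ltNge => /negP.
have [Cg CgE] : exists y, y = 2 * (K + 3 * k) by eexists.
have Cg0 : 0 <= Cg by rewrite CgE; lra.
have [e2 e20 e2s] := scale_eps Cg0 e4.
have e8 : 0 < eps / 8 by rewrite divr_gt0.
have Cr0 : 0 <= CL + Cg * KX by rewrite addr_ge0// mulr_ge0// KXE; lra.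
have [e3 e30 e3s] := scale_eps Cr0 e8.
have lin : \forall t \near (0 : R)^',
    `|\int[Pt t]_x (\1_G (W x) * Phi n0 n0 x) - \int[P0]_x (\1_G (W x) * Phi n0 n0 x)
     - t * \int[P0]_x ((\1_G (W x) * Phi n0 n0 x) * s x)| <= eps / 8 * `|t|.
  apply: (@linear_L2 _ ((1 + Kxi) * K + (2 * k + Kxi * (3 * k)))) => //.
    exact: (L2_indic_Phi k0 (L2_X n0_nuis)).1.
  apply: filterS nt_nuis => t nn.
  have [L n] := L2_indic_Phi k0 (L2_X nn); split => //.
  by apply: le_trans n _; rewrite lerD2r ler_wpM2l ?addr_ge0// (nrm_X nn).
near=> t.
have rt : r t <= e3 * `|t| by near: t; exact: r_small.
have cl : close s P0 P0 (Pt t) `|t| (r t) by near: t; exact: Pt_close.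
have nn : is_nuisances (Pt t) K (nt t) by near: t; exact: nt_nuis.
have lt : `|\int[Pt t]_x (\1_G (W x) * Phi n0 n0 x) - \int[P0]_x (\1_G (W x) * Phi n0 n0 x)
     - t * \int[P0]_x ((\1_G (W x) * Phi n0 n0 x) * s x)| <= eps / 8 * `|t|.
  by near: t; exact: lin.
have xt : nrm P0 (fun x => (xi (nt t) x - xi n0 x) * s x) <= e2 by near: t; exact: xi_cvg.
have H1 := good_part (normr_ge0 t) (r0 t) c0 cl n0_nuis nn mG k0.
have H2 := lipschitz L2s (normr_ge0 t) (r0 t) c0 cl n0_nuis nn mGc.
rewrite (mulrA (24 * K)) -CLE in H2; rewrite -CgE -KXE in H1.
have split_int (S : probability T R) (u : T -> R) : intg S u ->
    \int[S]_x u x = \int[S]_x (\1_G (W x) * u x) + \int[S]_x (\1_(~` G) (W x) * u x).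
  move=> Su; rewrite -RintegralD//.
  - apply: eq_Rintegral => x _; rewrite -mulrDl !indicE in_setC.
    by case: (_ \in G); rewrite ?addr0 ?add0r mul1r.
  - exact: intg_bddM m1 (fun x => indic_le1 G (W x)) Su.
  - exact: intg_bddM m1' (fun x => indic_le1 (~` G) (W x)) Su.
rewrite (split_int _ _ (intg_L2 (L2_outcome nn))) (split_int _ _ (intg_L2 (L2_outcome n0_nuis))).
rewrite (split_int _ _ (L2M LP L2s)).
have H3 : `|\int[P0]_x (\1_(~` G) (W x) * (Phi n0 n0 x * s x))| <= nrm P0 (Phi n0 n0) * e1.
  have LGs := L2_bddM m1' (fun x => indic_le1 (~` G) (W x)) L2s.
  apply: le_trans (_ : nrm P0 (Phi n0 n0) * nrm P0 (fun x => \1_(~` G) (W x) * s x) <= _).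
    apply: le_trans (cauchy_schwarz LP LGs).
    rewrite le_eqVlt; apply/orP; left; apply/eqP; congr `|_|.
    by apply: eq_Rintegral => x _; ring.
  by rewrite ler_wpM2l ?nrm_ge0.
have {H3}H3 : `|t * \int[P0]_x (\1_(~` G) (W x) * (Phi n0 n0 x * s x))|
    <= `|t| * (nrm P0 (Phi n0 n0) * e1) by rewrite normrM ler_wpM2l.
have KX0 : 0 <= KX by rewrite KXE; lra.
have {}H2 : `|\int[Pt t]_x (\1_(~` G) (W x) * outcome (nt t) x)
    - \int[P0]_x (\1_(~` G) (W x) * outcome n0 x)| <= CL * (`|t| * e1 + r t).
  apply: le_trans H2 _; apply: ler_wpM2l => //.
  by rewrite lerD2r ler_wpM2l.
have {}H1 := le_trans H1 (_ : _ <= Cg * (`|t| * e2 + KX * r t)).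
have {}H1 := H1 ltac:(apply: ler_wpM2l => //; by rewrite lerD2r ler_wpM2l).
have H4 : (CL + Cg * KX) * r t <= eps / 8 * `|t|.
  apply: le_trans (_ : (CL + Cg * KX) * (e3 * `|t|) <= _).
    by rewrite ler_wpM2l.
  by rewrite mulrA ler_wpM2r.
have H5 : C * e1 * `|t| <= eps / 4 * `|t| by rewrite ler_wpM2r.
have H6 : Cg * e2 * `|t| <= eps / 4 * `|t| by rewrite ler_wpM2r.
have lt' : `|\int[Pt t]_x (\1_G (W x) * Phi n0 n0 x) - \int[P0]_x (\1_G (W x) * Phi n0 n0 x)
     - t * \int[P0]_x (\1_G (W x) * (Phi n0 n0 x * s x))| <= eps / 8 * `|t|.
  move: lt; congr (`|_ - _ * _| <= _).
  by apply: eq_Rintegral => x _; ring.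
move: H1 H2 H3 H4 H5 H6 lt'; rewrite /C.
move: (nrm P0 (Phi n0 n0)) => NP.
move: (\int[Pt t]_x (\1_G (W x) * outcome (nt t) x)) (\int[P0]_x (\1_G (W x) * outcome n0 x))
  (\int[Pt t]_x (\1_G (W x) * Phi n0 n0 x)) (\int[P0]_x (\1_G (W x) * Phi n0 n0 x)) => a1 a2 a3 a4.
move: (\int[Pt t]_x (\1_(~` G) (W x) * outcome (nt t) x))
  (\int[P0]_x (\1_(~` G) (W x) * outcome n0 x))
  (\int[P0]_x (\1_(~` G) (W x) * (Phi n0 n0 x * s x)))
  (\int[P0]_x (\1_G (W x) * (Phi n0 n0 x * s x))) => b1 b2 b3 b4.
move=> /ler_normlP[H1 H1'] /ler_normlP[H2 H2'] /ler_normlP[H3 H3'] H4 H5 H6 /ler_normlP[H7 H7'].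
have t0 := normr_ge0 t.
have E1 : CL * (`|t| * e1 + r t) + Cg * (`|t| * e2 + KX * r t) + `|t| * (NP * e1) =
  (CL + Cg * KX) * r t + (CL + NP) * e1 * `|t| + Cg * e2 * `|t| by ring.
(* One eighth pays for the multiples of [r t], one eighth for the linearization on [G], one quarter
   for the tail of the score and one for xi_t - xi_0; the last quarter is slack. *)
have E2 : eps * `|t| = eps / 8 * `|t| + eps / 8 * `|t| + eps / 4 * `|t| + eps / 4 * `|t|
  + eps / 4 * `|t| by field.
have E3 : 0 <= eps / 4 * `|t| by rewrite mulr_ge0// ltW.
by apply/ler_normlP; split; rewrite E2; lra.
Unshelve. all: by end_near. Qed.

End pathwise_derivative.
End nuisances.

(** * Versions of the nuisance functions with bounds valid everywhere *)

Section nuisances_existence.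
Context {d dL : measure_display} {T : measurableType d}
  {TL : measurableType dL} {R : realType}.
Variables (W : {mfun T >-> TL}) (D X Z : T -> R) (c e : R).
Hypotheses (mD : measurable_fun setT D) (mX : measurable_fun setT X)
  (mZ : measurable_fun setT Z).
Hypotheses (D_le1 : forall x, `|D x| <= 1) (Z_lec : forall x, `|Z x| <= c).
Hypotheses (e_gt0 : 0 < e) (c0 : 0 <= c).

Definition clip (b : R) (g : TL -> R) l := Num.max (- b) (Num.min b (g l)).

Lemma clip_le b g l : 0 <= b -> `|clip b g l| <= b.
Proof. by move=> b0; rewrite ler_norml le_max lexx/= ge_max ge_min lexx andbT; lra. Qed.

Lemma clip_id b g l : `|g l| <= b -> clip b g l = g l.
Proof. by rewrite ler_norml => /andP[gb1 gb2]; rewrite /clip min_r// max_r. Qed.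

Lemma measurable_clip b g : measurable_fun setT g -> measurable_fun setT (clip b g).
Proof. by move=> mg; rewrite /clip; meas. Qed.

(** Boundedness of [V] and [g] admits every integrable test function; this makes gamma and eta
    legitimate multipliers of the centred D, Z and D Z. *)
Lemma res_bounded (P : probability T R) (V : T -> R) (g : TL -> R) (b b' : R) :
  measurable_fun setT V -> (forall x, `|V x| <= b) -> is_condE P W V g ->
  (forall l, `|g l| <= b') -> forall h : TL -> R, measurable_fun setT h ->
  intg P (fun x => h (W x)) -> mean_zero P (fun x => h (W x) * (V x - g (W x))).
Proof.
move=> mV Vb Hg gb h mh hi; have [mg _ _] := Hg.
have mgW : measurable_fun setT (fun x => g (W x)) by meas.
apply: pull_out => //.
- by apply: intg_L2; apply: (L2_le mV (L2_cst P b)) => x; exact: le_trans (Vb x) (ler_norm _).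
- by under eq_fun do rewrite mulrC; exact: intg_bddM hi.
- by under eq_fun do rewrite mulrC; apply: (intg_bddM mgW (fun x => gb (W x))).
Qed.

Lemma res_integrable (P : probability T R) (V : T -> R) (g h : TL -> R) (k : R) :
  intg P V -> is_condE P W V g -> measurable_fun setT h -> (forall l, `|h l| <= k) ->
  mean_zero P (fun x => h (W x) * (V x - g (W x))).
Proof.
move=> iV Hg mh hk; have [mg ig _] := Hg.
have mhW : measurable_fun setT (fun x => h (W x)) by meas.
by apply: pull_out => //; apply: (intg_bddM mhW (fun x => hk (W x))).
Qed.

(** One constant serves X, eta and gamma: eta has norm at most K by [condE_jensen], and |gamma| <=
    (|E[X Z | L]| + c |E[X | L]|) / e, where both summands have norm at most c K. *)
Lemma nuisances_ex (P : probability T R) (K : R) (gD gZ gX gDZ gXZ : TL -> R) :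
  L2 P X -> nrm P X <= K ->
  is_condE P W D gD -> is_condE P W Z gZ -> is_condE P W X gX ->
  is_condE P W (fun x => D x * Z x) gDZ -> is_condE P W (fun x => X x * Z x) gXZ ->
  {ae P, forall x, e <= `|gDZ (W x) - gD (W x) * gZ (W x)|} ->
  exists2 n, is_nuisances W D X Z c e P (K + 2 * c * K / e) n &
    [/\ {ae P, forall x, n_del n (W x) = gD (W x)},
        {ae P, forall x, n_rho n (W x) = gZ (W x)},
        {ae P, forall x, n_kap n (W x) = gDZ (W x) - gD (W x) * gZ (W x)},
        n_eta n = gX &
        {ae P, forall x, n_gam n (W x) =
          (gXZ (W x) - gX (W x) * gZ (W x)) / (gDZ (W x) - gD (W x) * gZ (W x))}].
Proof.
move=> LX nX HD HZ HX HDZ HXZ He.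
have iX := intg_L2 LX.
have K0 : 0 <= K by exact: le_trans (nrm_ge0 _ _) nX.
have DZc x : `|D x * Z x| <= c by rewrite normrM -[c]mul1r ler_pM.
have mDZ : measurable_fun setT (fun x => D x * Z x) by meas.
have bint (V : T -> R) b : measurable_fun setT V -> (forall x, `|V x| <= b) -> intg P V.
  by move=> mV Vb; apply: intg_L2; apply: (L2_le mV (L2_cst P b)) => x; exact: le_trans (Vb x) (ler_norm _).
have iD := bint _ _ mD D_le1; have iZ := bint _ _ mZ Z_lec; have iDZ := bint _ _ mDZ DZc.
have LXZ : L2 P (fun x => X x * Z x).
  by have := L2_bddM mZ Z_lec LX; congr (L2 P _); apply/funext => x; rewrite mulrC.
have nXZ : nrm P (fun x => X x * Z x) <= c * K.
  apply: le_trans (_ : c * nrm P X <= _); last by rewrite ler_wpM2l.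
  have := nrm_bddM mZ Z_lec LX; rewrite (ger0_norm c0); apply: le_trans.
  by rewrite le_eqVlt; apply/orP; left; apply/eqP; congr nrm; apply/funext => x; rewrite mulrC.
have [mgD _ _] := HD; have [mgZ _ _] := HZ; have [mgX _ _] := HX.
have [mgDZ _ _] := HDZ; have [mgXZ _ _] := HXZ.
(* The conditional mean of a bounded variable obeys the same bound almost everywhere, so clipping
   gives another version. *)
pose del := clip 1 gD; pose rho := clip c gZ; pose q0 := clip c gDZ.
have mdel : measurable_fun setT del by exact: measurable_clip.
have mrho : measurable_fun setT rho by exact: measurable_clip.
have mq0 : measurable_fun setT q0 by exact: measurable_clip.
pose A := [set l | e <= `|q0 l - del l * rho l|].
have mA : measurable A.
  by apply: (measurable_set_le (f := fun=> e) (g := fun l => `|q0 l - del l * rho l|)); meas.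
have m1 : measurable_fun setT (\1_A : TL -> R) by exact: measurable_indic.
(* Off [A], a null event for [W], the value e keeps [kap] away from zero at every point. *)
pose kap l : R := \1_A l * (q0 l - del l * rho l) + (1 - \1_A l) * e.
have mkap : measurable_fun setT kap by rewrite /kap; meas.
(* Dividing by the modified [kap] makes [gam * kap + gX * rho] equal to [gXZ] at every point, so the
   equation for X Z needs no almost-everywhere argument. *)
pose gam l := (gXZ l - gX l * rho l) / kap l.
have mgam : measurable_fun setT gam by rewrite /gam; meas.
have dl l : `|del l| <= 1 by exact: clip_le.
have rl l : `|rho l| <= c by exact: clip_le.
have ql l : `|q0 l| <= c by exact: clip_le.
have drl l : `|del l * rho l| <= c by rewrite normrM -[c]mul1r ler_pM.
have kge l : e <= `|kap l|.
  rewrite /kap indicE; case: (boolP (l \in A)) => [|_].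
    by rewrite inE /A/= subrr mul0r addr0 mul1r.
  by rewrite mul0r add0r subr0 mul1r ler_norm.
have kle l : `|kap l| <= 2 * c + e.
  rewrite /kap indicE; case: (boolP (l \in A)) => [_|_].
    rewrite subrr mul0r addr0 mul1r; apply: le_trans (ler_normB _ _) _.
    by have := ql l; have := drl l; have := ltW e_gt0; lra.
  by rewrite mul0r add0r subr0 mul1r (ger0_norm (ltW e_gt0)); have := c0; lra.
have k0 l : kap l != 0 by rewrite -normr_gt0 (lt_le_trans e_gt0).
have aeD : {ae P, forall x, gD (W x) = del (W x)}.
  have := condE_ae_le HD iD (aeW _ D_le1).
  by apply: filterS => x H; rewrite /del clip_id.
have aeZ : {ae P, forall x, gZ (W x) = rho (W x)}.
  have := condE_ae_le HZ iZ (aeW _ Z_lec).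
  by apply: filterS => x H; rewrite /rho clip_id.
have aeq : {ae P, forall x, gDZ (W x) = q0 (W x)}.
  have := condE_ae_le HDZ iDZ (aeW _ DZc).
  by apply: filterS => x H; rewrite /q0 clip_id.
have aek : {ae P, forall x, kap (W x) = gDZ (W x) - gD (W x) * gZ (W x)}.
  near=> x.
  have -> : gD (W x) = del (W x) by near: x; exact: aeD.
  have -> : gZ (W x) = rho (W x) by near: x; exact: aeZ.
  have -> : gDZ (W x) = q0 (W x) by near: x; exact: aeq.
  have : A (W x).
    rewrite /A/=.
    have <- : gD (W x) = del (W x) by near: x; exact: aeD.
    have <- : gZ (W x) = rho (W x) by near: x; exact: aeZ.
    have <- : gDZ (W x) = q0 (W x) by near: x; exact: aeq.
    by near: x; exact: He.
  by move=> Ax; rewrite /kap indicE mem_set//= subrr mul0r addr0 mul1r.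
have HD' := condE_ae_eq HD mdel aeD.
have HZ' := condE_ae_eq HZ mrho aeZ.
have HDZ' : is_condE P W (fun x => D x * Z x) (fun l => kap l + del l * rho l).
  apply: condE_ae_eq HDZ _ _; first by meas.
  near=> x.
  have -> : kap (W x) = gDZ (W x) - gD (W x) * gZ (W x) by near: x; exact: aek.
  have -> : gD (W x) = del (W x) by near: x; exact: aeD.
  have -> : gZ (W x) = rho (W x) by near: x; exact: aeZ.
  by rewrite subrK.
have HXZ' : is_condE P W (fun x => X x * Z x) (fun l => gam l * kap l + gX l * rho l).
  have -> // : (fun l => gam l * kap l + gX l * rho l) = gXZ.
  by apply/funext => l; rewrite /gam divfK// subrK.
have [LgX ngX] := condE_jensen HX LX; have [LgXZ ngXZ] := condE_jensen HXZ LXZ.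
have mrW : measurable_fun setT (fun x => rho (W x)) by meas.
have LB := L2Z e^-1 (L2D (_ : L2 P (fun x => `|gXZ (W x)|)) (_ : L2 P (fun x => c * `|gX (W x)|))).
have LnX : L2 P (fun x => `|gX (W x)|) by apply: (L2_le _ LgX); [meas|move=> x; rewrite normr_id].
have LnXZ : L2 P (fun x => `|gXZ (W x)|) by apply: (L2_le _ LgXZ); [meas|move=> x; rewrite normr_id].
have {}LB := LB LnXZ (L2Z c LnX).
have ie0 : 0 <= e^-1 by rewrite invr_ge0 ltW.
have gb x : `|gam (W x)| <= `|e^-1 * (`|gXZ (W x)| + c * `|gX (W x)|)|.
  rewrite [leRHS]ger0_norm ?mulr_ge0 ?addr_ge0 ?mulr_ge0// /gam mulrC normrM normfV.
  rewrite ler_pM ?invr_ge0//.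
    by rewrite lef_pV2// posrE normr_gt0.
  apply: le_trans (ler_normB _ _) _; rewrite lerD2l normrM mulrC.
  by rewrite ler_wpM2r.
have mgamW : measurable_fun setT (fun x => gam (W x)) by meas.
have Lgam := L2_le mgamW LB gb.
have ngam : nrm P (fun x => gam (W x)) <= 2 * c * K / e.
  apply: le_trans (le_nrm mgamW LB gb) _.
  rewrite nrmZ; last by apply: L2D => //; exact: L2Z.
  rewrite (ger0_norm ie0) mulrC ler_wpM2r//.
  apply: le_trans (nrmD LnXZ (L2Z c LnX)) _; rewrite nrmZ// (ger0_norm c0).
  have n1 : nrm P (fun x => `|gXZ (W x)|) <= c * K.
    apply: le_trans nXZ; apply: le_trans ngXZ; apply: le_nrm => //; first by meas.
    by move=> x; rewrite normr_id.
  have n2 : nrm P (fun x => `|gX (W x)|) <= K.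
    apply: le_trans nX; apply: le_trans ngX; apply: le_nrm => //; first by meas.
    by move=> x; rewrite normr_id.
  have : c * nrm P (fun x => `|gX (W x)|) <= c * K by rewrite ler_wpM2l.
  lra.
have b0 : 0 <= 2 * c * K / e by apply: divr_ge0; [apply: mulr_ge0 => //; exact: mulr_ge0|exact: ltW].
exists (Nuisances del rho kap gX gam).
  split => //=.
  - by rewrite (le_trans nX)// lerDl.
  - by rewrite (le_trans ngX)// (le_trans nX)// lerDl.
  - by rewrite (le_trans ngam)// lerDr.
  - exact: res_bounded HD' dl.
  - exact: res_bounded HZ' rl.
  - apply: (res_bounded (b' := 3 * c + e)) HDZ' _ => // l.
    by apply: le_trans (ler_normD _ _) _; have := kle l; have := drl l; lra.
  - by move=> h k mh hk; exact: res_integrable HX mh hk.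
  - by move=> h k mh hk; exact: (res_integrable (intg_L2 LXZ) HXZ' mh hk).
split => //=.
- by apply: filterS aeD => x.
- by apply: filterS aeZ => x.
- near=> x.
  have <- : kap (W x) = gDZ (W x) - gD (W x) * gZ (W x) by near: x; exact: aek.
  have -> : gZ (W x) = rho (W x) by near: x; exact: aeZ.
  by [].
Unshelve. all: by end_near. Qed.

End nuisances_existence.

(** * Consequences of differentiability in quadratic mean *)

Lemma measurable_sqrtr (R : realType) : measurable_fun setT (@Num.sqrt R).
Proof. by apply: continuous_measurable_fun; exact: sqrt_continuous. Qed.

Section quadratic_mean.
Context {d : measure_display} {T : measurableType d} {R : realType}.
Variables (mu : {measure set T -> \bar R}) (p : R -> T -> R).
Hypotheses (mp : forall t, measurable_fun setT (p t)) (p0 : forall t x, 0 <= p t x).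

Local Notation u t := (fun x => Num.sqrt (p t x)).

Let measurable_u t : measurable_fun setT (u t).
Proof. by apply: (measurableT_comp (@measurable_sqrtr R)). Qed.

Let sq_u t x : Num.sqrt (p t x) ^+ 2 = p t x.
Proof. exact: sqr_sqrtr. Qed.

Section one_law.
Variables (t : R) (nu : probability T R).
Hypothesis nuE : forall B, measurable B -> nu B = (\int[mu]_(x in B) (p t x)%:E)%E.

(** Multiplication by sqrt(p_t) embeds L2 of P_t isometrically into L2(mu), where functions under
    different laws can be compared. *)
Lemma L2_density f : L2 nu f -> L2 mu (fun x => f x * Num.sqrt (p t x)).
Proof.
move=> [mf fi]; split; first by apply: measurable_funM.
have := (integrable_density (mp t) (p0 t) nuE (measurable_funX 2 mf)).1 fi.
by congr (integrable mu setT _); apply/funext => x /=; rewrite exprMn sq_u.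
Qed.

Lemma nrm_density f : L2 nu f -> nrm mu (fun x => f x * Num.sqrt (p t x)) = nrm nu f.
Proof.
move=> [mf fi]; rewrite /nrm (Rintegral_density (mp t) (p0 t) nuE fi); congr Num.sqrt.
by apply: eq_Rintegral => x _; rewrite exprMn sq_u.
Qed.

End one_law.

Variables (P0 : probability T R) (Pt : R -> probability T R) (s : T -> R).
Hypothesis P0E : forall B, measurable B -> P0 B = (\int[mu]_(x in B) (p 0 x)%:E)%E.
Hypothesis PtE : \forall t \near (0 : R), forall B, measurable B ->
  Pt t B = (\int[mu]_(x in B) (p t x)%:E)%E.
Hypothesis L2s : L2 P0 s.
Hypothesis dqm : (fun t : R => ((t ^- 2)%:E * \int[mu]_x
  ((Num.sqrt (p t x) - Num.sqrt (p 0 x) - t / 2 * s x * Num.sqrt (p 0 x)) ^+ 2)%:E)%E)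
  @ (0 : R)^' --> (0 : \bar R)%E.

Let w t x := Num.sqrt (p t x) - Num.sqrt (p 0 x) - t / 2 * s x * Num.sqrt (p 0 x).

Let L2_u t (nu : probability T R) :
  (forall B, measurable B -> nu B = (\int[mu]_(x in B) (p t x)%:E)%E) ->
  L2 mu (u t) /\ nrm mu (u t) = 1.
Proof.
move=> nuE; have := L2_density nuE (L2_cst nu 1); have := nrm_density nuE (L2_cst nu 1).
rewrite nrm_cst normr1 => E L; split.
  by move: L; congr (L2 mu _); apply/funext => x; rewrite mul1r.
by rewrite -[RHS]E; congr nrm; apply/funext => x; rewrite mul1r.
Qed.

Let L2_su : L2 mu (fun x => s x * Num.sqrt (p 0 x)).
Proof. exact (L2_density P0E L2s). Qed.

Let L2_w t : (forall B, measurable B -> Pt t B = (\int[mu]_(x in B) (p t x)%:E)%E) ->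
  L2 mu (w t).
Proof.
move=> H; have := L2B (L2B (L2_u H).1 (L2_u P0E).1) (L2Z (t / 2) L2_su).
by congr (L2 mu _); apply/funext => x; rewrite /w mulrA.
Qed.

Let r1 t := nrm mu (w t).

Let r1_small eps : 0 < eps -> \forall t \near (0 : R)^', r1 t <= eps * `|t|.
Proof.
move=> e0; have PtE' : \forall t \near (0 : R)^', forall B, measurable B ->
  Pt t B = (\int[mu]_(x in B) (p t x)%:E)%E by exact: cvg_within PtE.
have e20 : 0 < eps ^+ 2 by rewrite exprn_gt0.
have H := dqm (nbhs_open_ereal_lt (f := fun=> eps ^+ 2) e20).
near=> t.
have t0 : t != 0 by near: t; exact: nbhs_dnbhs_neq.
have E : forall B, measurable B -> Pt t B = (\int[mu]_(x in B) (p t x)%:E)%E by near: t.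
have Lw := L2_w E.
have : ((t ^- 2)%:E * \int[mu]_x (w t x ^+ 2)%:E < (eps ^+ 2)%:E)%E by near: t; exact: H.
rewrite -[X in (_ * X < _)%E]fineK; last by case: Lw => _; exact: integrable_fin_num.
rewrite -EFinM lte_fin -/(Rintegral mu setT (fun x => w t x ^+ 2)) -nrm_sqr.
have t2 : 0 < t ^+ 2 by rewrite lt_def sqrf_eq0 t0 sqr_ge0.
rewrite mulrC ltr_pdivrMr// => /ltW.
rewrite -(real_normK (num_real t)) -exprMn ler_pXn2r// nnegrE ?nrm_ge0//.
by rewrite mulr_ge0// ltW.
Unshelve. all: by end_near. Qed.

(** With u_t = sqrt(p_t), p_t - p_0 = (u_0 + u_t)(u_t - u_0) and u_t - u_0 = w_t + (t/2) s u_0. For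
    [close], Cauchy-Schwarz places f on the sum and h on the difference, so that h stays with the
    score. *)
Lemma dqm_bounds : exists r : R -> R, [/\ forall t, 0 <= r t,
  forall eps, 0 < eps -> \forall t \near (0 : R)^', r t <= eps * `|t|,
  \forall t \near (0 : R)^', close s P0 P0 (Pt t) `|t| (r t) &
  \forall t \near (0 : R)^', forall (f : T -> R) (k : R),
    measurable_fun setT f -> (forall x, `|f x| <= k) ->
    `|\int[Pt t]_x f x - \int[P0]_x f x - t * \int[P0]_x (f x * s x)| <= k * r t].
Proof.
pose N := nrm P0 s; have N0 : 0 <= N := nrm_ge0 _ _.
(* The first summand bounds w_t against u_0 + u_t, of norm at most 2; the second is the second-order
   term of the linear expansion. In particular r1 <= r, which is all that [close] uses. *)
pose r t := 2 * r1 t + `|t| / 2 * N * (r1 t + `|t| / 2 * N).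
have r10 t : 0 <= r1 t := nrm_ge0 _ _.
have t20 (t : R) : 0 <= `|t| / 2 * N by rewrite mulr_ge0.
have PtE' : \forall t \near (0 : R)^', forall B, measurable B ->
  Pt t B = (\int[mu]_(x in B) (p t x)%:E)%E by exact: cvg_within PtE.
have [Lu0 nu0] := L2_u P0E.
exists r; split.
- by move=> t; rewrite /r addr_ge0 ?mulr_ge0 ?addr_ge0.
- move=> eps e0.
  have e4 : 0 < eps / 4 by rewrite divr_gt0.
  have a0 : 0 < N * (1 + N) + 1 by rewrite ltr_wpDl// mulr_ge0// addr_ge0.
  have e5 : 0 < eps / (N * (1 + N) + 1) by rewrite divr_gt0.
  near=> t.
  have r1e : r1 t <= eps / 4 * `|t| by near: t; exact: r1_small.
  have r11 : r1 t <= 1 * `|t| by near: t; exact: r1_small.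
  have te : `|t| <= eps / (N * (1 + N) + 1) by near: t; exact: dnbhs0_le.
  have H1 : `|t| * (N * (1 + N)) <= eps.
    move: te; rewrite ler_pdivlMr//; apply: le_trans; rewrite ler_wpM2l// lerDl//.
  have H2 : `|t| * (`|t| * (N * (1 + N))) <= `|t| * eps by rewrite ler_wpM2l.
  have H3 : `|t| / 2 * N * (r1 t + `|t| / 2 * N) <= `|t| / 2 * N * (`|t| + `|t| * N).
    rewrite ler_wpM2l// lerD ?mul1r//; first by rewrite mul1r in r11.
    by rewrite ler_wpM2r// ler_pdivrMr// ler_peMr// ler1n.
  have E : `|t| / 2 * N * (`|t| + `|t| * N) = `|t| * (`|t| * (N * (1 + N))) / 2 by field.
  rewrite /r; move: H3; rewrite E; lra.
- near=> t => h f k mh hk Lf Lft.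
  have H : forall B, measurable B -> Pt t B = (\int[mu]_(x in B) (p t x)%:E)%E by near: t.
  have Lfu := L2_density H Lft; have Lfu0 := L2_density P0E Lf.
  have nfu := nrm_density H Lft; have nfu0 := nrm_density P0E Lf.
  have Lhs : L2 P0 (fun x => h x * s x) := L2_bddM mh hk L2s.
  have Lhsu := L2_density P0E Lhs; have nhsu := nrm_density P0E Lhs.
  have Lw := L2_w H.
  have Lhw := L2_bddM mh hk Lw; have nhw := nrm_bddM mh hk Lw.
  have Lthsu := L2Z (t / 2) Lhsu.
  have if1 := intg_bddM mh hk (intg_L2 Lft); have if0 := intg_bddM mh hk (intg_L2 Lf).
  rewrite (Rintegral_density (mp t) (p0 t) H if1) (Rintegral_density (mp 0) (p0 0) P0E if0).
  rewrite -RintegralB//; last 2 first.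
  - by apply/(integrable_density (mp t) (p0 t) H) => //; exact: intg_meas if1.
  - by apply/(integrable_density (mp 0) (p0 0) P0E) => //; exact: intg_meas if0.
  rewrite (_ : \int[mu]_x _ = \int[mu]_x ((f x * Num.sqrt (p 0 x) + f x * Num.sqrt (p t x))
     * (h x * w t x + t / 2 * (h x * s x * Num.sqrt (p 0 x))))); last first.
    apply: eq_Rintegral => x _; rewrite -{1}(sq_u t x) -{1}(sq_u 0 x) /w; ring.
  apply: le_trans (cauchy_schwarz (L2D Lfu0 Lfu) (L2D Lhw Lthsu)) _.
  rewrite ler_pM ?nrm_ge0//.
    by apply: le_trans (nrmD Lfu0 Lfu) _; rewrite nfu nfu0.
  apply: le_trans (nrmD Lhw Lthsu) _; rewrite nrmZ// nhsu addrC lerD//.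
    rewrite ler_wpM2r ?nrm_ge0// normrM (ger0_norm (_ : 0 <= 2^-1)) ?invr_ge0//.
    by rewrite ler_pdivrMr// ler_peMr// ler1n.
  have k0 : 0 <= k by apply: le_trans (hk point).
  apply: le_trans nhw _; rewrite (ger0_norm k0) ler_wpM2l//.
  have rr : r1 t <= r t.
    have : 0 <= `|t| / 2 * N * (r1 t + `|t| / 2 * N) by rewrite mulr_ge0// addr_ge0.
    by rewrite /r; have := r10 t; lra.
  exact: rr.
- near=> t => f k mf fk.
  have H : forall B, measurable B -> Pt t B = (\int[mu]_(x in B) (p t x)%:E)%E by near: t.
  have [Lu nu1] := L2_u H; have Lw := L2_w H.
  have Lf (S : probability T R) : L2 S f.
    by apply: (L2_le mf (L2_cst S k)) => x; exact: le_trans (fk x) (ler_norm _).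
  have k0 : 0 <= k by apply: le_trans (fk point).
  have if1 := intg_L2 (Lf (Pt t)); have if0 := intg_L2 (Lf P0).
  have ifs := L2M (Lf P0) L2s.
  rewrite (Rintegral_density (mp t) (p0 t) H if1) (Rintegral_density (mp 0) (p0 0) P0E if0).
  rewrite (Rintegral_density (mp 0) (p0 0) P0E ifs).
  have j1 := (integrable_density (mp t) (p0 t) H mf).1 if1.
  have j0 := (integrable_density (mp 0) (p0 0) P0E mf).1 if0.
  have js := (integrable_density (mp 0) (p0 0) P0E (intg_meas ifs)).1 ifs.
  have Lfw := L2_bddM mf fk Lw; have Lfsu := L2_bddM mf fk L2_su.
  have Lut := L2D Lu0 Lu.
  have Ld : L2 mu (fun x => w t x + t / 2 * (s x * Num.sqrt (p 0 x))) := L2D Lw (L2Z (t / 2) L2_su).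
  (* In the score term u_0 + u_t is written 2 u_0 + (u_t - u_0): the first part is t E_0[f s], the
     second carries t/2 and the further factor u_t - u_0 of order t. *)
  have E : \int[mu]_x (f x * p t x) - \int[mu]_x (f x * p 0 x) -
      t * \int[mu]_x (f x * s x * p 0 x) =
    \int[mu]_x ((f x * w t x) * (Num.sqrt (p 0 x) + Num.sqrt (p t x))) +
    t / 2 * \int[mu]_x ((f x * (s x * Num.sqrt (p 0 x))) *
      (w t x + t / 2 * (s x * Num.sqrt (p 0 x)))).
    have i1 := L2M Lfw Lut; have i2 := L2M Lfsu Ld.
    rewrite -RintegralZl// -RintegralB// -RintegralZl// -RintegralB//; [|exact: intgB|exact: intgZ].
    rewrite -RintegralD//; last exact: intgZ.
    apply: eq_Rintegral => x _; rewrite -{1}(sq_u t x) -{1 2}(sq_u 0 x) /w; by field.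
  rewrite E; apply: le_trans (ler_normD _ _) _.
  have H1 := cauchy_schwarz Lfw Lut; have H2 := cauchy_schwarz Lfsu Ld.
  have n1 : nrm mu (fun x => Num.sqrt (p 0 x) + Num.sqrt (p t x)) <= 2.
    by apply: le_trans (nrmD Lu0 Lu) _; rewrite nu0 nu1.
  have n2 : nrm mu (fun x => f x * w t x) <= k * r1 t.
    by have := nrm_bddM mf fk Lw; rewrite (ger0_norm k0).
  have nsu : nrm mu (fun x => s x * Num.sqrt (p 0 x)) = N by exact (nrm_density P0E L2s).
  have n3 : nrm mu (fun x => f x * (s x * Num.sqrt (p 0 x))) <= k * N.
    by have := nrm_bddM mf fk L2_su; rewrite (ger0_norm k0) nsu.
  have n4 : nrm mu (fun x => w t x + t / 2 * (s x * Num.sqrt (p 0 x))) <= r1 t + `|t| / 2 * N.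
    apply: le_trans (nrmD Lw (L2Z (t / 2) L2_su)) _; rewrite nrmZ// nsu lerD2l.
    by rewrite normrM (ger0_norm (_ : 0 <= 2^-1)) ?invr_ge0.
  have H3 : `|\int[mu]_x ((f x * w t x) * (Num.sqrt (p 0 x) + Num.sqrt (p t x)))| <= k * r1 t * 2.
    by apply: le_trans H1 _; rewrite ler_pM ?nrm_ge0.
  have H4 : `|\int[mu]_x ((f x * (s x * Num.sqrt (p 0 x))) *
      (w t x + t / 2 * (s x * Num.sqrt (p 0 x))))| <= k * N * (r1 t + `|t| / 2 * N).
    by apply: le_trans H2 _; rewrite ler_pM ?nrm_ge0.
  have H5 : `|t / 2| * `|\int[mu]_x ((f x * (s x * Num.sqrt (p 0 x))) *
      (w t x + t / 2 * (s x * Num.sqrt (p 0 x))))| <= `|t| / 2 * (k * N * (r1 t + `|t| / 2 * N)).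
    by rewrite normrM (ger0_norm (_ : 0 <= 2^-1)) ?invr_ge0// ler_wpM2l// mulr_ge0.
  rewrite [`|t / 2 * _|]normrM; apply: le_trans (lerD H3 H5) _.
  by rewrite le_eqVlt /r; apply/orP; left; apply/eqP; ring.
Unshelve. all: by end_near. Qed.

End quadratic_mean.

(** * Laws that agree on measurable sets *)

Section equal_laws.
Context {d dW : measure_display} {T : measurableType d}
  {TW : measurableType dW} {R : realType}.
Variables (P Q : probability T R).
Hypothesis PQ : forall B, measurable B -> P B = Q B.

Lemma eq_law_integral D (f : T -> \bar R) : (\int[P]_(x in D) f x = \int[Q]_(x in D) f x)%E.
Proof. by apply: eq_measure_integral => A mA _; exact: PQ. Qed.

Lemma eq_law_Rintegral (f : T -> R) : \int[P]_x f x = \int[Q]_x f x.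
Proof. by rewrite /Rintegral eq_law_integral. Qed.

Lemma eq_law_integrable (f : T -> \bar R) : P.-integrable setT f -> Q.-integrable setT f.
Proof. by move=> /integrableP[mf fi]; apply/integrableP; rewrite -eq_law_integral. Qed.

End equal_laws.

(** The chosen versions coincide as functions, because [xget] picks from the same set of versions
    under both laws. *)
Lemma eq_law_condE {d dW : measure_display} {T : measurableType d}
    {TW : measurableType dW} {R : realType} (P Q : probability T R) (W : T -> TW) f :
  (forall B, measurable B -> P B = Q B) -> condE P W f = condE Q W f.
Proof.
move=> PQ; rewrite /condE; congr xget; apply/seteqP; split => g [mg gi gE]; split => //.
- exact: eq_law_integrable PQ _ gi.
- by move=> B mB; rewrite -!(eq_law_integral PQ) gE.
- by apply: eq_law_integrable gi => B mB; rewrite PQ.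
- by move=> B mB; rewrite !(eq_law_integral PQ) gE.
Qed.

Lemma condEP {d dW : measure_display} {T : measurableType d}
    {TW : measurableType dW} {R : realType} (P : probability T R) (W : {mfun T >-> TW}) f :
  intg P f -> is_condE P W f (condE P W f).
Proof. by move=> /(condE_ex W)/(xgetPex (cst 0)). Qed.

Lemma condE_ae_arg {d dW : measure_display} {T : measurableType d}
    {TW : measurableType dW} {R : realType} (P : probability T R) (W : {mfun T >-> TW}) f f' g :
  measurable_fun setT f -> measurable_fun setT f' -> {ae P, forall x, f x = f' x} ->
  is_condE P W f g -> is_condE P W f' g.
Proof.
move=> mf mf' ff' [mg gi gE]; split => // B mB; rewrite gE//; apply: ae_eq_integral.
- by rewrite -[X in measurable X]setTI; exact: measurable_funP.
- by apply: measurable_funTS; exact/measurable_EFinP.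
- by apply: measurable_funTS; exact/measurable_EFinP.
- by apply: filterS ff' => x ->.
Qed.

Lemma L2_ae {d : measure_display} {T : measurableType d} {R : realType}
    (mu : {measure set T -> \bar R}) (f g : T -> R) : measurable_fun setT g ->
  {ae mu, forall x, f x = g x} -> L2 mu f -> L2 mu g.
Proof.
move=> mg fg [mf fi]; split => //; apply: eq_intg_ae fi; first exact: measurable_funX.
by apply: filterS fg => x ->.
Qed.

(** * The influence function as a gradient for the law of the observed data *)

Section observed_data.
Context {R : realType} {M : nat} {dL : measure_display} {TL : measurableType dL}.
Local Notation obs := (R * 'I_M.+1 * R * TL)%type.
Implicit Types (P : probability obs R) (a : 'I_M.+1).

Lemma measurable_obsL : measurable_fun setT (@obsL R M dL TL).
Proof. exact: measurable_snd. Qed.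

Lemma measurable_obsZ : measurable_fun setT (@obsZ R M dL TL).
Proof.
apply: (measurableT_comp (f := fst) (g := fun o : obs => o.1.1)); first exact: measurable_fst.
apply: (measurableT_comp (f := fst) (g := fun o : obs => o.1)); exact: measurable_fst.
Qed.

Lemma measurable_obsY : measurable_fun setT (@obsY R M dL TL).
Proof.
by apply: (measurableT_comp (f := snd) (g := fun o : obs => o.1));
  [exact: measurable_snd|exact: measurable_fst].
Qed.

Lemma measurable_treat a : measurable_fun setT (treat a : obs -> R).
Proof.
have mA : measurable_fun setT (@obsA R M dL TL).
  apply: (measurableT_comp (f := snd) (g := fun o : obs => o.1.1)); first exact: measurable_snd.
  apply: (measurableT_comp (f := fst) (g := fun o : obs => o.1)); exact: measurable_fst.
apply: (measurableT_comp (f := fun i : 'I_M.+1 => (i == a)%:R : R) _ mA).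
by move=> _ B mB.
Qed.

Lemma measurable_treatY a : measurable_fun setT (treatY a : obs -> R).
Proof. by apply: measurable_funM; [exact: measurable_treat|exact: measurable_obsY]. Qed.

Definition obsL_mfun : {mfun obs >-> TL} :=
  HB.pack (@obsL R M dL TL) (isMeasurableFun.Build _ _ _ _ _ measurable_obsL).

(** Z is bounded only almost surely; the clipped variable is bounded at every point and agrees with
    Z under all laws of the path near 0, so one variable serves them all. *)
Definition clipZ (c : R) (o : obs) : R := Num.max (- c) (Num.min c (obsZ o)).

Lemma measurable_clipZ c : measurable_fun setT (clipZ c).
Proof. by have := measurable_obsZ => ?; rewrite /clipZ; meas. Qed.

Lemma clipZ_le c o : 0 <= c -> `|clipZ c o| <= c.
Proof. by move=> c0; rewrite ler_norml le_max lexx/= ge_max ge_min lexx andbT; lra. Qed.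

Lemma clipZ_id c o : `|obsZ o| <= c -> obsZ o = clipZ c o.
Proof. by rewrite ler_norml => /andP[? ?]; rewrite /clipZ min_r// max_r. Qed.

Lemma treat_le1 a (o : obs) : `|treat a o : R| <= 1.
Proof. by rewrite /treat; case: (_ == _); rewrite ?normr1 ?normr0. Qed.

Local Notation nuis a c e := (is_nuisances obsL_mfun (treat a) (treatY a) (clipZ c) c e).

Lemma obs_nuisances P a (c e K : R) : 0 <= c -> 0 < e -> regular_weighting_bounds a c e P ->
  L2 P (treatY a) -> nrm P (treatY a) <= K ->
  exists2 n, nuis a c e P (K + 2 * c * K / e) n &
    psi_MIV a P = \int[P]_o outcome obsL_mfun (treat a) (treatY a) n o /\
    (measurable_fun setT (eif_MIV a P) /\
    {ae P, forall o, eif_MIV a P o =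
      Phi obsL_mfun (treat a) (treatY a) (clipZ c) n n o - psi_MIV a P}).
Proof.
move=> c0 e0 [Zc ke] LX nX.
have mD := measurable_treat a; have mX := measurable_treatY a.
have mZ := measurable_clipZ c; have mZ0 := measurable_obsZ.
have ZE : {ae P, forall o, obsZ o = clipZ c o} by apply: filterS Zc => o; exact: clipZ_id.
have ZE' : {ae P, forall o, clipZ c o = obsZ o} by apply: filterS ZE => o ->.
have bint (V : obs -> R) b : measurable_fun setT V -> (forall x, `|V x| <= b) -> intg P V.
  by move=> mV Vb; apply: intg_L2; apply: (L2_le mV (L2_cst P b)) => x; exact: le_trans (Vb x) (ler_norm _).
have iD := bint _ _ mD (treat_le1 a); have iX := intg_L2 LX.
have iZc := bint _ _ mZ (fun o => clipZ_le o c0).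
have iZ : intg P (@obsZ R M dL TL) by exact: eq_intg_ae iZc.
have mDZc : measurable_fun setT (fun o : obs => treat a o * clipZ c o) by meas.
have mDZ : measurable_fun setT (fun o : obs => treat a o * obsZ o) by meas.
have mXZc : measurable_fun setT (fun o : obs => treatY a o * clipZ c o) by meas.
have mXZ : measurable_fun setT (fun o : obs => treatY a o * obsZ o) by meas.
have DZE : {ae P, forall o, treat a o * obsZ o = treat a o * clipZ c o}.
  by apply: filterS ZE => o ->.
have XZE : {ae P, forall o, treatY a o * obsZ o = treatY a o * clipZ c o}.
  by apply: filterS ZE => o ->.
have iDZ : intg P (fun o : obs => treat a o * obsZ o) := intg_bddM mD (treat_le1 a) iZ.
have iXZ : intg P (fun o : obs => treatY a o * obsZ o).
  have : intg P (fun o : obs => treatY a o * clipZ c o).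
    by under eq_fun do rewrite mulrC; exact: intg_bddM mZ (fun o => clipZ_le o c0) iX.
  by apply: eq_intg_ae => //; apply: filterS XZE => o ->.
have HD := condEP obsL_mfun iD; have HX := condEP obsL_mfun iX.
have HZ := condEP obsL_mfun iZ; have HDZ := condEP obsL_mfun iDZ.
have HXZ := condEP obsL_mfun iXZ.
have HZc := condE_ae_arg mZ0 mZ ZE HZ; have HDZc := condE_ae_arg mDZ mDZc DZE HDZ.
have HXZc := condE_ae_arg mXZ mXZc XZE HXZ.
have [mgD _ _] := HD; have [mgZ _ _] := HZ; have [mgX _ _] := HX.
have [mgDZ _ _] := HDZ; have [mgXZ _ _] := HXZ.
have [n nn [n1 n2 n3 n4 n5]] := nuisances_ex mD mZ (treat_le1 a)
  (fun o => clipZ_le o c0) e0 c0 LX nX HD HZc HX HDZc HXZc ke.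
exists n => //.
have mL := measurable_obsL.
have mkap : measurable_fun setT (kappa P a) by rewrite /kappa /condCov; meas.
have mgam : measurable_fun setT (gamma P a) by rewrite /gamma /condCov; meas.
have mkapL : measurable_fun setT (fun o : obs => kappa P a (obsL o)) by exact: measurableT_comp.
have mgamL : measurable_fun setT (fun o : obs => gamma P a (obsL o)) by exact: measurableT_comp.
have mdelL : measurable_fun setT (fun o : obs => delta P a (obsL o)) by exact: measurableT_comp.
have metaL : measurable_fun setT (fun o : obs => Defs.eta P a (obsL o)) by exact: measurableT_comp.
have mrhoL : measurable_fun setT (fun o : obs => rho P (obsL o)) by exact: measurableT_comp.
have psiE : psi_MIV a P = \int[P]_o outcome obsL_mfun (treat a) (treatY a) n o.
  apply: eq_Rintegral_ae; first by meas.
    exact: (measurable_outcome mD mX nn).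
  near=> o; rewrite /outcome.
  suff -> : n_gam n (obsL_mfun o) = gamma P a (obsL o) by [].
  by near: o; exact: n5.
split => //; split; first by rewrite /eif_MIV; meas.
near=> o; rewrite /eif_MIV /Phi /outcome /xi /resid /wgt.
have -> : n_gam n (obsL_mfun o) = gamma P a (obsL o) by near: o; exact: n5.
have -> : n_del n (obsL_mfun o) = delta P a (obsL o) by near: o; exact: n1.
have -> : n_rho n (obsL_mfun o) = rho P (obsL o) by near: o; exact: n2.
have -> : n_kap n (obsL_mfun o) = kappa P a (obsL o) by near: o; exact: n3.
have -> : n_eta n (obsL_mfun o) = Defs.eta P a (obsL o) by rewrite n4.
have <- : obsZ o = clipZ c o by near: o; exact: ZE.
ring.
Unshelve. all: by end_near. Qed.

Lemma eif_mean_zero P a : regular_weighting a P -> sq_integrable P (treatY a) ->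
  sq_integrable P (eif_MIV a P) /\ \int[P]_o eif_MIV a P o = 0.
Proof.
move=> [c [e [e0 [Zc ke]]]] LX.
(* The bound [c] comes without a sign; |c| is again a bound and is nonnegative. *)
have rw : regular_weighting_bounds a `|c| e P.
  by split => //; apply: filterS Zc => o; move=> /le_trans; apply; exact: ler_norm.
have [n nn [psiE [meif eifE]]] := obs_nuisances (normr_ge0 c) e0 rw LX (lexx _).
have mD := measurable_treat a; have mX := measurable_treatY a.
have mZ := measurable_clipZ `|c|.
have LP := L2_Phi mD mZ (treat_le1 a) (fun o => clipZ_le o (normr_ge0 c)) e0 nn.
have LPp := L2B LP (L2_cst P (psi_MIV a P)).
have E' : {ae P, forall o, Phi obsL_mfun (treat a) (treatY a) (clipZ `|c|) n n o - psi_MIV a P =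
    eif_MIV a P o} by apply: filterS eifE => o ->.
split; first exact: L2_ae meif E' LPp.
have mPp : measurable_fun setT (fun o => Phi obsL_mfun (treat a) (treatY a) (clipZ `|c|) n n o
  - psi_MIV a P) by case: LPp.
rewrite -(eq_Rintegral_ae mPp meif E') RintegralB//; [|exact: intg_L2|exact: finite_measure_integrable_cst].
rewrite Rintegral_cst//= (@probability_setT _ _ _ P) mulr1.
(* With weight and residual of the same law and the full event, the correction term has mean zero
   and only psi - psi remains. *)
have [zi z] := mean_zero_xi_resid e0 nn nn (@measurableT _ TL).
have E1 o : Phi obsL_mfun (treat a) (treatY a) (clipZ `|c|) n n o =
  outcome obsL_mfun (treat a) (treatY a) n o + \1_setT (obsL_mfun o) *
  (xi obsL_mfun (clipZ `|c|) n o * resid obsL_mfun (treat a) (treatY a) n o).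
  by rewrite indicE in_setT mul1r.
under eq_Rintegral do rewrite E1.
rewrite RintegralD//; last exact: (intg_L2 (L2_outcome mD (treat_le1 a) nn)).
by rewrite z addr0 -psiE subrr.
Qed.

Lemma eif_eq_law P (Q : probability obs R) a : (forall B, measurable B -> P B = Q B) ->
  psi_MIV a P = psi_MIV a Q /\ eif_MIV a P = eif_MIV a Q.
Proof.
move=> PQ; have cE f : condE P (@obsL R M dL TL) f = condE Q (@obsL R M dL TL) f.
  exact: eq_law_condE.
have ccE f g : condCov P (@obsL R M dL TL) f g = condCov Q (@obsL R M dL TL) f g.
  by apply/funext => l; rewrite /condCov !cE.
have gE : gamma P a = gamma Q a by apply/funext => l; rewrite /gamma !ccE.
have psiE : psi_MIV a P = psi_MIV a Q by rewrite /psi_MIV gE (eq_law_Rintegral PQ).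
split => //; apply/funext => o.
by rewrite /eif_MIV gE psiE /delta /Defs.eta /rho /kappa !cE !ccE.
Qed.

Lemma eif_gradient ZZ a P0 : regular_weighting a P0 -> sq_integrable P0 (treatY a) ->
  is_influence_gradient ZZ a P0 (eif_MIV a P0).
Proof.
move=> rw LX; have [L2e int0] := eif_mean_zero rw LX; split => // Pt s.
move=> [P0E [L2s [mu [p [mp p0 PtE dqm]]]] _ [c2 Hc2] [c [e [e0 Hce]]]].
have P0E' B : measurable B -> P0 B = Pt 0 B by move=> mB; rewrite P0E.
have [psiE0 eifE0] := eif_eq_law a P0E'.
rewrite eifE0 (eq_law_Rintegral P0E').
have L2s0 : L2 (Pt 0) s.
  by case: L2s => ms si; split => //; exact: eq_law_integrable P0E' _ si.
have P00 : forall B, measurable B -> Pt 0 B = (\int[mu]_(x in B) (p 0 x)%:E)%E.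
  exact: (nbhs_singleton PtE).
have [r [r0 r_small cl lin]] := dqm_bounds mp p0 P00 PtE L2s0 dqm.
pose K := Num.sqrt `|c2|.
have mX := measurable_treatY a; have mD := measurable_treat a.
have mZ := measurable_clipZ `|c|.
have LXt t : (\int[Pt t]_o (treatY a o ^+ 2)%:E <= c2%:E)%E ->
    L2 (Pt t) (treatY a) /\ nrm (Pt t) (treatY a) <= K.
  move=> H; have LXt : L2 (Pt t) (treatY a).
    split => //; apply/integrableP; split; first by apply/measurable_EFinP; meas.
    under eq_integral do rewrite /= ger0_norm ?sqr_ge0//.
    by apply: le_lt_trans H _; rewrite ltry.
  split => //; rewrite ler_sqrt//; apply: le_trans (ler_norm c2).
  rewrite -lee_fin fineK//; case: LXt => _; exact: integrable_fin_num.
have rwt t : regular_weighting_bounds a c e (Pt t) -> regular_weighting_bounds a `|c| e (Pt t).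
  by move=> [Zc ke]; split => //; apply: filterS Zc => o; move=> /le_trans; apply; exact: ler_norm.
pose Kn := K + 2 * `|c| * K / e.
pose good t n := nuis a `|c| e (Pt t) Kn n /\
  psi_MIV a (Pt t) = \int[Pt t]_o outcome obsL_mfun (treat a) (treatY a) n o.
have [LX0 nX0] := LXt _ (nbhs_singleton Hc2).
have [n0 nn0 [psi0 [meif0 eif0]]] := obs_nuisances (normr_ge0 c) e0 (rwt _ (nbhs_singleton Hce)) LX0 nX0.
(* A simultaneous choice for all t; [n0] is a placeholder for those t at which no good functions
   exist, and only t near 0 matter. *)
pose nt t := if pselect (exists n, good t n) is left gt then sval (cid gt) else n0.
have goodt : \forall t \near (0 : R)^', good t (nt t).
  have near1 : \forall t \near (0 : R)^', (\int[Pt t]_o (treatY a o ^+ 2)%:E <= c2%:E)%E.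
    exact: cvg_within Hc2.
  have near2 : \forall t \near (0 : R)^', regular_weighting_bounds a c e (Pt t).
    exact: cvg_within Hce.
  apply: filterS2 near1 near2 => t /LXt[LXt' nXt] /rwt rt.
  have [n nn [psin _]] := obs_nuisances (normr_ge0 c) e0 rt LXt' nXt.
  rewrite /nt; case: pselect => [gt|[]]; last by exists n.
  exact: svalP (cid gt).
have goodn : \forall t \near (0 : R)^', nuis a `|c| e (Pt t) Kn (nt t).
  by apply: filterS goodt => t [].
have PD := pathwise_derivative mD mX mZ (treat_le1 a) (fun o => clipZ_le o (normr_ge0 c)) e0
  L2s0 (normr_ge0 c) r0 r_small cl lin nn0 goodn (psi_MIV a (Pt 0)).
have LP := L2_Phi mD mZ (treat_le1 a) (fun o => clipZ_le o (normr_ge0 c)) e0 nn0.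
have mPhi : measurable_fun setT (Phi obsL_mfun (treat a) (treatY a) (clipZ `|c|) n0 n0) by case: LP.
have [ms _] := L2s.
have -> : \int[Pt 0]_o (eif_MIV a (Pt 0) o * s o) =
    \int[Pt 0]_o ((Phi obsL_mfun (treat a) (treatY a) (clipZ `|c|) n0 n0 o - psi_MIV a (Pt 0)) * s o).
  apply: eq_Rintegral_ae; [by meas|by meas|].
  by apply: filterS eif0 => o ->.
set df := \int[Pt 0]_o _.
have cvgD : h^-1 *: (psi_MIV a (Pt (h *: (1 : R) + 0)) - psi_MIV a (Pt 0)) @[h --> (0 : R)^'] --> df.
  apply/cvgrPdist_le => eps eps0; near=> h.
  have h0 : h != 0 by near: h; exact: nbhs_dnbhs_neq.
  have [_ gh] : good h (nt h) by near: h.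
  have H : `|\int[Pt h]_x outcome obsL_mfun (treat a) (treatY a) (nt h) x -
      \int[Pt 0]_x outcome obsL_mfun (treat a) (treatY a) n0 x - h * df| <= eps * `|h|.
    by near: h; exact: PD.
  rewrite -gh -psi0 in H.
  rewrite addr0 [h *: 1]mulr1.
  have -> : df - h^-1 *: (psi_MIV a (Pt h) - psi_MIV a (Pt 0)) =
      - (h^-1 * (psi_MIV a (Pt h) - psi_MIV a (Pt 0) - h * df)).
    by rewrite /GRing.scale/=; field.
  rewrite normrN normrM normfV mulrC ler_pdivrMr ?normr_gt0//.
apply: DeriveDef.
- by apply/cvg_ex; exists df; exact: cvgD.
- exact: (cvg_lim _ cvgD).
Unshelve. all: by end_near. Qed.

End observed_data.

(** * Tilted laws and their conditional expectations *)

Section tilted_law.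
Context {d : measure_display} {T : measurableType d} {R : realType}.
Variables (P : probability T R) (p : T -> R).
Hypotheses (mp : measurable_fun setT p) (p0 : forall x, 0 <= p x).
Hypothesis p1 : (\int[P]_x (p x)%:E = 1)%E.

Definition tilt of (\int[P]_x (p x)%:E = 1)%E := density P mp p0.

HB.instance Definition _ := Measure.on (tilt p1).
HB.instance Definition _ :=
  Measure_isProbability.Build _ _ _ (tilt p1) (p1 : tilt p1 setT = 1%E).

Lemma tilt_ae (S : T -> Prop) : {ae P, forall x, S x} -> {ae tilt p1, forall x, S x}.
Proof.
move=> [A [mA A0 SA]]; exists A; split => //.
rewrite /tilt /density; apply: null_set_integral => //.
by apply: measurable_funTS; exact/measurable_EFinP.
Qed.

End tilted_law.

Section tilted_conditional_expectation.
Context {d dW : measure_display} {T : measurableType d}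
  {TW : measurableType dW} {R : realType}.
Variables (P : probability T R) (W : {mfun T >-> TW}) (p : T -> R) (tau : R).
Hypotheses (mp : measurable_fun setT p) (p0 : forall x, 0 <= p x).
Hypothesis p1 : (\int[P]_x (p x)%:E = 1)%E.
Hypotheses (p_close : forall x, `|p x - 1| <= tau) (p_half : forall x, 1 / 2 <= p x).

Local Notation Q := (tilt mp p0 p1).

(** For an event B of [W], E_Q[1_B (f - gP)] = E_P[1_B (f - gP)(p - 1)] since E_P[1_B (f - gP)] = 0.
    This is at most 2 b tau P(B), and p >= 1/2 turns P(B) into at most 2 Q(B); [ae_le_cond] then
    gives both inequalities. *)
Lemma tilt_condE (f : T -> R) (b : R) (gP gQ : TW -> R) : measurable_fun setT f ->
  (forall x, `|f x| <= b) -> 0 <= b -> is_condE P W f gP -> is_condE Q W f gQ ->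
  {ae Q, forall x, `|gQ (W x) - gP (W x)| <= 4 * b * tau}.
Proof.
move=> mf fb b0 HP HQ.
have tau0 : 0 <= tau by apply: le_trans (p_close point).
have QE : forall B, measurable B -> Q B = (\int[P]_(x in B) (p x)%:E)%E by [].
have bint (S : probability T R) (V : T -> R) (k : R) : measurable_fun setT V ->
    (forall x, `|V x| <= k) -> intg S V.
  by move=> mV Vb; apply: intg_L2; apply: (L2_le mV (L2_cst S k)) => x; exact: le_trans (Vb x) (ler_norm _).
have ifP := bint P _ _ mf fb; have ifQ := bint (Q : probability T R) _ _ mf fb.
have [mgP igP _] := HP; have [mgQ igQ _] := HQ.
pose g := clip b gP.
have mg : measurable_fun setT g by exact: measurable_clip.
have gb l : `|g l| <= b by exact: clip_le.
have gE : {ae P, forall x, gP (W x) = g (W x)}.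
  have := condE_ae_le HP ifP (aeW _ fb).
  by apply: filterS => x H; rewrite /g clip_id.
have HP' := condE_ae_eq HP mg gE; have gEQ := tilt_ae mp p0 p1 gE.
have mgW : measurable_fun setT (fun x => g (W x)) by meas.
have fgb x : `|f x - g (W x)| <= 2 * b.
  by apply: le_trans (ler_normB _ _) _; have := fb x; have := gb (W x); lra.
have key B : measurable B ->
    `|\int[Q]_x (\1_B (W x) * (f x - g (W x)))| <= 4 * b * tau * \int[Q]_x \1_B (W x).
  move=> mB.
  have m0 : measurable_fun setT (\1_B : TW -> R) by exact: measurable_indic.
  have m1 : measurable_fun setT (fun x => \1_B (W x) : R) by meas.
  have B1 x : `|\1_B (W x) : R| <= 1 by exact: indic_le1.
  have mu : measurable_fun setT (fun x => \1_B (W x) * (f x - g (W x))) by meas.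
  have ub x : `|\1_B (W x) * (f x - g (W x))| <= 2 * b.
    by rewrite normrM -[leRHS]mul1r ler_pM.
  have iuP := bint P _ _ mu ub; have iuQ := bint (Q : probability T R) _ _ mu ub.
  have iBP := bint P _ _ m1 B1; have iBQ := bint (Q : probability T R) _ _ m1 B1.
  have [_ z] : mean_zero P (fun x => \1_B (W x) * (f x - g (W x))).
    by apply: (res_integrable (k := 1)) HP' m0 _ => // l; exact: indic_le1.
  rewrite (Rintegral_density mp p0 QE iuQ) (Rintegral_density mp p0 QE iBQ).
  have pi := (integrable_density mp p0 QE mu).1 iuQ.
  have bi := (integrable_density mp p0 QE m1).1 iBQ.
  rewrite -[X in `|X|]subr0 -z -RintegralB//.
  have mv : measurable_fun setT (fun x => \1_B (W x) * (f x - g (W x)) * p x -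
    \1_B (W x) * (f x - g (W x))) by meas.
  have iv := intgB pi iuP.
  apply: le_trans (le_normr_Rintegral measurableT iv) _.
  rewrite -RintegralZl//; apply: le_Rintegral => //.
  - exact: intg_norm.
  - exact: intgZ.
  move=> x _; rewrite -{2}[_ * (f x - _)]mulr1 -mulrBr normrM.
  rewrite indicE; case: (_ \in _); last by rewrite !mul0r normr0 mul0r mulr0.
  rewrite !mul1r; apply: le_trans (_ : 2 * b * tau <= _).
    by rewrite ler_pM// p_close.
  have b2 : 0 <= 2 * b * tau by rewrite !mulr_ge0.
  rewrite (_ : 4 * b * tau * p x = 2 * b * tau * (2 * p x)); last by ring.
  by rewrite -[leLHS]mulr1; apply: ler_wpM2l => //; have := p_half x; lra.
have side (h : TW -> R) B : measurable B -> measurable_fun setT h -> intg Q (fun x => h (W x)) ->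
    intg Q (fun x => \1_B (W x) * h (W x)).
  move=> mB mh ih.
  have m0 : measurable_fun setT (\1_B : TW -> R) by exact: measurable_indic.
  have m1 : measurable_fun setT (fun x => \1_B (W x) : R) by meas.
  exact: intg_bddM m1 (fun x => indic_le1 B (W x)) ih.
have igW : intg Q (fun x => g (W x)) by exact: (bint (Q : probability T R) _ _ mgW (fun x => gb (W x))).
have ik (k : R) : intg Q (fun=> k) by exact: (intg_L2 (L2_cst (Q : probability T R) k)).
have E B : measurable B -> \int[Q]_x (\1_B (W x) * gQ (W x)) =
    \int[Q]_x (\1_B (W x) * g (W x)) + \int[Q]_x (\1_B (W x) * (f x - g (W x))).
  move=> mB; rewrite (int_indic_cond HQ)//.
  have m0 : measurable_fun setT (\1_B : TW -> R) by exact: measurable_indic.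
  have m1 : measurable_fun setT (fun x => \1_B (W x) : R) by meas.
  rewrite -RintegralD//; [by apply: eq_Rintegral => x _; ring|exact: side|].
  exact: intg_bddM m1 (fun x => indic_le1 B (W x)) (intgB ifQ igW).
have kE B k : measurable B -> \int[Q]_x (\1_B (W x) * (g (W x) + k)) =
    \int[Q]_x (\1_B (W x) * g (W x)) + k * \int[Q]_x \1_B (W x).
  move=> mB; have iB : intg Q (fun x => \1_B (W x) * (1 : R)) by exact: (side (fun=> 1)).
  have iB' : intg Q (fun x => \1_B (W x) : R).
    by move: iB; congr (integrable _ setT _); apply/funext => x /=; rewrite mulr1.
  rewrite -RintegralZl// -RintegralD//; [|exact: side|exact: intgZ].
  by apply: eq_Rintegral => x _; ring.
have up : {ae Q, forall x, gQ (W x) <= g (W x) + 4 * b * tau}.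
  apply: (ae_le_cond (P := Q) (h := fun l => g l + 4 * b * tau)) => //; first by meas.
    by apply: intgD.
  move=> B mB; rewrite E// kE// lerD2l; exact: le_trans (ler_norm _) (key B mB).
have lo : {ae Q, forall x, g (W x) + - (4 * b * tau) <= gQ (W x)}.
  apply: (ae_le_cond (P := Q) (g := fun l => g l + - (4 * b * tau))) => //; first by meas.
    by apply: intgD.
  move=> B mB; rewrite E// kE// lerD2l mulNr; have /ler_normlP[] := key B mB; lra.
near=> x.
have -> : gP (W x) = g (W x) by near: x; exact: gEQ.
have H1 : gQ (W x) <= g (W x) + 4 * b * tau by near: x; exact: up.
have H2 : g (W x) + - (4 * b * tau) <= gQ (W x) by near: x; exact: lo.
by apply/ler_normlP; split; lra.
Unshelve. all: by end_near. Qed.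

End tilted_conditional_expectation.

(** * Linear paths with bounded score *)

Section linear_path.
Context {d : measure_display} {T : measurableType d} {R : realType}.
Variables (P : probability T R) (s : T -> R).
Hypotheses (ms : measurable_fun setT s) (s_le1 : forall x, `|s x| <= 1)
  (s_mean0 : \int[P]_x s x = 0).

(* The clamp makes (1 + t s) P a law for every t; it is inactive near t = 0. *)
Definition clamp (t : R) : R := Num.max (- (1 / 2)) (Num.min (1 / 2) t).

Definition path_density t x : R := 1 + clamp t * s x.

Lemma clamp_le t : `|clamp t| <= 1 / 2.
Proof. by rewrite ler_norml le_max lexx/= ge_max ge_min lexx andbT; lra. Qed.

Lemma clamp_id t : `|t| <= 1 / 2 -> clamp t = t.
Proof. by rewrite ler_norml => /andP[t1 t2]; rewrite /clamp min_r// max_r. Qed.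

Lemma measurable_path_density t : measurable_fun setT (path_density t).
Proof. by rewrite /path_density; meas. Qed.

Lemma path_density_close t x : `|path_density t x - 1| <= `|clamp t|.
Proof. by rewrite /path_density addrC addKr normrM -[leRHS]mulr1 ler_wpM2l. Qed.

Lemma path_density_ge t x : 1 / 2 <= path_density t x.
Proof.
have := path_density_close t x; have := clamp_le t => c1 /ler_normlP[c2 _]; lra.
Qed.

Lemma path_density_le t x : path_density t x <= 2.
Proof.
have := path_density_close t x; have := clamp_le t => c1 /ler_normlP[_ c2]; lra.
Qed.

Lemma path_density_ge0 t x : 0 <= path_density t x.
Proof. by have := path_density_ge t x; lra. Qed.

Lemma intg_score : intg P s.
Proof.
apply: intg_L2; apply: (L2_le ms (L2_cst P 1)) => x.
exact: le_trans (s_le1 x) (ler_norm _).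
Qed.

Lemma path_density_mass t : (\int[P]_x (path_density t x)%:E = 1)%E.
Proof.
have si := intg_score; have i1 := intg_L2 (L2_cst P 1); have si' := intgZ (clamp t) si.
have pi : intg P (path_density t) by exact: intgD.
rewrite -[LHS]fineK; last exact: integrable_fin_num.
rewrite -/(Rintegral P setT (path_density t)) /path_density RintegralD// RintegralZl//.
by rewrite s_mean0 mulr0 addr0 Rintegral_cst//= (@probability_setT _ _ _ P) mulr1.
Qed.

Definition linear_path t : probability T R :=
  tilt (measurable_path_density t) (path_density_ge0 t) (path_density_mass t).

Lemma linear_path0 B : measurable B -> linear_path 0 B = P B.
Proof.
move=> mB; have -> : linear_path 0 B = (\int[P]_(x in B) (path_density 0 x)%:E)%E by [].
under eq_integral do rewrite /path_density clamp_id ?normr0 ?divr_ge0// mul0r addr0.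
by rewrite integral_cst// mul1e.
Qed.

(** For y = sqrt(1 + x) the error is - (y - 1)^2 / 2, while x^2 = (y - 1)^2 (y + 1)^2 and y + 1 >=
    1. *)
Lemma sqrt_taylor (x : R) : `|x| <= 1 / 2 -> `|Num.sqrt (1 + x) - 1 - x / 2| <= x ^+ 2.
Proof.
move=> /ler_normlP[x1 x2]; set y := Num.sqrt (1 + x).
have y2 : y ^+ 2 = 1 + x by rewrite sqr_sqrtr//; lra.
have y0 : 0 <= y by exact: sqrtr_ge0.
have -> : y - 1 - x / 2 = - ((y - 1) ^+ 2 / 2).
  have -> : x = y ^+ 2 - 1 by rewrite y2; ring.
  by field.
have -> : x ^+ 2 = (y - 1) ^+ 2 * (y + 1) ^+ 2.
  have -> : x = y ^+ 2 - 1 by rewrite y2; ring.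
  ring.
rewrite normrN ger0_norm ?divr_ge0 ?sqr_ge0//; apply: ler_wpM2l; first exact: sqr_ge0.
nra.
Qed.

Lemma linear_path_dqm :
  (fun t : R => ((t ^- 2)%:E * \int[P]_x
    ((Num.sqrt (path_density t x) - Num.sqrt (path_density 0 x)
      - t / 2 * s x * Num.sqrt (path_density 0 x)) ^+ 2)%:E)%E)
  @ (0 : R)^' --> (0 : \bar R)%E.
Proof.
have p0E x : path_density 0 x = 1.
  by rewrite /path_density clamp_id ?normr0 ?divr_ge0// mul0r addr0.
(* By [sqrt_taylor] at t s, with |s| <= 1, the integrand is at most t^4, so the normalized integral
   is at most t^2. *)
apply: (@squeeze_cvge _ _ _ _ (cst 0%E) _ (fun t : R => (t ^+ 2)%:E)); last 2 first.
- exact: cvg_cst.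
- apply: cvg_EFin; first by apply: nearW.
  have : (fun t : R => t ^+ 2) @ (0 : R) --> (0 : R) ^+ 2.
    exact: (@exprn_continuous R 2 0).
  rewrite expr0n/= => H; exact: cvg_within_filter H.
near=> t.
have t0 : t != 0 by near: t; exact: nbhs_dnbhs_neq.
have th : `|t| <= 1 / 2 by near: t; apply: dnbhs0_le; rewrite divr_gt0.
have t2 : 0 < t ^+ 2 by rewrite lt_def sqrf_eq0 t0 sqr_ge0.
apply/andP; split.
  apply: mule_ge0; first by rewrite lee_fin invr_ge0 ltW.
  by apply: integral_ge0 => x _; rewrite lee_fin sqr_ge0.
have bound x : (Num.sqrt (path_density t x) - Num.sqrt (path_density 0 x)
      - t / 2 * s x * Num.sqrt (path_density 0 x)) ^+ 2 <= t ^+ 4.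
  rewrite p0E sqrtr1 mulr1 /path_density clamp_id//.
  have xb : `|t * s x| <= `|t| by rewrite normrM -[leRHS]mulr1 ler_wpM2l.
  have := sqrt_taylor (le_trans xb th).
  rewrite (_ : t * s x / 2 = t / 2 * s x); last by ring.
  move=> H; rewrite -(real_normK (num_real (_ - _))).
  rewrite (_ : t ^+ 4 = (t ^+ 2) ^+ 2); last by rewrite -exprM.
  rewrite lerXn2r// ?nnegrE ?sqr_ge0//; apply: le_trans H _.
  by rewrite -(real_normK (num_real (t * s x))) -(real_normK (num_real t)) lerXn2r// nnegrE.
apply: (@le_trans _ _ ((t ^- 2)%:E * \int[P]_x (t ^+ 4)%:E)%E).
  apply: lee_wpmul2l; first by rewrite lee_fin invr_ge0 ltW.
  apply: ge0_le_integral => //.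
  - by move=> x _; rewrite lee_fin sqr_ge0.
  - apply/measurable_EFinP; have mpt := measurable_path_density t.
    have mq : measurable_fun setT (fun x => Num.sqrt (path_density t x)).
      exact: (measurableT_comp (@measurable_sqrtr R)).
    have mq0 : measurable_fun setT (fun x => Num.sqrt (path_density 0 x)).
      exact: (measurableT_comp (@measurable_sqrtr R) (measurable_path_density 0)).
    by meas.
  - by move=> x _; rewrite lee_fin.
rewrite integral_cst//= (@probability_setT _ _ _ P) mule1 -EFinM lee_fin.
by rewrite (_ : t ^+ 4 = t ^+ 2 * t ^+ 2) ?mulKf ?sqrf_eq0// -exprD.
Unshelve. all: by end_near. Qed.

End linear_path.

(** * Uniqueness of the gradient *)

Section uniqueness.
Context {R : realType} {M : nat} {dL : measure_display} {TL : measurableType dL}.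
Local Notation obs := (R * 'I_M.+1 * R * TL)%type.
Variables (ZZ : set R) (a : 'I_M.+1) (P0 : probability obs R).
Hypotheses (mZZ : measurable ZZ) (P0_ZZ : P0 (@obsZ R M dL TL @^-1` ZZ) = 1%E).
Hypotheses (rw : regular_weighting a P0) (LX : sq_integrable P0 (treatY a)).

Section path.
Variable s : obs -> R.
Hypotheses (ms : measurable_fun setT s) (s_le1 : forall x, `|s x| <= 1)
  (s_mean0 : \int[P0]_x s x = 0).

Local Notation Pt := (linear_path ms s_le1 s_mean0).

Let PtE t B : Pt t B = (\int[P0]_(x in B) (path_density s t x)%:E)%E.
Proof. by []. Qed.

Lemma linear_path_kappa (c e : R) : 0 <= c -> 0 < e -> regular_weighting_bounds a c e P0 ->
  \forall t \near (0 : R), regular_weighting_bounds a c (e / 2) (Pt t).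
Proof.
move=> c0 e0 [Zc ke].
have mD : measurable_fun setT (treat a : obs -> R) := measurable_treat a.
have mZ : measurable_fun setT (clipZ c : obs -> R) := measurable_clipZ c.
have mZ0 : measurable_fun setT (@obsZ R M dL TL) := measurable_obsZ.
have mDZ : measurable_fun setT (fun o : obs => treat a o * obsZ o) by meas.
have mDZc : measurable_fun setT (fun o : obs => treat a o * clipZ c o) by meas.
have Zl (o : obs) : `|clipZ c o| <= c by exact: clipZ_le.
have Dl : forall o : obs, `|treat a o : R| <= 1 := treat_le1 a.
have DZl (o : obs) : `|treat a o * clipZ c o| <= c by rewrite normrM -[leRHS]mul1r ler_pM.
have versions (S : probability obs R) : {ae S, forall o, `|obsZ o| <= c} ->
    [/\ is_condE S obsL_mfun (treat a) (condE S (@obsL R M dL TL) (treat a)),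
        is_condE S obsL_mfun (clipZ c) (condE S (@obsL R M dL TL) obsZ) &
        is_condE S obsL_mfun (fun o : obs => treat a o * clipZ c o)
          (condE S (@obsL R M dL TL) (fun o : obs => treat a o * obsZ o))].
  move=> ZcS.
  have ZE : {ae S, forall o, obsZ o = clipZ c o} by apply: filterS ZcS => o; exact: clipZ_id.
  have DZE : {ae S, forall o, treat a o * obsZ o = treat a o * clipZ c o}.
    by apply: filterS ZE => o ->.
  have bint (V : obs -> R) b : measurable_fun setT V -> (forall x, `|V x| <= b) -> intg S V.
    by move=> mV Vb; apply: intg_L2; apply: (L2_le mV (L2_cst S b)) => x; exact: le_trans (Vb x) (ler_norm _).
  split.
  - exact: (condEP obsL_mfun (bint _ _ mD Dl)).
  - apply: (condE_ae_arg mZ0 mZ ZE); apply: (condEP obsL_mfun).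
    by apply: eq_intg_ae (bint _ _ mZ Zl) => //; apply: filterS ZE => o ->.
  - apply: (condE_ae_arg mDZ mDZc DZE); apply: (condEP obsL_mfun).
    by apply: eq_intg_ae (bint _ _ mDZc DZl) => //; apply: filterS DZE => o ->.
have c13 : 0 < 24 * c + 1 by lra.
(* The three conditional means move kappa by at most 4 c |t| each, 12 c |t| in all, which must not
   exceed e / 2: hence 24 c. The added 1 keeps the denominator positive when c = 0, and 1 / 2 keeps
   the clamp inactive. *)
have ec : 0 < Num.min (1 / 2) (e / (24 * c + 1)) by rewrite lt_min !divr_gt0.
near=> t.
have : `|t| <= Num.min (1 / 2) (e / (24 * c + 1)) by near: t; exact: (@nbhs0_le _ R _ ec).
rewrite le_min => /andP[th te].
have ct := clamp_id th.
have aePt S : {ae P0, forall o, S o} -> {ae Pt t, forall o, S o}.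
  exact: tilt_ae.
have ZcT := aePt _ Zc; split => //.
have [HD HZ HDZ] := versions P0 Zc; have [HDt HZt HDZt] := versions (Pt t) ZcT.
have close x : `|path_density s t x - 1| <= `|t|.
  by rewrite -{2}ct; exact: path_density_close.
have half x : 1 / 2 <= path_density s t x by exact: path_density_ge.
have dD := tilt_condE close half mD Dl ler01 HD HDt.
have dZ := tilt_condE close half mZ Zl c0 HZ HZt.
have dDZ := tilt_condE close half mDZc DZl c0 HDZ HDZt.
have bint (S : probability obs R) (V : obs -> R) b : measurable_fun setT V ->
    (forall x, `|V x| <= b) -> intg S V.
  by move=> mV Vb; apply: intg_L2; apply: (L2_le mV (L2_cst S b)) => x; exact: le_trans (Vb x) (ler_norm _).
have bDt := condE_ae_le HDt (bint (Pt t) _ _ mD Dl) (aeW _ Dl).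
have bZ := aePt _ (condE_ae_le HZ (bint P0 _ _ mZ Zl) (aeW _ Zl)).
have keT := aePt _ ke.
near=> o.
have H1 : `|condE (Pt t) (@obsL R M dL TL) (treat a) (obsL o)
  - condE P0 (@obsL R M dL TL) (treat a) (obsL o)| <= 4 * 1 * `|t| by near: o; exact: dD.
have H2 : `|condE (Pt t) (@obsL R M dL TL) obsZ (obsL o)
  - condE P0 (@obsL R M dL TL) obsZ (obsL o)| <= 4 * c * `|t| by near: o; exact: dZ.
have H3 : `|condE (Pt t) (@obsL R M dL TL) (fun o : obs => treat a o * obsZ o) (obsL o)
  - condE P0 (@obsL R M dL TL) (fun o : obs => treat a o * obsZ o) (obsL o)| <= 4 * c * `|t|.
  by near: o; exact: dDZ.
have H4 : `|condE (Pt t) (@obsL R M dL TL) (treat a) (obsL o)| <= 1 by near: o; exact: bDt.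
have H5 : `|condE P0 (@obsL R M dL TL) obsZ (obsL o)| <= c by near: o; exact: bZ.
have H6 : e <= `|kappa P0 a (obsL o)| by near: o; exact: keT.
move: H1 H2 H3 H4 H5 H6; rewrite /kappa /condCov.
move: (condE (Pt t) _ (treat a) _) (condE P0 _ (treat a) _) => dt d0.
move: (condE (Pt t) _ obsZ _) (condE P0 _ obsZ _) => zt z0.
move: (condE (Pt t) _ _ _) (condE P0 _ _ _) => qt q0 H1 H2 H3 H4 H5 H6.
have E : q0 - d0 * z0 = (qt - dt * zt) - (qt - q0) + (dt * (zt - z0) + z0 * (dt - d0)) by ring.
have H7 : `|dt * (zt - z0) + z0 * (dt - d0)| <= 1 * (4 * c * `|t|) + c * (4 * 1 * `|t|).
  by apply: le_trans (ler_normD _ _) _; rewrite !normrM lerD// ler_pM.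
have H8 : `|q0 - d0 * z0| <= `|qt - dt * zt| + `|qt - q0| + `|dt * (zt - z0) + z0 * (dt - d0)|.
  by rewrite E; apply: le_trans (ler_normD _ _) _; rewrite lerD2r ler_normB.
have H9 : 24 * c * `|t| <= e.
  move: te; rewrite ler_pdivlMr// mulrC; apply: le_trans.
  by rewrite ler_wpM2r// lerDl.
have E2 : 1 * (4 * c * `|t|) + c * (4 * 1 * `|t|) = 8 * (c * `|t|) by ring.
have E3 : 24 * c * `|t| = 24 * (c * `|t|) by ring.
have E4 : 4 * c * `|t| = 4 * (c * `|t|) by ring.
rewrite E2 in H7; rewrite E3 in H9; rewrite E4 in H3.
lra.
Unshelve. all: by end_near. Qed.

Lemma linear_path_regular : regular_submodel ZZ a P0 Pt s.
Proof.
have mX : measurable_fun setT (treatY a : obs -> R) := measurable_treatY a.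
have L2s : L2 P0 s.
  by apply: (L2_le ms (L2_cst P0 1)) => x; exact: le_trans (s_le1 x) (ler_norm _).
split.
- exact: linear_path0.
- split; first exact: L2s.
  exists (P0 : {sigma_finite_measure set obs -> \bar R}), (path_density s); split.
  + exact: measurable_path_density.
  + exact: path_density_ge0.
  + by apply: (@nearW _ (nbhs (0 : R))) => t B mB.
  + exact: linear_path_dqm.
- apply: (@nearW _ (nbhs (0 : R))) => t.
  have mB : measurable (@obsZ R M dL TL @^-1` ZZ).
    by rewrite -[X in measurable X]setTI; exact: measurable_obsZ.
  have : {ae P0, forall o, ZZ (obsZ o)}.
    exists (~` (@obsZ R M dL TL @^-1` ZZ)); split => //; first exact: measurableC.
    by rewrite probability_setC// P0_ZZ subee.
  move=> /(tilt_ae (measurable_path_density ms t) (path_density_ge0 s_le1 t)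
    (path_density_mass ms s_le1 s_mean0 t)) [N [mN N0 sN]].
  apply/eqP; rewrite eq_le probability_le1//=.
  (* Null events of [P0] stay null under the tilt, so the event that Z lies in [ZZ] keeps mass
     one. *)
  have -> : (1 = Pt t (~` N))%E by rewrite probability_setC// (N0 : Pt t N = 0%E) sube0.
  apply: le_measure; rewrite ?inE//; first exact: measurableC.
  by move=> o /= No; apply: contrapT => nZ; apply: No; exact: sN.
- exists (2 * \int[P0]_o (treatY a o ^+ 2)); apply: (@nearW _ (nbhs (0 : R))) => t.
  have [_ iX2] := LX.
  rewrite (@ge0_integral_density _ _ _ P0 (Pt t) (path_density s t))//; first last.
  + by move=> o; rewrite lee_fin sqr_ge0.
  + by apply/measurable_EFinP; meas.
  + exact: path_density_ge0.
  + exact: measurable_path_density.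
  rewrite EFinM fineK; last exact: integrable_fin_num.
  rewrite -ge0_integralZl//; [|by apply/measurable_EFinP; meas|by move=> o _; rewrite lee_fin sqr_ge0].
  have mpt := measurable_path_density ms t.
  apply: ge0_le_integral => //.
  + by move=> o _; rewrite mule_ge0// lee_fin ?sqr_ge0// path_density_ge0.
  + by apply/measurable_EFinP; meas.
  + by apply/measurable_EFinP; meas.
  + by move=> o _; rewrite -EFinM lee_fin mulrC ler_wpM2r ?sqr_ge0// path_density_le.
- have [c [e [e0 [Zc ke]]]] := rw.
  exists `|c|, (e / 2); split; first by rewrite divr_gt0.
  apply: linear_path_kappa => //; split => //.
  by apply: filterS Zc => o; move=> /le_trans; apply; exact: ler_norm.
Qed.

End path.

Lemma influence_gradient_unique phi phi' : is_influence_gradient ZZ a P0 phi ->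
  is_influence_gradient ZZ a P0 phi' -> {ae P0, forall o, phi' o = phi o}.
Proof.
move=> [Lp ip dp] [Lp' ip' dp'].
pose f o := phi' o - phi o.
have L2f : L2 P0 f by exact: L2B.
have [mf _] := L2f; have fi := intg_L2 L2f.
have if0 : \int[P0]_o f o = 0.
  by rewrite RintegralB//; [rewrite ip ip' subrr|exact: (intg_L2 Lp')|exact: (intg_L2 Lp)].
pose A := [set o | 0 < f o].
have mA : measurable A by apply: (measurable_set_lt (f := fun=> 0) (g := f)); meas.
have m1 : measurable_fun setT (\1_A : obs -> R) by exact: measurable_indic.
have A1 o : `|\1_A o : R| <= 1 by rewrite indicE; case: (_ \in _); rewrite ?normr1 ?normr0.
have A01 o : 0 <= (\1_A o : R) <= 1 by rewrite indicE; case: (_ \in _); rewrite /= ?lexx ?ler01.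
have i1 : intg P0 (\1_A : obs -> R).
  apply: intg_L2; apply: (L2_le m1 (L2_cst P0 1)) => x; exact: le_trans (A1 x) (ler_norm _).
pose k := \int[P0]_o (\1_A o : R).
have k01 : 0 <= k <= 1.
  apply/andP; split; first by apply: Rintegral_ge0 => o _; have /andP[] := A01 o.
  have -> : 1 = \int[P0]_o (1 : R).
    by rewrite Rintegral_cst//= (@probability_setT _ _ _ P0) mulr1.
  apply: le_Rintegral; [by []|exact: i1|exact: (intg_L2 (L2_cst P0 1))|].
  by move=> o _; have /andP[] := A01 o.
(* Subtracting the mass of [A] centres the indicator; both lie in [0, 1], so [s] is bounded by 1 as
   the linear path requires. *)
pose s o : R := \1_A o - k.
have ms : measurable_fun setT s by rewrite /s; meas.
have sb o : `|s o| <= 1.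
  by have /andP[? ?] := A01 o; have /andP[? ?] := k01; apply/ler_normlP; rewrite /s; split; lra.
have ik : intg P0 (fun=> k) := intg_L2 (L2_cst P0 k).
have s0 : \int[P0]_o s o = 0.
  by rewrite RintegralB// Rintegral_cst//= (@probability_setT _ _ _ P0) mulr1 subrr.
have reg := linear_path_regular ms sb s0.
have L2s : L2 P0 s.
  by apply: (L2_le ms (L2_cst P0 1)) => x; exact: le_trans (sb x) (ler_norm _).
(* Both sides are the derivative at 0 of the same function of t along the linear path. *)
have E : \int[P0]_o (phi o * s o) = \int[P0]_o (phi' o * s o).
  have D1 := dp _ _ reg; have D2 := dp' _ _ reg.
  by rewrite -(@derive_val _ _ _ _ _ _ _ D1) -(@derive_val _ _ _ _ _ _ _ D2).
have fA : \int[P0]_o (\1_A o * f o) = 0.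
  have : \int[P0]_o (f o * s o) = 0.
    rewrite (_ : \int[P0]_o _ = \int[P0]_o (phi' o * s o - phi o * s o)); last first.
      by apply: eq_Rintegral => o _; rewrite /f; ring.
    by rewrite RintegralB ?E ?subrr//; [exact: (L2M Lp' L2s)|exact: (L2M Lp L2s)].
  have iAf := intg_bddM m1 A1 fi.
  rewrite (_ : \int[P0]_o _ = \int[P0]_o (\1_A o * f o - k * f o)); last first.
    by apply: eq_Rintegral => o _; rewrite /s; ring.
  by rewrite RintegralB// ?RintegralZl// ?if0 ?mulr0 ?subr0//; exact: intgZ.
have iAf := intg_bddM m1 A1 fi.
(* Since [f] and [\1_A * f] both have mean zero, this identity gives E|f| = 0. *)
have absE o : `|f o| = 2 * (\1_A o * f o) - f o.
  rewrite indicE; case: (boolP (o \in A)) => [|].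
    by rewrite inE /A/= => f0; rewrite gtr0_norm// mul1r; ring.
  rewrite notin_setE /A/= => /negP; rewrite -leNgt => f0.
  by rewrite ler0_norm// mul0r mulr0 sub0r.
have iabs : \int[P0]_o `|f o| <= 0.
  under eq_Rintegral do rewrite absE.
  by rewrite RintegralB//; [rewrite RintegralZl// fA if0 mulr0 subrr|exact: intgZ].
have := ae_eq0_ge0 (intg_norm fi) (fun o => normr_ge0 (f o)) iabs.
by apply: filterS => o /normr0_eq0 /eqP; rewrite subr_eq0 => /eqP.
Qed.

End uniqueness.

Theorem theoremB2 (R : realType) (M : nat)
    (dO dU dL : measure_display) (Omega : measurableType dO)
    (TU : measurableType dU) (TL : measurableType dL)
    (P : probability Omega R)
    (ZZ : set R) (mZZ : measurable ZZ)
    (Z : {RV P >-> R}) (A : {RV P >-> 'I_M.+1}) (U : {RV P >-> TU})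
    (L : {RV P >-> TL}) (Y : {RV P >-> R})
    (Ypot : 'I_M.+1 -> {RV P >-> R})
    (Z_in_ZZ : forall w, ZZ (Z w))
    (consistency : {ae P, forall w, Y w = Ypot (A w) w})
    (latent_ignorability : forall a' : 'I_M.+1,
      cond_indep P (Ypot a') (fun w => (A w, Z w)) (fun w => (U w, L w)))
    (iv_independence : cond_indep P Z U L)
    (iv_relevance : iv_relevant P Z A L)
    (P0 : probability (obs_type R M TL) R)
    (P0_law : has_law P (fun w => (Z w, A w, Y w, L w) : obs_type R M TL) P0)
    (a : 'I_M.+1)
    (regular_Z : regular_weighting a P0)
    (treatY_L2 : sq_integrable P0 (treatY a)) :
  is_efficient_influence_function ZZ a P0 (eif_MIV a P0).
Proof.
(* The range of the instrument becomes an event of mass one for the observed law, the form in which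
   submodels must preserve it. *)
have P0_ZZ : P0 (@obsZ R M dL TL @^-1` ZZ) = 1%E.
  rewrite P0_law; last by rewrite -[X in measurable X]setTI; exact: measurable_obsZ.
  rewrite (_ : _ @^-1` _ = setT) ?probability_setT//.
  by apply/seteqP; split => // w _; exact: Z_in_ZZ.
have grad := @eif_gradient R M dL TL ZZ a P0 regular_Z treatY_L2.
split => // phi' grad'.
exact: (influence_gradient_unique mZZ P0_ZZ regular_Z treatY_L2 grad grad').
Qed.
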